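(* Let $Y\to Z\xrightarrow{\pi_Z} X$ be finite morphisms between real affine varieties. Then the restriction $\widetilde{\pi_Z} : \pi_{Z(\mathbb{C})}^{-1}(X(\mathbb{R})) \to X(\mathbb{R})$ of the morphism $\pi_{Z(\mathbb{C})} : Z(\mathbb{C})\to X(\mathbb{C})$ is bijective if and only if there exists a morphism $\pi_Z^+ : X^{R+}_Y \to Z$ such that $\pi_Z\circ\pi^+_Z = \pi^+$. Moreover $\pi^+_Z$ is unique and the restriction $\widetilde{\pi^+_Z} : (\pi^+_Z)^{-1}(Z(\mathbb{R})) \to Z(\mathbb{R})$ of the morphism $\pi^+_Z : X^{R+}_Y(\mathbb{C}) \to Z(\mathbb{C})$ is bijective.
   Context: Rings are commutative with unit. An ideal $I$ of a ring $A$ is real if $\sum a_i^2\in I$ (finite sum) implies that every $a_i\in I$; $\mathrm{R\text{-}Spec}(A)$ is the set of real prime ideals of $A$. For an integral extension $A\hookrightarrow B$ put $A_B^{R+}=\{b\in B\mid \forall \mathfrak{p}\in\mathrm{R\text{-}Spec}(A),\ b_{\mathfrak p}\in A_{\mathfrak p}+\mathrm{Rad}(B_{\mathfrak p})\}$, where $B_{\mathfrak p}=(A\setminus\mathfrak p)^{-1}B$, $b_{\mathfrak p}$ is the image of $b$ in $B_{\mathfrak p}$, and $\mathrm{Rad}$ is the Jacobson radical. A real affine variety is $X=\mathrm{Spec}(\mathbb{R}[X])$ with $\mathbb{R}[X]\simeq\mathbb{R}[x_1,\dots,x_n]/I$ and $I$ a real ideal (possibly reducible). $X(\mathbb{R})$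 is its set of real closed points (maximal ideals with residue field $\mathbb{R}$), and $X(\mathbb{C})$ is the set of closed points of its complexification (coordinate ring $\mathbb{R}[X]\otimes_{\mathbb{R}}\mathbb{C}$), so $X(\mathbb{R})\subset X(\mathbb{C})$. A morphism $\pi:Y\to X$ of real affine varieties induces $\pi^*:\mathbb{R}[X]\hookrightarrow\mathbb{R}[Y]$; morphisms are understood to be dominant, that is, with $\pi^*$ injective. The morphism $\pi$ is finite if $\pi^*$ makes $\mathbb{R}[Y]$ a finite $\mathbb{R}[X]$-module. The R-seminormalization of $X$ in $Y$, for $Y\to X$ finite, is $X^{R+}_Y=\mathrm{Spec}\big(\mathbb{R}[X]^{R+}_{\mathbb{R}[Y]}\big)$; here $Y\to X$ is the composite $Y\to Z\to X$. The inclusions $\mathbb{R}[X]\hookrightarrow\mathbb{R}[X]^{R+}_{\mathbb{R}[Y]}\hookrightarrow\mathbb{R}[Y]$ give morphisms $Y\to X^{R+}_Y\xrightarrow{\pi^+}X$. *)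

(* Defs.v *)
From HB Require Import structures.
From mathcomp Require Import all_boot all_order all_algebra generic_quotient ring.
From mathcomp Require Import boolp classical_sets functions reals.
From mathcomp Require mpoly.
(* only the ring structures on [mpoly n R]; its notations clash with those of
   the analysis library *)
Import (canonicals) mpoly.

Set Implicit Arguments.
Unset Strict Implicit.
Unset Printing Implicit Defensive.

Import GRing.Theory.

Local Open Scope classical_set_scope.
Local Open Scope ring_scope.

(* All rings are [comPzRingType]s: the zero ring, i.e. the empty variety, is
   allowed. *)

Section Ideals.
Variable A : comPzRingType.
Implicit Types I J : set A.

Definition ideal I : Prop :=
  [/\ I 0, forall x y, I x -> I y -> I (x + y) & forall a x, I x -> I (a * x)].

(* the unit ideal is real *)
Definition real_ideal I : Prop :=
  ideal I /\ forall s : seq A, I (\sum_(a <- s) a ^+ 2) ->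
    forall a, a \in s -> I a.

Definition prime_ideal I : Prop :=
  [/\ ideal I, ~ I 1 & forall x y, I (x * y) -> I x \/ I y].

Definition maximal_ideal I : Prop :=
  [/\ ideal I, ~ I 1 & forall J, ideal J -> ~ J 1 -> I `<=` J -> J = I].

Definition jacobson_radical : set A := \bigcap_(M in maximal_ideal) M.

Lemma jacobson_radical_ideal : ideal jacobson_radical.
Proof.
split=> [M [[]]//|x y xJ yJ M MM|a x xJ M MM].
  have [[_ addM _] _ _] := MM; exact: addM (xJ M MM) (yJ M MM).
have [[_ _ mulM] _ _] := MM; exact: mulM (xJ M MM).
Qed.

End Ideals.

Record realSpec (A : comPzRingType) := RealSpec {
  real_prime :> set A;
  real_primeP : prime_ideal real_prime;
  real_primeR : real_ideal real_prime }.

Record mulSet (B : comPzRingType) := MulSet {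
  mulset :> set B;
  mulset1 : mulset 1;
  mulsetM : forall s t, mulset s -> mulset t -> mulset (s * t) }.

Section Localization.
Variables (B : comPzRingType) (S : mulSet B).

Definition den (s : S) : B := sval s.

Definition loc_eqv (x y : B * S) : bool :=
  `[< exists2 u, mulset S u & u * (x.1 * den y.2 - y.1 * den x.2) = 0 >].

Let SP (s : S) : mulset S (den s). Proof. by case: s => s /= /set_mem. Qed.

Fact loc_eqv_refl : reflexive loc_eqv.
Proof.
by move=> x; apply/asboolP; exists 1; [exact: mulset1|rewrite subrr mulr0].
Qed.

Fact loc_eqv_sym : symmetric loc_eqv.
Proof.
suff h x y : loc_eqv x y -> loc_eqv y x by move=> x y; apply/idP/idP; exact: h.
by move=> /asboolP[u Su e]; apply/asboolP; exists u; rewrite // -opprB mulrN e oppr0.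
Qed.

Fact loc_eqv_trans : transitive loc_eqv.
Proof.
move=> y x z /asboolP[u Su e] /asboolP[v Sv e']; apply/asboolP.
exists (u * v * den y.2); first by apply: mulsetM (SP _); apply: mulsetM.
transitivity (v * den z.2 * (u * (x.1 * den y.2 - y.1 * den x.2)) +
              u * den x.2 * (v * (y.1 * den z.2 - z.1 * den y.2))); first by ring.
by rewrite e e' !mulr0 addr0.
Qed.

Canonical loc_equiv := EquivRel loc_eqv loc_eqv_refl loc_eqv_sym loc_eqv_trans.

(* the ring of fractions S^-1 B *)
Definition loc := {eq_quot loc_equiv}%qT.
HB.instance Definition _ := EqQuotient.on loc.
HB.instance Definition _ := Choice.on loc.

Definition mulset_elt s (Ss : mulset S s) : S := exist _ s (mem_set Ss).

Lemma mulset_eltK s (Ss : mulset S s) : den (mulset_elt Ss) = s. Proof. by []. Qed.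

Definition frac (b : B) (s : S) : loc := \pi_loc%qT (b, s).

Lemma fracP b s c t :
  frac b s = frac c t <->
  exists2 u, mulset S u & u * (b * den t - c * den s) = 0.
Proof.
by split=> [/eqquotP/asboolP|h]; [|apply/eqquotP/asboolP].
Qed.

Lemma loc_ind (P : loc -> Prop) : (forall b s, P (frac b s)) -> forall x, P x.
Proof. by move=> h x; rewrite -[x]reprK; case: (repr x). Qed.

Definition smul (s t : S) : S := mulset_elt (mulsetM (SP s) (SP t)).
Definition sone : S := mulset_elt (mulset1 S).

Lemma den_smul s t : den (smul s t) = den s * den t. Proof. by []. Qed.
Lemma den_sone : den sone = 1. Proof. by []. Qed.
Let denE := (den_smul, den_sone).

Definition loc_add (x y : loc) : loc :=
  let: (b, s) := repr x in let: (c, t) := repr y in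
  frac (b * den t + c * den s) (smul s t).
Definition loc_opp (x : loc) : loc := let: (b, s) := repr x in frac (- b) s.
Definition loc_mul (x y : loc) : loc :=
  let: (b, s) := repr x in let: (c, t) := repr y in frac (b * c) (smul s t).

Let repr_frac b s : exists2 u, mulset S u &
  u * ((repr (frac b s)).1 * den s - b * den (repr (frac b s)).2) = 0.
Proof.
by apply/fracP; rewrite /frac -surjective_pairing reprK.
Qed.

Lemma loc_addE b s c t :
  loc_add (frac b s) (frac c t) = frac (b * den t + c * den s) (smul s t).
Proof.
rewrite /loc_add; have := repr_frac b s; have := repr_frac c t.
case: (repr (frac b s)) => b' s'; case: (repr (frac c t)) => c' t' /=.
move=> [v Sv e'] [u Su e]; apply/fracP; exists (u * v); first exact: mulsetM.
rewrite ?denE.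
transitivity (v * den t * den t' * (u * (b' * den s - b * den s')) +
              u * den s * den s' * (v * (c' * den t - c * den t'))); first by ring.
by rewrite e e' !mulr0 addr0.
Qed.

Lemma loc_oppE b s : loc_opp (frac b s) = frac (- b) s.
Proof.
rewrite /loc_opp; have := repr_frac b s.
case: (repr (frac b s)) => b' s' /= [u Su e]; apply/fracP; exists u => //.
transitivity (- (u * (b' * den s - b * den s'))); first by ring.
by rewrite e oppr0.
Qed.

Lemma loc_mulE b s c t : loc_mul (frac b s) (frac c t) = frac (b * c) (smul s t).
Proof.
rewrite /loc_mul; have := repr_frac b s; have := repr_frac c t.
case: (repr (frac b s)) => b' s'; case: (repr (frac c t)) => c' t' /=.
move=> [v Sv e'] [u Su e]; apply/fracP; exists (u * v); first exact: mulsetM.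
rewrite ?denE.
transitivity (v * c' * den t * (u * (b' * den s - b * den s')) +
              u * b * den s' * (v * (c' * den t - c * den t'))); first by ring.
by rewrite e e' !mulr0 addr0.
Qed.

Let frac_eq b s c t : b * den t - c * den s = 0 -> frac b s = frac c t.
Proof. by move=> e; apply/fracP; exists 1; [exact: mulset1|rewrite e mulr0]. Qed.

Fact loc_addA : associative loc_add.
Proof.
elim/loc_ind=> b s; elim/loc_ind=> c t; elim/loc_ind=> d r.
by rewrite !loc_addE; apply: frac_eq; rewrite ?denE; ring.
Qed.

Fact loc_addC : commutative loc_add.
Proof.
elim/loc_ind=> b s; elim/loc_ind=> c t.
by rewrite !loc_addE; apply: frac_eq; rewrite ?denE; ring.
Qed.

Fact loc_add0 : left_id (frac 0 sone) loc_add.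
Proof. by elim/loc_ind=> b s; rewrite loc_addE; apply: frac_eq; rewrite ?denE; ring. Qed.

Fact loc_addN : left_inverse (frac 0 sone) loc_opp loc_add.
Proof.
by elim/loc_ind=> b s; rewrite loc_oppE loc_addE; apply: frac_eq; rewrite ?denE; ring.
Qed.

HB.instance Definition _ :=
  GRing.isZmodule.Build loc loc_addA loc_addC loc_add0 loc_addN.

Fact loc_mulA : associative loc_mul.
Proof.
elim/loc_ind=> b s; elim/loc_ind=> c t; elim/loc_ind=> d r.
by rewrite !loc_mulE; apply: frac_eq; rewrite ?denE; ring.
Qed.

Fact loc_mulC : commutative loc_mul.
Proof.
elim/loc_ind=> b s; elim/loc_ind=> c t.
by rewrite !loc_mulE; apply: frac_eq; rewrite ?denE; ring.
Qed.

Fact loc_mul1 : left_id (frac 1 sone) loc_mul.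
Proof. by elim/loc_ind=> b s; rewrite loc_mulE; apply: frac_eq; rewrite ?denE; ring. Qed.

Fact loc_mulDl : left_distributive loc_mul loc_add.
Proof.
elim/loc_ind=> b s; elim/loc_ind=> c t; elim/loc_ind=> d r.
by rewrite !(loc_addE, loc_mulE); apply: frac_eq; rewrite ?denE; ring.
Qed.

HB.instance Definition _ := GRing.Zmodule_isComPzRing.Build loc
  loc_mulA loc_mulC loc_mul1 loc_mulDl.

Lemma fracD b s c t :
  frac b s + frac c t = frac (b * den t + c * den s) (smul s t).
Proof. exact: loc_addE. Qed.

Lemma fracN b s : - frac b s = frac (- b) s.
Proof. exact: loc_oppE. Qed.

Lemma fracM b s c t : frac b s * frac c t = frac (b * c) (smul s t).
Proof. exact: loc_mulE. Qed.

Definition loc_in (b : B) : loc := frac b sone.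

Fact loc_in_zmod_morphism : zmod_morphism loc_in.
Proof. by move=> b c; rewrite fracN fracD; apply: frac_eq; rewrite ?denE; ring. Qed.

Fact loc_in_monoid_morphism : monoid_morphism loc_in.
Proof. by split=> // b c; rewrite fracM; apply: frac_eq; rewrite ?denE; ring. Qed.

HB.instance Definition _ :=
  GRing.isZmodMorphism.Build B loc loc_in loc_in_zmod_morphism.
HB.instance Definition _ :=
  GRing.isMonoidMorphism.Build B loc loc_in loc_in_monoid_morphism.

End Localization.

Section RealSeminormalization.
Variables (A B : comPzRingType) (f : {rmorphism A -> B}).

Section AtPrime.
Variable p : realSpec A.

Fact prime_compl1 : (f @` ~` p) 1.
Proof. by exists 1; [case: (real_primeP p)|rewrite rmorph1]. Qed.

Fact prime_complM s t : (f @` ~` p) s -> (f @` ~` p) t -> (f @` ~` p) (s * t).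
Proof.
move=> [a pa <-] [b pb <-]; exists (a * b); rewrite ?rmorphM//.
by have [_ _ h] := real_primeP p; move=> /h[].
Qed.

Definition prime_compl : mulSet B := MulSet prime_compl1 prime_complM.

Definition loc_prime : comPzRingType := loc prime_compl.

(* the image of A_p in B_p: the fractions f(a)/f(s), s \notin p *)
Definition loc_base : set loc_prime :=
  [set x | exists (a : A) (t : prime_compl), x = frac (f a) t].

End AtPrime.

Definition Rplus : set B :=
  [set b | forall p : realSpec A,
     exists2 x : loc_prime p, loc_base x &
       exists2 r : loc_prime p, jacobson_radical r &
         loc_in (prime_compl p) b = x + r].

Lemma Rplus_base a : Rplus (f a).
Proof.
move=> p; exists (loc_in (prime_compl p) (f a)); last first.
  exists 0; last by rewrite addr0.
  by case: (jacobson_radical_ideal (loc_prime p)).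
by exists a, (sone (prime_compl p)).
Qed.

Let denP p (t : prime_compl p) : exists s, den t = f s.
Proof. by case: t => t /= /set_mem[s _ <-]; exists s. Qed.

Let loc_baseB p (x y : loc_prime p) :
  loc_base x -> loc_base y -> loc_base (x - y).
Proof.
move=> [a [t ->]] [b [u ->]].
have [s ts] := denP t; have [r ur] := denP u.
exists (a * r - b * s), (smul t u); rewrite fracN fracD ts ur.
by rewrite rmorphB !rmorphM mulNr.
Qed.

Let loc_baseM p (x y : loc_prime p) :
  loc_base x -> loc_base y -> loc_base (x * y).
Proof.
move=> [a [t ->]] [b [u ->]].
by exists (a * b), (smul t u); rewrite fracM rmorphM.
Qed.

Fact Rplus_subring : subring_closed (mem Rplus).
Proof.
split=> [|b c /set_mem hb /set_mem hc|b c /set_mem hb /set_mem hc];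
  apply/mem_set.
- by rewrite -(rmorph1 f); exact: Rplus_base.
- move=> p; have [J0 JD JM] := jacobson_radical_ideal (loc_prime p).
  have [x xA [r rJ e]] := hb p; have [y yA [q qJ e']] := hc p.
  exists (x - y); first exact: loc_baseB.
  exists (r - q); first by apply: JD => //; rewrite -mulN1r; exact: JM.
  by rewrite rmorphB /= e e'; ring.
- move=> p; have [J0 JD JM] := jacobson_radical_ideal (loc_prime p).
  have [x xA [r rJ e]] := hb p; have [y yA [q qJ e']] := hc p.
  exists (x * y); first exact: loc_baseM.
  exists (x * q + (y + q) * r); first by apply: JD; exact: JM.
  by rewrite rmorphM /= e e'; ring.
Qed.

(* A_B^{R+} as a ring *)
Definition RplusRing := {b : B | b \in Rplus}.
HB.instance Definition _ := [isSub of RplusRing for @sval B (fun b => b \in Rplus)].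
HB.instance Definition _ := [Choice of RplusRing by <:].
HB.instance Definition _ :=
  GRing.SubChoice_isSubComPzRing.Build B (mem Rplus) RplusRing Rplus_subring.

Definition Rplus_incl (a : A) : RplusRing := exist _ (f a) (mem_set (Rplus_base a)).

Fact Rplus_incl_zmod_morphism : zmod_morphism Rplus_incl.
Proof. by move=> a b; apply: val_inj; rewrite /= !rmorphB. Qed.

Fact Rplus_incl_monoid_morphism : monoid_morphism Rplus_incl.
Proof.
by split=> [|a b]; apply: val_inj; rewrite /= ?rmorph1 ?rmorphM.
Qed.

HB.instance Definition _ := GRing.isZmodMorphism.Build A RplusRing
  Rplus_incl Rplus_incl_zmod_morphism.
HB.instance Definition _ := GRing.isMonoidMorphism.Build A RplusRing
  Rplus_incl Rplus_incl_monoid_morphism.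

End RealSeminormalization.

Section Complexification.
Variable A : comPzRingType.

(* For an R-algebra A, the ring A \otimes_R C = A \oplus A i:
   (a, b) stands for a \otimes 1 + b \otimes i. *)
Definition complexification : Type := (A * A)%type.
HB.instance Definition _ := GRing.Zmodule.on complexification.

Definition cone : complexification := (1, 0).
Definition cmul (z w : complexification) : complexification :=
  (z.1 * w.1 - z.2 * w.2, z.1 * w.2 + z.2 * w.1).

Fact cmulA : associative cmul.
Proof. by move=> [a b] [c d] [e g]; congr (_, _) => /=; ring. Qed.
Fact cmulC : commutative cmul.
Proof. by move=> [a b] [c d]; congr (_, _) => /=; ring. Qed.
Fact cmul1 : left_id cone cmul.
Proof. by move=> [a b]; congr (_, _) => /=; ring. Qed.
Fact cmulDl : left_distributive cmul +%R.
Proof. by move=> [a b] [c d] [e g]; congr (_, _) => /=; ring. Qed.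

HB.instance Definition _ := GRing.Zmodule_isComPzRing.Build complexification
  cmulA cmulC cmul1 cmulDl.

End Complexification.

Section Varieties.
Variable R : realType.

(* Spec of an R-algebra, presented by the algebra: a commutative ring with its
   structure morphism (the library's [comAlgType R] excludes the zero ring). *)
Record affScheme := AffScheme {
  coord_ring :> comPzRingType;
  scalar : {rmorphism R -> coord_ring} }.

Definition real_affine_variety (X : affScheme) : Prop :=
  exists n (phi : {rmorphism mpoly.mpoly n R -> X}),
    [/\ forall c, phi (mpoly.mpolyC n c) = scalar X c,
        forall a : X, exists P, phi P = a
      & real_ideal [set P | phi P = 0]].

(* dominant morphisms Y -> X *)
Record morphism (Y X : affScheme) := Morphism {
  comorphism :> {rmorphism X -> Y};
  comorphism_scalar : forall c, comorphism (scalar X c) = scalar Y c;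
  comorphism_inj : injective comorphism }.

Section Comp.
Variables (Y Z X : affScheme) (pi : morphism Z X) (rho : morphism Y Z).

Fact comp_scalar c : (rho \o pi) (scalar X c) = scalar Y c.
Proof. by rewrite /= !comorphism_scalar. Qed.

Fact comp_inj : injective (rho \o pi).
Proof. exact: inj_comp (@comorphism_inj _ _ rho) (@comorphism_inj _ _ pi). Qed.

(* pi o rho : Y -> Z -> X *)
Definition morphism_comp : morphism Y X :=
  @Morphism Y X (rho \o pi : {rmorphism _ -> _}) comp_scalar comp_inj.

End Comp.

Definition finite_morphism (Y X : affScheme) (pi : morphism Y X) : Prop :=
  exists s : seq Y, forall b : Y, exists a : 'I_(size s) -> X,
    b = \sum_(i < size s) pi (a i) * s`_i.

Section Seminormalization.
Variables (Y X : affScheme) (pi : morphism Y X).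

(* X_Y^{R+} *)
Definition Rseminormalization : affScheme :=
  @AffScheme (RplusRing pi) (Rplus_incl pi \o scalar X : {rmorphism _ -> _}).

Fact Rplus_incl_inj : injective (Rplus_incl pi).
Proof. by move=> a b /(congr1 val)/= /comorphism_inj. Qed.

(* pi^+ : X_Y^{R+} -> X *)
Definition Rseminormalization_map : morphism Rseminormalization X :=
  @Morphism Rseminormalization X (Rplus_incl pi : {rmorphism _ -> _})
    (fun=> erefl) Rplus_incl_inj.

End Seminormalization.

(* X(C) *)
Definition complex_points (X : affScheme) : set (set (complexification X)) :=
  [set M | maximal_ideal M].

(* X(R): maximal ideals m such that R -> A/m is bijective *)
Definition real_points (X : affScheme) : set (set X) :=
  [set m | maximal_ideal m /\ forall a : X, exists! c, m (a - scalar X c)].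

Arguments complex_points : clear implicits.
Arguments real_points : clear implicits.

(* the inclusion X(R) -> X(C), m |-> m \otimes_R C *)
Definition real_to_complex (X : affScheme) (m : set X) :
    set (complexification X) :=
  [set z | m z.1 /\ m z.2].

Definition real_points_in_complex (X : affScheme) :
    set (set (complexification X)) :=
  [set real_to_complex m | m in real_points X].

Arguments real_points_in_complex : clear implicits.

(* Y(C) -> X(C), contraction of ideals along the complexified comorphism *)
Definition complex_map (Y X : affScheme) (pi : morphism Y X)
    (N : set (complexification Y)) : set (complexification X) :=
  [set z | N (pi z.1, pi z.2)].

(* the restriction pi_C^-1(X(R)) -> X(R) is bijective *)
Definition bijective_over_real (Y X : affScheme) (pi : morphism Y X) : Prop :=
  set_bij (complex_points Y `&` complex_map pi @^-1` real_points_in_complex X)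
    (real_points_in_complex X) (complex_map pi).

End Varieties.

(* Main.v *)
From HB Require Import structures.
From mathcomp Require Import all_boot all_order all_algebra ring lra zify.
From mathcomp Require Import ring_quotient closed_field.
From mathcomp Require Import boolp classical_sets functions reals.
From mathcomp Require Import polyorder polyrcf complex.
From mathcomp Require mpoly.
Import (canonicals) mpoly.
Require Import Defs.

Set Implicit Arguments.
Unset Strict Implicit.
Unset Printing Implicit Defensive.

Import Order.TTheory GRing.Theory Num.Theory.
Local Open Scope classical_set_scope.
Local Open Scope ring_scope.


(** Write A, C and B for the coordinate rings of X, Z and Y, and A+ for that
    of the R-seminormalization of X in Y; the extensions A, C, B are finite.

    Call b in B rational on the fibre over a prime p of A when some fraction
    a/s with s outside p satisfies: s b - a lies in all primes of B over p
    ([fibrewise_rational]). The maximal ideals of B_p are the primes of B over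
    p, so A+ consists of the elements that are rational on the fibre over
    every real prime ([Rplus_rational], [rational_Rplus_at]). When all the
    elements of an integral extension are rational on these fibres, a real
    prime p has exactly one prime over it, with the same residue field; over a
    real point, this residue field is R, so that there is exactly one complex
    point, and it is real ([bijective_of_rational]).

    Hence a factorization C -> A+ makes the elements of C rational, by lying
    over, which gives bijectivity of Z -> X; and the elements of A+ are
    rational over the real primes of C, which gives bijectivity of A+ over Z.
    Two factorizations take the same rational value modulo every real prime of
    B, and these primes meet in 0 because B is a real ring
    ([real_prime_avoiding]).

    For the converse, C must be mapped into A+ by its inclusion in B, so its
    elements have to be rational over every real prime p of A, while the
    hypothesis speaks of real points of X only ([rational_fibre]). The prime p
    is the kernel of a point x of X with coordinates in a real closed field W.
    If c in C were not rational over p, its minimal polynomial over the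
    residue field would have several roots in W[i], hence x would have several
    preimages in Z(W[i]). This says that finitely many polynomial equations
    and one inequation with coefficients in R have a solution in W; then they
    have one in R, which is a real point of X with two preimages in Z(C).

    Three constructions support this argument. Transfer from W to R comes from
    the Cohen-Hormander method: the signs of a finite family of univariate
    polynomials are determined, up to a monotone change of variable, by the
    signs of finitely many polynomials in their coefficients
    ([sign_determination]); Hilbert's basis theorem makes the system finite.
    The field W is obtained inside an algebraically closed field containing the
    residue field of p ([closed_point]), built one variable at a time, a
    transcendental variable being the sequence 0, 1, 2, ... in a residue field
    of a ring of sequences. In that field a maximal real subring is
    real closed ([real_closed_point]), by the argument of Artin and
    Schreier. *)

(** * Sign diagrams of finite families of polynomials *)

Section Gaps.
Variables (F : rcfType) (fs : seq {poly F}).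
Implicit Types (x y t : F) (p f : {poly F}).

(** The zero polynomial is left out: it would make every point a root of the
    family. *)
Definition family_root y := has (fun f => (f != 0) && root f y) fs.

(** No root of the family separates [x] from [y], and neither is a root: this is
    the relation of lying in the same component of the complement of the roots. *)
Definition same_gap x y :=
  forall t, family_root t -> (t < x) && (t < y) || (x < t) && (y < t).

Lemma family_root_finite : exists rs : seq F, forall y, family_root y = (y \in rs).
Proof.
exists (rootsR (\prod_(f <- fs | f != 0) f)) => y.
have nz : \prod_(f <- fs | f != 0) f != 0 by rewrite prodf_seq_neq0; apply/allP=> f _; apply/implyP.
rewrite /family_root -(roots_on_rootsR nz) ?in_itv//= {nz}.
elim: fs => [|f s IH] /=; first by rewrite big_nil rootE hornerC oner_eq0.
by rewrite big_cons; case: eqP => //= _; rewrite ?rootM -IH.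
Qed.

Lemma same_gap_sym x y : same_gap x y -> same_gap y x.
Proof. by move=> g t /g; rewrite andbC [(y < t) && _]andbC. Qed.

Lemma same_gap_refl x : ~~ family_root x -> same_gap x x.
Proof. by move=> nx t rt; have [//|//|e] := ltgtP t x; rewrite e (negPf nx) in rt. Qed.

Lemma same_gap_nroot x y : same_gap x y -> ~~ family_root x.
Proof. by move=> g; apply/negP => /g; rewrite !ltxx. Qed.

Lemma same_gap_trans y x z : same_gap x y -> same_gap y z -> same_gap x z.
Proof.
move=> g g' t rt; have := g t rt; have := g' t rt.
move=> /orP[]/andP[a b] /orP[]/andP[c d]; rewrite ?b ?c ?orbT ?a ?d ?orbT//.
  by have := lt_trans a d; rewrite ltxx.
by have := lt_trans a d; rewrite ltxx.
Qed.

Lemma same_gap_itv x y : x <= y ->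
  (forall t, x <= t <= y -> ~~ family_root t) -> same_gap x y.
Proof.
move=> xy h t rt; case: (ltP t x) => [tx|xt] /=; first by rewrite (lt_le_trans tx xy).
case: (ltP y t) => [yt|ty]; first by rewrite (le_lt_trans xy yt).
by have := h t; rewrite xt ty rt => /(_ isT).
Qed.

Lemma same_gap_sgz x y f : f \in fs -> same_gap x y -> sgz f.[x] = sgz f.[y].
Proof.
move=> ffs; wlog xy : x y / x <= y => [W g|g].
  by have [/W|/ltW/W] := leP x y; [apply|move/(_ (same_gap_sym g))].
have [->|f0] := eqVneq f 0; first by rewrite !horner0.
have nr t : x <= t <= y -> ~~ root f t.
  move=> /andP[xt ty]; apply/negP => rt.
  have /g : family_root t by apply/hasP; exists f; rewrite // f0.
  by rewrite [t < x]ltNge xt [y < t]ltNge ty andbF.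
have [/poly_ivtoo|] := ltP (f.[x] * f.[y]) 0.
  move=> /(_ xy)[t]; rewrite in_itv/= => /andP[xt ty].
  by rewrite (negPf (nr _ _)) // !ltW.
have := nr x; have := nr y; rewrite !lexx xy => /(_ isT) + /(_ isT).
rewrite !rootE; move: f.[x] f.[y] => u v.
have [hu|hu|->] := ltgtP u 0; have [hv|hv|->] := ltgtP v 0; rewrite ?eqxx// => _ _ uv.
- by rewrite !ltr0_sgz.
- by move: uv; rewrite leNgt nmulr_rlt0 ?hv.
- by move: uv; rewrite leNgt pmulr_rlt0 ?hv.
- by rewrite !gtr0_sgz.
Qed.

Definition gapwise_sign f := forall x y, same_gap x y -> sgz f.[x] = sgz f.[y].

(** The mean value theorem, seen through signs: on a gap of a family on which
    the derivative has constant sign, [p] varies in the direction of that sign.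
    The end points [x] and [y] may themselves be roots of the family. *)
Lemma gap_incr p x y w : gapwise_sign p^`() -> x < y ->
  (forall t, x < t < y -> same_gap w t) ->
  sgz (p.[y] - p.[x]) = sgz p^`().[w].
Proof.
move=> pfs xy h; have [c] := poly_mvt p xy; rewrite in_itv/= => /h g ->.
by rewrite sgzM (pfs _ _ g) [sgz (y - x)]gtr0_sgz ?mulr1// subr_gt0.
Qed.

End Gaps.

Lemma seq_min d (T : orderType d) (P : T -> Prop) (l : seq T) s : s \in l -> P s ->
  exists u, [/\ u \in l, P u & forall t, t \in l -> P t -> (u <= t)%O].
Proof.
elim: l s => // a l IH s; rewrite inE => sl Ps.
have [[t [tl Pt]]|N] := pselect (exists t, t \in l /\ P t).
  have [u [ul Pu um]] := IH t tl Pt.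
  have [[Pa au]|Na] := pselect (P a /\ (a < u)%O).
    exists a; rewrite mem_head; split=> // v; rewrite inE => /orP[/eqP->//|vl Pv].
    by rewrite (le_trans (ltW au))// um.
  exists u; rewrite inE ul orbT; split=> // v; rewrite inE => /orP[/eqP-> Pa|/um//].
  by rewrite leNgt; apply/negP => au; apply: Na.
have es : s = a by case/orP: sl => [/eqP//|sl]; case: N; exists s.
subst s; exists a; rewrite mem_head; split=> // v; rewrite inE => /orP[/eqP->//|vl Pv].
by case: N; exists v.
Qed.

(** A finite set of points to the right of [x] has a smallest element. *)
Lemma next_family_root (F : rcfType) (fs : seq {poly F}) (x s : F) : family_root fs s -> x < s ->
  exists u, [/\ family_root fs u, x < u <= s & forall t, x < t < u -> ~~ family_root fs t].
Proof.
move=> rs xs; have [l lP] := family_root_finite fs; rewrite lP in rs.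
have [u [ul xu um]] := @seq_min _ _ (fun u => x < u) l s rs xs.
exists u; split=> [||t /andP[xt tu]]; rewrite ?lP ?xu ?(um _ rs xs)//.
by apply/negP => tl; have := um t tl xt; rewrite leNgt tu.
Qed.

(** The point midway between [x] and the first root on its right is not a root. *)
Lemma exists_between_roots (F : rcfType) (fs : seq {poly F}) (x y : F) : x < y ->
  exists2 t, x < t < y & ~~ family_root fs t.
Proof.
move=> xy; have mid (a b : F) : a < b -> a < (a + b) / 2 < b.
  move=> ab; apply/andP; split; first by rewrite ltr_pdivlMr// mulr_natr mulr2n ltrD2l.
  by rewrite ltr_pdivrMr// mulr_natr mulr2n ltrD2r.
have [[s [rs /andP[xs sy]]]|N] := pselect (exists s, family_root fs s /\ x < s < y); last first.
  exists ((x + y) / 2); first exact: mid.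
  by apply/negP => r; apply: N; exists ((x + y) / 2); rewrite r mid.
have [u [ru /andP[xu us] h]] := next_family_root rs xs.
exists ((x + u) / 2); last by rewrite h// mid.
by have /andP[-> w] := mid _ _ xu; rewrite (lt_trans w) ?(le_lt_trans us sy).
Qed.

Section Reflect.
Variables (F : rcfType) (fs : seq {poly F}).
(** The change of variable t -> - t, used to deduce statements about the left
    end of a gap from statements about its right end. *)
Definition reflect_poly (f : {poly F}) := f \Po (- 'X).
Lemma horner_reflect f x : (reflect_poly f).[x] = f.[- x].
Proof. by rewrite horner_comp !hornerE. Qed.
Lemma reflect_polyN f : reflect_poly (- f) = - reflect_poly f.
Proof. by rewrite /reflect_poly raddfN. Qed.
Lemma reflect_poly_eq0 f : (reflect_poly f == 0) = (f == 0).
Proof. by rewrite comp_poly2_eq0 // size_polyN size_polyX. Qed.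
Lemma family_root_reflect x : family_root (map reflect_poly fs) x = family_root fs (- x).
Proof. by rewrite /family_root has_map; apply: eq_has => f /=; rewrite reflect_poly_eq0 !rootE horner_reflect. Qed.
Lemma same_gap_reflect x y : same_gap (map reflect_poly fs) x y -> same_gap fs (- x) (- y).
Proof.
move=> g t rt; have := g (- t); rewrite family_root_reflect opprK => /(_ rt).
by rewrite (ltrNl t x) (ltrNl t y) (ltrNr x t) (ltrNr y t) orbC.
Qed.
End Reflect.

Section GapEnds.
Variables (F1 F2 : rcfType) (fs1 : seq {poly F1}) (fs2 : seq {poly F2}).
Variable (theta : F1 -> F2).
Hypothesis theta_mono : {homo theta : x y / x <= y}.
Hypothesis theta_root : forall y, family_root fs2 (theta y) = family_root fs1 y.
Hypothesis theta_surj : forall s, family_root fs2 s -> exists2 r, family_root fs1 r & theta r = s.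

Lemma theta_lt y r : ~~ family_root fs1 y -> family_root fs1 r -> (theta y < theta r) = (y < r).
Proof.
move=> ny rr; have ne : theta y != theta r.
  by apply/eqP => e; move: ny; rewrite -theta_root e theta_root rr.
have [yr|ry] := ltP y r; first by rewrite lt_neqAle ne theta_mono// ltW.
by rewrite lt_neqAle ne /= leNgt lt_neqAle eq_sym ne theta_mono.
Qed.

Lemma theta_gt y r : ~~ family_root fs1 y -> family_root fs1 r -> (theta r < theta y) = (r < y).
Proof.
move=> ny rr; have ne : theta r != theta y.
  by apply/eqP => e; move: ny; rewrite -theta_root -e theta_root rr.
have [yr|ry] := ltP r y; first by rewrite lt_neqAle ne theta_mono// ltW.
by rewrite lt_neqAle ne /= leNgt lt_neqAle eq_sym ne theta_mono.
Qed.

(** A root separating the images would be the image of a root, and that root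
    would separate the two points. *)
Lemma theta_gap y y' : same_gap fs1 y y' -> same_gap fs2 (theta y) (theta y').
Proof.
move=> g t /theta_surj[r rr <-].
have ny := same_gap_nroot g; have ny' := same_gap_nroot (same_gap_sym g).
by rewrite (theta_gt ny rr) (theta_gt ny' rr) (theta_lt ny rr) (theta_lt ny' rr); exact: g.
Qed.

(** Let [p1] increase on the gap of [y], with a nonnegative value at [y]. Then
    [p1] is positive at the right end of the gap, be it a root of the family or
    infinity, hence so is [p2] at the right end of the gap of [theta y], and
    [p2] is positive close to this end. *)
Lemma gap_right (p1 : {poly F1}) (p2 : {poly F2}) y :
    gapwise_sign fs1 p1^`() ->
    (forall r, family_root fs1 r -> sgz p2.[theta r] = sgz p1.[r]) ->
    sgz (lead_coef p1) = sgz (lead_coef p2) ->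
    ~~ family_root fs1 y -> 0 < p1^`().[y] -> 0 <= p1.[y] ->
  exists2 z, same_gap fs2 (theta y) z & 0 < p2.[z].
Proof.
move=> d1 sr slc ny dy py.
have ny2 : ~~ family_root fs2 (theta y) by rewrite theta_root.
have [pz|pz] := ltP 0 p2.[theta y]; first by exists (theta y) => //; exact: same_gap_refl.
have [[s [rs ts]]|N] := pselect (exists s, family_root fs2 s /\ theta y < s).
  have [u [ru /andP[tu us] hu]] := next_family_root rs ts.
  have [r rr ur] := theta_surj ru.
  have yr : y < r by rewrite -theta_lt// ur.
  have [v [rv /andP[yv vr] hv]] := next_family_root rr yr.
  have tv : theta v = u.
    apply/eqP; rewrite eq_le -{1}ur theta_mono//= leNgt; apply/negP => vu.
    by have := hu (theta v); rewrite theta_lt// yv vu theta_root rv => /(_ isT).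
  have pv : p1.[y] < p1.[v].
    rewrite -subr_gt0 -sgz_gt0 (@gap_incr _ fs1 _ _ _ y)// ?sgz_gt0// => t /andP[yt tv'].
    apply: same_gap_itv; first exact: ltW.
    move=> w /andP[yw wt]; have [<-//|yw'] := eqVneq y w; apply: hv.
    by rewrite lt_neqAle yw' yw (le_lt_trans wt tv').
  have pu : 0 < p2.[u] by rewrite -sgz_gt0 -tv sr// sgz_gt0 (le_lt_trans py).
  (* [p2] takes the value [p2.[u] / 2] somewhere before [u] *)
  have [||c] := @poly_ivtoo _ (p2 - (p2.[u] / 2)%:P) (theta y) u; first exact: ltW.
    rewrite !hornerE; have : 0 < p2.[u] / 2 by rewrite divr_gt0.
    by nra.
  rewrite in_itv/= => /andP[tc cu]; rewrite rootE !hornerE subr_eq0 => /eqP pc.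
  exists c; last by rewrite pc divr_gt0.
  apply: same_gap_itv; first exact: ltW.
  move=> w /andP[yw wt]; have [<-//|yw'] := eqVneq (theta y) w; apply: hu.
  by rewrite lt_neqAle yw' yw (le_lt_trans wt cu).
have noright1 t : y <= t -> ~~ family_root fs1 t.
  rewrite le_eqVlt => /orP[/eqP<-//|yt]; apply/negP => rt; apply: N.
  by exists (theta t); rewrite theta_root theta_lt.
have noright2 t : theta y <= t -> ~~ family_root fs2 t.
  by rewrite le_eqVlt => /orP[/eqP<-//|yt]; apply/negP => rt; apply: N; exists t.
(* no root on the right: the sign at infinity, which is read at the Cauchy
   bound, is the sign of the leading coefficient *)
pose x := Num.max (y + 1) (cauchy_bound p1).
have yx : y < x by rewrite lt_max ltrDl ltr01.
have px : 0 < p1.[x].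
  apply: le_lt_trans py _.
  rewrite -subr_gt0 -sgz_gt0 (@gap_incr _ fs1 _ _ _ y)// ?sgz_gt0// => t /andP[yt tv'].
  by apply: same_gap_itv; [exact: ltW|move=> w /andP[/noright1]].
have p10 : p1 != 0 by apply: contraTneq px => ->; rewrite horner0 ltxx.
have lc1 : 0 < lead_coef p1.
  rewrite -sgr_gt0 -/(sgp_pinfty p1) -(@sgp_pinftyP _ x _ _ x) ?in_itv/= ?lexx ?sgr_gt0//.
  move=> t; rewrite in_itv/= andbT => xt; apply: ge_cauchy_bound => //.
  by rewrite in_itv/= andbT (le_trans _ xt)// le_max lexx orbT.
have lc2 : 0 < lead_coef p2 by rewrite -sgz_gt0 -slc sgz_gt0.
have p20 : p2 != 0 by rewrite -lead_coef_eq0 gt_eqF.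
pose z := Num.max (theta y) (cauchy_bound p2).
exists z.
  by apply: same_gap_itv; [rewrite le_max lexx|move=> w /andP[/noright2]].
rewrite -sgr_gt0 (@sgp_pinftyP _ z) ?in_itv/= ?lexx ?sgr_gt0//.
move=> t; rewrite in_itv/= andbT => xt; apply: ge_cauchy_bound => //.
by rewrite in_itv/= andbT (le_trans _ xt)// le_max lexx orbT.
Qed.
End GapEnds.

Lemma same_gap_mid (F : rcfType) (fs : seq {poly F}) x y z :
  same_gap fs x y -> x <= z <= y -> same_gap fs x z.
Proof.
move=> g /andP[xz zy]; apply: same_gap_itv => // t /andP[xt tz]; apply/negP => /g.
by rewrite ltNge xt /= andbC ltNge (le_trans tz).
Qed.

Section GapPoints.
Variables (F1 F2 : rcfType) (fs1 : seq {poly F1}) (fs2 : seq {poly F2}).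
Variable (theta : F1 -> F2).
Hypothesis theta_mono : {homo theta : x y / x <= y}.
Hypothesis theta_root : forall y, family_root fs2 (theta y) = family_root fs1 y.
Hypothesis theta_surj : forall s, family_root fs2 s -> exists2 r, family_root fs1 r & theta r = s.

(** The reflection of [gap_right]. *)
Lemma gap_left (p1 : {poly F1}) (p2 : {poly F2}) y :
    gapwise_sign fs1 p1^`() ->
    (forall r, family_root fs1 r -> sgz p2.[theta r] = sgz p1.[r]) ->
    sgz (lead_coef (reflect_poly p1)) = sgz (lead_coef (reflect_poly p2)) ->
    ~~ family_root fs1 y -> 0 < p1^`().[y] -> p1.[y] <= 0 ->
  exists2 z, same_gap fs2 (theta y) z & p2.[z] < 0.
Proof.
move=> d1 sr slc ny dy py.
have dreflect (F : rcfType) (p : {poly F}) : (- reflect_poly p)^`() = reflect_poly p^`().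
  by rewrite derivN deriv_comp derivN derivX mulrN1 opprK.
have [|||||||||z] := @gap_right F1 F2 (map (@reflect_poly F1) fs1) (map (@reflect_poly F2) fs2) (fun x => - theta (- x)) _ _ _
  (- reflect_poly p1) (- reflect_poly p2) (- y).
- by move=> x z xz; rewrite lerN2 theta_mono// lerN2.
- by move=> x; rewrite !family_root_reflect opprK theta_root.
- move=> s; rewrite family_root_reflect => /theta_surj[r rr e].
  by exists (- r); rewrite ?family_root_reflect opprK// e opprK.
- by rewrite dreflect => x z /same_gap_reflect/d1; rewrite !horner_reflect.
- by move=> r; rewrite family_root_reflect => /sr; rewrite !hornerN !horner_reflect opprK !sgzN => ->.
- by rewrite !lead_coefN !sgzN slc.
- by rewrite family_root_reflect opprK.
- by rewrite dreflect horner_reflect opprK.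
- by rewrite hornerN horner_reflect opprK oppr_ge0.
rewrite opprK => /same_gap_reflect; rewrite opprK hornerN horner_reflect oppr_gt0.
by exists (- z).
Qed.

(** On an increasing gap, a value of sign 0 comes from a positive and a negative
    one by the intermediate value theorem. *)
Lemma gap_point_pos (p1 : {poly F1}) (p2 : {poly F2}) y :
    gapwise_sign fs1 p1^`() ->
    (forall r, family_root fs1 r -> sgz p2.[theta r] = sgz p1.[r]) ->
    sgz (lead_coef p1) = sgz (lead_coef p2) ->
    sgz (lead_coef (reflect_poly p1)) = sgz (lead_coef (reflect_poly p2)) ->
    ~~ family_root fs1 y -> 0 < p1^`().[y] ->
  exists2 z, same_gap fs2 (theta y) z & sgz p2.[z] = sgz p1.[y].
Proof.
move=> d1 sr slc slc' ny dy.
have R := gap_right theta_mono theta_root theta_surj d1 sr slc ny dy.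
have L := gap_left d1 sr slc' ny dy.
have [py|py|py] := ltgtP p1.[y] 0.
- by have [z g pz] := L (ltW py); exists z; rewrite // !ltr0_sgz.
- by have [z g pz] := R (ltW py); exists z; rewrite // !gtr0_sgz.
have [z1 g1 n1] : exists2 z, same_gap fs2 (theta y) z & p2.[z] < 0 by apply: L; rewrite py.
have [z2 g2 n2] : exists2 z, same_gap fs2 (theta y) z & 0 < p2.[z] by apply: R; rewrite py.
have g12 := same_gap_trans (same_gap_sym g1) g2.
have n12 : p2.[z1] * p2.[z2] < 0 by rewrite nmulr_rlt0.
have [z12|z21] := leP z1 z2.
  have [z] := poly_ivtoo z12 n12; rewrite in_itv/= => /andP[a b] /rootP pz.
  exists z; last by rewrite pz py !sgz0.
  by apply: same_gap_trans g1 _; apply: same_gap_mid g12 _; rewrite !ltW.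
rewrite mulrC in n12; have [z] := poly_ivtoo (ltW z21) n12.
rewrite in_itv/= => /andP[a b] /rootP pz; exists z; last by rewrite pz py !sgz0.
by apply: same_gap_trans g2 _; apply: same_gap_mid (same_gap_sym g12) _; rewrite !ltW.
Qed.

(** If the derivative vanishes at a point of a gap it is the zero polynomial,
    being in the family, and [p1] and [p2] are constants. *)
Lemma gap_point (p1 : {poly F1}) (p2 : {poly F2}) y :
    p1^`() \in fs1 -> p2^`() \in fs2 ->
    sgz p2^`().[theta y] = sgz p1^`().[y] ->
    (forall r, family_root fs1 r -> sgz p2.[theta r] = sgz p1.[r]) ->
    sgz (lead_coef p1) = sgz (lead_coef p2) ->
    sgz (lead_coef (reflect_poly p1)) = sgz (lead_coef (reflect_poly p2)) ->
    ~~ family_root fs1 y ->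
  exists2 z, same_gap fs2 (theta y) z & sgz p2.[z] = sgz p1.[y].
Proof.
move=> d1 d2 sd sr slc slc' ny.
have gd : gapwise_sign fs1 p1^`() by move=> ? ?; apply: same_gap_sgz.
have [dy|dy|dy] := ltgtP p1^`().[y] 0; last first.
- have nroot0 (F : rcfType) (fs : seq {poly F}) (f : {poly F}) x :
      f \in fs -> ~~ family_root fs x -> f.[x] = 0 -> f = 0.
    move=> ffs nx fx; apply/eqP/negPn/negP => f0; move/negP: nx; apply.
    by apply/hasP; exists f; rewrite // f0 /root fx eqxx.
  have e1 := nroot0 _ _ _ _ d1 ny dy.
  have e2 : p2^`() = 0.
    apply: (nroot0 _ fs2 _ (theta y)) => //; first by rewrite theta_root.
    by apply/eqP; rewrite -sgz_eq0 sd dy sgz0.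
  have cst (F : rcfType) (p : {poly F}) : p^`() = 0 -> p = (lead_coef p)%:P.
    move=> p0; have /size1_polyC -> : (size p <= 1)%N; last by rewrite lead_coefC.
    by rewrite -subn_eq0 subn1 -size_deriv p0 size_poly0.
  exists (theta y); first by apply: same_gap_refl; rewrite theta_root.
  by rewrite (cst _ _ e1) (cst _ _ e2) !hornerC.
- exact: gap_point_pos.
have [||||||z gz] := @gap_point_pos (- p1) (- p2) y => //.
- by move=> u v /gd; rewrite derivN !hornerN !sgzN => ->.
- by move=> r /sr; rewrite !hornerN !sgzN => ->.
- by rewrite !lead_coefN !sgzN slc.
- by rewrite !reflect_polyN !lead_coefN !sgzN slc'.
- by rewrite derivN hornerN oppr_gt0.
by rewrite !hornerN !sgzN => /oppr_inj; exists z.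
Qed.
End GapPoints.

Lemma sgz_mono (F : realDomainType) (a b : F) : a <= b -> sgz a <= sgz b.
Proof.
have [a0|a0|->] := ltgtP a 0; first by rewrite (ltr0_sgz a0); case: (sgzP b).
  by move=> /(lt_le_trans a0) b0; rewrite !gtr0_sgz.
by rewrite sgz0 sgz_ge0.
Qed.

(** A point strictly between two roots which is not a root has to be sent
    strictly between their images. *)
Lemma theta_inj (F1 F2 : rcfType) (fs1 : seq {poly F1}) (fs2 : seq {poly F2}) (theta : F1 -> F2) :
  {homo theta : x y / x <= y} ->
  (forall y, family_root fs2 (theta y) = family_root fs1 y) -> {in family_root fs1 &, injective theta}.
Proof.
move=> mono th r r' rr rr' e; wlog lt : r r' rr rr' e / r < r'.
  by move=> W; have [/W->|/W->|] := ltgtP r r'.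
have [t /andP[rt tr] nt] := exists_between_roots fs1 lt.
have : theta t = theta r.
  by apply/eqP; rewrite eq_le {1}e !mono// ltW.
by move=> et; move: nt; rewrite -th et th; case/negP.
Qed.

(** Both families have finitely many roots, and [theta] and [theta'] inject the
    roots of each family into those of the other one. *)
Lemma theta_surjective (F1 F2 : rcfType) (fs1 : seq {poly F1}) (fs2 : seq {poly F2})
  (theta : F1 -> F2) (theta' : F2 -> F1) :
  {homo theta : x y / x <= y} -> {homo theta' : x y / x <= y} ->
  (forall y, family_root fs2 (theta y) = family_root fs1 y) ->
  (forall y, family_root fs1 (theta' y) = family_root fs2 y) ->
  forall s, family_root fs2 s -> exists2 r, family_root fs1 r & theta r = s.
Proof.
move=> mono mono' th th' s rs.
have [l1 l1P] := family_root_finite fs1; have [l2 l2P] := family_root_finite fs2.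
have sub : {subset map theta (undup l1) <= undup l2}.
  by move=> _ /mapP[r + ->]; rewrite !mem_undup -l1P -l2P th.
have sub' : {subset map theta' (undup l2) <= undup l1}.
  by move=> _ /mapP[r + ->]; rewrite !mem_undup -l1P -l2P th'.
have u : uniq (map theta (undup l1)).
  rewrite map_inj_in_uniq ?undup_uniq// => x y; rewrite !mem_undup -!l1P.
  exact: theta_inj.
have u' : uniq (map theta' (undup l2)).
  rewrite map_inj_in_uniq ?undup_uniq// => x y; rewrite !mem_undup -!l2P.
  exact: theta_inj.
have := uniq_leq_size u' sub'; rewrite size_map -[in X in (_ <= X)%N](size_map theta).
move=> /(uniq_min_size u sub)[_ /(_ s)].
rewrite mem_undup -l2P rs => /mapP[r]; rewrite mem_undup -l1P => rr ->.
by exists r.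
Qed.

Section SameSigns.
Variables (A : comNzRingType) (F1 F2 : rcfType).
Variables (al : {rmorphism A -> F1}) (be : {rmorphism A -> F2}).

Definition same_signs (cs : seq A) := forall c, c \in cs -> sgz (al c) = sgz (be c).

(** The map [theta] is a witness that the sign diagrams of the two
    specialisations of [ps] agree, up to a change of variable that may collapse
    intervals. *)
Definition sign_map (ps : seq {poly A}) (theta : F1 -> F2) :=
  {homo theta : x y / x <= y} /\
  forall p, p \in ps -> forall y, sgz (map_poly be p).[theta y] = sgz (map_poly al p).[y].

Definition coef_signs (p : {poly A}) := forall i, sgz (al p`_i) = sgz (be p`_i).

Lemma same_signs_coef (p : {poly A}) : same_signs p -> coef_signs p.
Proof.
move=> h i; have [/(nth_default 0)->|ip] := leqP (size p) i; first by rewrite !rmorph0 !sgz0.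
exact/h/mem_nth.
Qed.

(** The size of a specialisation only depends on which coefficients vanish. *)
Lemma coef_signs_size p : coef_signs p -> size (map_poly al p) = size (map_poly be p).
Proof.
move=> h; have e i : ((map_poly al p)`_i == 0) = ((map_poly be p)`_i == 0).
  by rewrite !coef_map -sgz_eq0 h sgz_eq0.
apply/eqP; rewrite eqn_leq; apply/andP; split; apply/leq_sizeP => i le.
  by apply/eqP; rewrite e nth_default.
by apply/eqP; rewrite -e nth_default.
Qed.

Lemma coef_signs_lead p : coef_signs p ->
  sgz (lead_coef (map_poly al p)) = sgz (lead_coef (map_poly be p)).
Proof. by move=> h; rewrite !lead_coefE -coef_signs_size// !coef_map h. Qed.

Lemma coef_signs_eq0 p : coef_signs p -> (map_poly al p == 0) = (map_poly be p == 0).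
Proof. by move=> h; rewrite -!size_poly_eq0 coef_signs_size. Qed.

Lemma coef_signs_lead_reflect p : coef_signs p ->
  sgz (lead_coef (reflect_poly (map_poly al p))) = sgz (lead_coef (reflect_poly (map_poly be p))).
Proof.
move=> h; rewrite /reflect_poly !lead_coef_comp ?size_polyN ?size_polyX//.
rewrite !lead_coefN !lead_coefX !sgzM coef_signs_lead// coef_signs_size//.
by rewrite !sgzX !sgzN !sgz1.
Qed.
End SameSigns.

Lemma same_signs_eq0 (A : comNzRingType) (F1 F2 : rcfType) (al : {rmorphism A -> F1})
    (be : {rmorphism A -> F2}) cs c : same_signs al be cs -> c \in cs ->
  (be c == 0) = (al c == 0).
Proof. by move=> ss /ss e; rewrite -sgz_eq0 -e sgz_eq0. Qed.

Section Remainders.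
Variables (A : comNzRingType) (gs : seq {poly A}).
(** The specialisation of [g] may have a smaller degree than [g], but it is also
    that of a truncation of [g] whose leading coefficient does not vanish. *)
Definition truncations := [seq take_poly j g | g <- gs, j <- iota 0 (size g).+1].
(** At a root of the specialisation of [t], the value of [p] is, up to a power
    of the leading coefficient of [t], that of the pseudo-remainder of [p] by
    [t]. *)
Definition remainders p := [seq Pdiv.Ring.rmodp p t | t <- truncations & t != 0].

(** Among the truncations of [g], one has the specialisation of [g] and a
    leading coefficient that survives. *)
Lemma truncation_of (K : fieldType) (f : {rmorphism A -> K}) g (t := take_poly (size (map_poly f g)) g) :
  g \in gs -> map_poly f g != 0 ->
  [/\ t \in [seq t <- truncations | t != 0], map_poly f t = map_poly f g & f (lead_coef t) != 0].
Proof.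
move=> gg nz; pose j := size (map_poly f g).
have fg : map_poly f t = map_poly f g.
  apply/polyP => i; rewrite !coef_map coef_take_poly; case: ltnP => // le.
  by rewrite -coef_map nth_default// raddf0.
have jg : (j <= size g)%N by exact: size_poly.
have lc : f t`_j.-1 != 0 by rewrite -coef_map fg -lead_coefE lead_coef_eq0.
have st : size t = j.
  apply/eqP; rewrite eqn_leq size_take_poly /= -[j]prednK ?lt0n ?size_poly_eq0//.
  by rewrite ltnNge; apply: contra lc => /leq_sizeP->; rewrite ?rmorph0.
split=> //; last by rewrite lead_coefE st.
rewrite mem_filter -size_poly_eq0 st size_poly_eq0 nz /=.
by apply/allpairsPdep; exists g, j; rewrite mem_iota/= ltnS.
Qed.
End Remainders.

Section HormanderStep.
Variables (A : comNzRingType) (F1 F2 : rcfType).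
Variables (al : {rmorphism A -> F1}) (be : {rmorphism A -> F2}).
Variables (p : {poly A}) (rest : seq {poly A}).
Let gs := p^`() :: rest.
Let Q := gs ++ remainders gs p.
Hypothesis coefP : forall f, f \in p :: gs -> coef_signs al be f.
Variables (theta : F1 -> F2) (theta' : F2 -> F1).
Hypothesis thetaP : sign_map al be Q theta.
Hypothesis thetaP' : sign_map be al Q theta'.

Let coefG g : g \in gs -> coef_signs al be g.
Proof. by move=> gg; apply: coefP; rewrite inE gg orbT. Qed.

Let coefQ t : t \in truncations gs -> sgz (al (lead_coef t)) = sgz (be (lead_coef t)).
Proof.
move=> /allpairsPdep[g [j [gg _ ->]]]; rewrite lead_coefE coef_take_poly.
by case: ifP => _; [exact: coefG|rewrite !raddf0 !sgz0].
Qed.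

Let fs1 := map (map_poly al) gs.
Let fs2 := map (map_poly be) gs.

Let theta_root y : family_root fs2 (theta y) = family_root fs1 y.
Proof.
rewrite /family_root !has_map; apply: eq_in_has => g gg /=.
rewrite -(coef_signs_eq0 (coefG gg)); congr (_ && _).
by rewrite !rootE -sgz_eq0 thetaP.2 ?sgz_eq0// mem_cat gg.
Qed.

Let theta_root' y : family_root fs1 (theta' y) = family_root fs2 y.
Proof.
rewrite /family_root !has_map; apply: eq_in_has => g gg /=.
rewrite (coef_signs_eq0 (coefG gg)); congr (_ && _).
by rewrite !rootE -sgz_eq0 thetaP'.2 ?sgz_eq0// mem_cat gg.
Qed.

Let theta_surj := theta_surjective thetaP.1 thetaP'.1 theta_root theta_root'.

(* the signs of [p] at the roots of the family are those of pseudo-remainders *)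
Let root_sign r : family_root fs1 r -> sgz (map_poly be p).[theta r] = sgz (map_poly al p).[r].
Proof.
rewrite /family_root has_map => /hasP[g gg /= /andP[nz rr]].
have [tt tg lc] := truncation_of gg nz; set t := take_poly _ _ in tt tg lc.
move: (tt); rewrite mem_filter => /andP[t0 ttr].
have cg := coefG gg.
have rt : (map_poly al t).[r] = 0 by apply/eqP; rewrite tg.
have rt' : (map_poly be t).[theta r] = 0.
  have nz' : map_poly be g != 0 by rewrite -(coef_signs_eq0 cg).
  rewrite /t (coef_signs_size cg); have [_ -> _] := truncation_of gg nz'.
  by apply/eqP; rewrite -sgz_eq0 thetaP.2 ?mem_cat ?gg// sgz_eq0.
have E := Pdiv.ComRing.rdivp_eq t p.
have := congr1 (fun f => (map_poly al f).[r]) E.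
have := congr1 (fun f => (map_poly be f).[theta r]) E.
rewrite /= !linearZ /= !rmorphD !rmorphM /= !hornerE rt rt' !mulr0 !add0r => e2 e1.
have rQ : Pdiv.Ring.rmodp p t \in Q by rewrite mem_cat (map_f _ tt) orbT.
have := thetaP.2 _ rQ r; rewrite -e1 -e2 !sgzM !rmorphXn /= !sgzX -coefQ//.
by apply: mulfI; rewrite expf_neq0// sgz_eq0.
Qed.

(** The points outside the roots are moved inside their gap so as to fix the
    sign of [p]. The choice only depends on the gap and on the sign, which makes
    the map constant on each part of a gap where [p] has constant sign. *)
Definition refined_map y : F2 := if family_root fs1 y then theta y else
  xget 0 [set z | same_gap fs2 (theta y) z /\
                  sgz (map_poly be p).[z] = sgz (map_poly al p).[y]].

Let refinedP y : ~~ family_root fs1 y -> same_gap fs2 (theta y) (refined_map y) /\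
  sgz (map_poly be p).[refined_map y] = sgz (map_poly al p).[y].
Proof.
move=> ny; rewrite /refined_map (negPf ny); set S := [set z | _].
suff : S (xget 0 S) by []; apply: xgetPex.
have pp : coef_signs al be p by apply: coefP; rewrite mem_head.
have [|||||||z g pz] := @gap_point _ _ fs1 fs2 _ thetaP.1 theta_root theta_surj
  (map_poly al p) (map_poly be p) y.
- by rewrite deriv_map map_f// mem_head.
- by rewrite deriv_map map_f// mem_head.
- by rewrite !deriv_map thetaP.2// mem_cat mem_head.
- exact: root_sign.
- exact: coef_signs_lead.
- exact: coef_signs_lead_reflect.
- by [].
by exists z.
Qed.

(** The inductive step of the Cohen-Hormander method: the sign diagram of [p ::
    rest] is determined by the signs of the coefficients and by the sign diagram
    of [rest], the derivative of [p], and the pseudo-remainders of [p]. *)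
Lemma refined_sign_map : sign_map al be (p :: rest) refined_map.
Proof.
have [mono _] := thetaP; split=> [y y'|f].
  rewrite le_eqVlt => /orP[/eqP->//|yy'].
  (* a root between the two points separates their images *)
  have [[r [rr yr ry']]|N] := pselect (exists r, [/\ family_root fs1 r, y <= r & r <= y']).
    apply: (@le_trans _ _ (theta r)).
      have [iy|ny] := boolP (family_root fs1 y); first by rewrite /refined_map iy mono.
      have [/(_ (theta r))] := refinedP ny; rewrite theta_root rr => /(_ isT) + _.
      by rewrite [theta r < _]ltNge mono//= => /andP[_ /ltW].
    have [iy|ny] := boolP (family_root fs1 y'); first by rewrite /refined_map iy mono.
    have [/(_ (theta r))] := refinedP ny; rewrite theta_root rr => /(_ isT) + _.
    by rewrite [_ < theta r]ltNge mono//= orbF => /andP[_ /ltW].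
  have nr t : y <= t <= y' -> ~~ family_root fs1 t.
    by move=> /andP[yt ty]; apply/negP => rt; apply: N; exists t.
  have ny : ~~ family_root fs1 y by rewrite nr// lexx ltW.
  have ny' : ~~ family_root fs1 y' by rewrite nr// lexx ltW.
  have g := same_gap_itv (ltW yy') nr.
  have g2 := theta_gap mono theta_root theta_surj g.
  (* in the same gap the images coincide when the signs of [p] do, and
     otherwise are ordered because [p] is monotone *)
  have [es|ns] := eqVneq (sgz (map_poly al p).[y]) (sgz (map_poly al p).[y']).
    rewrite /refined_map (negPf ny) (negPf ny') es.
    rewrite (_ : [set _ | _] = [set z | same_gap fs2 (theta y') z /\
                  sgz (map_poly be p).[z] = sgz (map_poly al p).[y']])//.
    apply/seteqP; split=> z [gz pz]; split=> //.
      exact: same_gap_trans (same_gap_sym g2) gz.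
    exact: same_gap_trans g2 gz.
  have [gT sT] := refinedP ny; have [gT' sT'] := refinedP ny'.
  rewrite leNgt; apply/negP => lt.
  have d1 : gapwise_sign fs1 (map_poly al p)^`().
    by move=> ? ?; apply: same_gap_sgz; rewrite deriv_map map_f// mem_head.
  have d2 : gapwise_sign fs2 (map_poly be p)^`().
    by move=> ? ?; apply: same_gap_sgz; rewrite deriv_map map_f// mem_head.
  have i1 : sgz ((map_poly al p).[y'] - (map_poly al p).[y]) = sgz (map_poly al p)^`().[y].
    apply: (gap_incr d1 yy') => t /andP[yt ty].
    by apply: same_gap_mid g _; rewrite !ltW.
  have gTT : same_gap fs2 (refined_map y') (refined_map y).
    exact: same_gap_trans (same_gap_sym gT') (same_gap_trans (same_gap_sym g2) gT).
  have i2 : sgz ((map_poly be p).[refined_map y] - (map_poly be p).[refined_map y']) =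
      sgz (map_poly be p)^`().[theta y].
    apply: (gap_incr d2 lt) => t /andP[yt ty].
    apply: same_gap_trans (same_gap_trans g2 gT') _.
    by apply: same_gap_mid gTT _; rewrite !ltW.
  have ed : sgz (map_poly be p)^`().[theta y] = sgz (map_poly al p)^`().[y].
    by rewrite !deriv_map thetaP.2// mem_cat mem_head.
  rewrite ed -i1 in i2; move/eqP: ns; apply.
  move: i2 sT sT'; move: (map_poly al p).[y] (map_poly al p).[y'].
  move: (map_poly be p).[refined_map y] (map_poly be p).[refined_map y'] => u u' v v'.
  move=> i2 sT sT'; apply/eqP; rewrite eq_le; apply/andP; split.
    have [/sgz_mono//|lt'] := leP v v'.
    rewrite -sT -sT' sgz_mono// -subr_le0 -sgz_le0 i2 sgz_le0 subr_le0 ltW//.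
  have [/sgz_mono//|lt'] := leP v' v.
  by rewrite -sT -sT' sgz_mono// -subr_ge0 -sgz_ge0 i2 sgz_ge0 subr_ge0 ltW.
rewrite inE => /orP[/eqP-> y|fr y].
  have [iy|ny] := boolP (family_root fs1 y); last by have [] := refinedP ny.
  by rewrite /refined_map iy root_sign.
have fg : f \in gs by rewrite inE fr orbT.
rewrite -thetaP.2 ?mem_cat ?fg//.
have [iy|ny] := boolP (family_root fs1 y); first by rewrite /refined_map iy.
have [g _] := refinedP ny; apply/esym; apply: same_gap_sgz g.
by rewrite map_f.
Qed.
End HormanderStep.

(** Replacing a polynomial of maximal size by its derivative and by pseudo-
    remainders only adds polynomials of smaller size: the induction is on the
    maximal size, then on the number of polynomials having it. The
    specialisations are quantified after the list [cs], which does not depend on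
    them. *)
Lemma sign_determination (A : comNzRingType) (ps : seq {poly A}) :
  exists cs : seq A, forall (F1 F2 : rcfType) (al : {rmorphism A -> F1})
    (be : {rmorphism A -> F2}), same_signs al be cs -> exists theta, sign_map al be ps theta.
Proof.
have [n] : exists n, all (fun p : {poly A} => size p <= n)%N ps.
  elim: ps => [|p ps [n h]]; first by exists 0%N.
  exists (maxn (size p) n); rewrite /= leq_maxl; apply: sub_all h => q qn.
  by rewrite leq_max qn orbT.
elim: n ps => [|n IHn] ps sz.
  exists [::] => F1 F2 al be _; exists (fun=> 0); split=> // p /(allP sz).
  by rewrite leqn0 size_poly_eq0 => /eqP-> y; rewrite !rmorph0 !horner0 !sgz0.
move: {2}(count _ ps) (erefl (count (fun p : {poly A} => n < size p)%N ps)) => k.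
elim: k ps sz => [|k IHk] ps sz ck.
  apply: IHn; apply/allP => p pps; rewrite leqNgt; apply/negP => np.
  have : has (fun p : {poly A} => n < size p)%N ps by apply/hasP; exists p.
  by rewrite has_count ck.
have /hasP[p pps np] : has (fun p : {poly A} => n < size p)%N ps by rewrite has_count ck.
have sp : (size p <= n.+1)%N by apply: (allP sz).
pose rest := rem p ps; pose gs := p^`() :: rest.
have pp : perm_eq ps (p :: rest) := perm_to_rem pps.
have p0 : p != 0 by rewrite -size_poly_gt0 (leq_ltn_trans _ np).
have sp' : (size p^`() <= n)%N by rewrite -ltnS (leq_trans (lt_size_deriv p0)).
have srem : all (fun p : {poly A} => size p <= n)%N (remainders gs p).
  apply/allP => _ /mapP[t + ->]; rewrite mem_filter => /andP[t0 /allpairsPdep[g [j [gg _ et]]]].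
  rewrite -ltnS (leq_trans _ (_ : size t <= n.+1)%N)//; first by rewrite Pdiv.CommonRing.ltn_rmodp.
  apply: (@leq_trans (size g)).
    rewrite et; apply/leq_sizeP => i gi; rewrite coef_take_poly.
    by case: ifP => // _; rewrite nth_default.
  move: gg; rewrite inE => /orP[/eqP->|/mem_rem/(allP sz)//].
  exact: leq_trans sp' _.
have [||cs csP] := IHk (gs ++ remainders gs p).
- rewrite all_cat /= leqW//=; apply/andP; split.
    by apply/allP => q /mem_rem/(allP sz).
  by apply: sub_all srem => q; exact: leqW.
- have -> : gs ++ remainders gs p = [:: p^`()] ++ rest ++ remainders gs p by [].
  rewrite !count_cat /= ltnNge sp' /= !add0n.
  have /permP/(_ (fun p : {poly A} => n < size p)%N) := pp; rewrite ck /= np add1n => -[->].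
  suff -> : count (fun p : {poly A} => n < size p)%N (remainders gs p) = 0%N by rewrite addn0.
  apply/eqP; rewrite -leqn0 leqNgt -has_count -all_predC.
  by apply: sub_all srem => q /=; rewrite -leqNgt.
exists (cs ++ flatten (map (@polyseq A) (p :: gs))) => F1 F2 al be ss.
have cP f : f \in p :: gs -> coef_signs al be f.
  move=> fg; apply: same_signs_coef => c cf; apply: ss; rewrite mem_cat.
  by apply/orP; right; apply/flattenP; exists (polyseq f) => //; apply: map_f.
have ss1 : same_signs al be cs by move=> c cc; apply: ss; rewrite mem_cat cc.
have ss2 : same_signs be al cs by move=> c cc; rewrite ss1.
have [th thP] := csP _ _ _ _ ss1; have [th' thP'] := csP _ _ _ _ ss2.
have [mono sg] := refined_sign_map cP thP thP'.
by eexists; split; [exact: mono|move=> q; rewrite (perm_mem pp); apply: sg].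
Qed.

(** Iterated univariate polynomials, the form in which inductions on the number
    of variables are immediate. *)
Fixpoint ipoly (A : comNzRingType) (n : nat) : comNzRingType :=
  if n is m.+1 then {poly (ipoly A m)} else A.

Fixpoint ipolyC (A : comNzRingType) (n : nat) : {rmorphism A -> ipoly A n} :=
  match n return {rmorphism A -> ipoly A n} with
  | 0 => idfun
  | m.+1 => (@polyC (ipoly A m)) \o ipolyC A m
  end.

(** Here [i] gives [A] the structure of an [R]-algebra. The property says that a
    finite system of sign conditions with a solution in [W] has one in [R]. *)
Definition transferable (R W : rcfType) (A : comNzRingType) (i : R -> A) :=
  forall (al : {rmorphism A -> W}) (cs : seq A),
    exists2 be : {rmorphism A -> R}, (forall c, be (i c) = c) & same_signs al be cs.

(** Field morphisms between real closed fields preserve signs, as positive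
    elements are squares. *)
Lemma transferable_base (R W : rcfType) : transferable W (@idfun R).
Proof.
move=> al cs; exists idfun => // c _ /=.
have pos (x : R) : 0 < x -> 0 < al x.
  move=> x0; rewrite -(sqr_sqrtr (ltW x0)) rmorphXn/= lt_neqAle sqr_ge0 andbT.
  by rewrite eq_sym sqrf_eq0 fmorph_eq0 gt_eqF// sqrtr_gt0.
have [c0|c0|->] := ltgtP c 0; last by rewrite rmorph0 !sgz0.
  by rewrite !ltr0_sgz// -oppr_gt0 -rmorphN pos// oppr_gt0.
by rewrite !gtr0_sgz// pos.
Qed.

(** The signs to be realised by the last variable are determined by signs in
    [A]; once these are realised in [R], the last coordinate is carried over by
    a [sign_map]. *)
Lemma transferable_poly (R W : rcfType) (A : comNzRingType) (i : R -> A) :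
  transferable W i -> transferable W (fun c => (i c)%:P).
Proof.
move=> tA al cs; pose al1 : {rmorphism A -> W} := al \o @polyC A.
have [ds dsP] := sign_determination cs.
have [be1 bC ss] := tA al1 ds.
have [th [_ thP]] := dsP _ _ _ _ ss.
have cm : commr_rmorph be1 (th (al 'X)) by move=> x; apply: mulrC.
exists (horner_morph cm) => [c|p pc /=]; first exact: etrans (horner_morphC _ _) (bC c).
by rewrite /horner_morph thP//; congr sgz; exact: poly_initial.
Qed.

(** * Ideals and residue fields *)

(** Zorn's lemma for a property of sets, stable under unions of nonempty chains,
    starting from a given set. *)
Lemma Zorn_above (T : Type) (P : set T -> Prop) (X0 : set T) : P X0 ->
  (forall F : set (set T), F !=set0 -> (forall X, F X -> P X) -> total_on F subset ->
     P (\bigcup_(X in F) X)) ->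
  exists M, [/\ P M, X0 `<=` M & forall N, P N -> M `<=` N -> N `<=` M].
Proof.
move=> P0 Pch; have [|M [PM Mmax]] := @Zorn_bigcup T (fun X => P (X `|` X0)).
  move=> F FP tot; have [->|/set0P[X1 FX1]] := eqVneq F set0; first by rewrite bigcup_set0 set0U.
  have -> : \bigcup_(X in F) X `|` X0 = \bigcup_(Y in [set X `|` X0 | X in F]) Y.
    apply/seteqP; split=> [x [[X FX Xx]|X0x]|x [_ [X FX <-] [Xx|X0x]]].
    - by exists (X `|` X0); [exists X|left].
    - by exists (X1 `|` X0); [exists X1|right].
    - by left; exists X.
    - by right.
  apply: Pch; first by exists (X1 `|` X0), X1.
    by move=> _ [X FX <-]; exact: FP.
  by move=> _ _ [X FX <-] [Y FY <-]; have [XY|YX] := tot _ _ FX FY; [left|right]; exact: setSU.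
exists (M `|` X0); split=> [//||N PN MN x Nx]; first exact: subsetUr.
have NX : N `|` X0 = N by apply/setUidPl => y X0y; apply: MN; right.
apply: contrapT => nx; apply: (Mmax N); last by rewrite NX.
by split=> [y My|NM]; [apply: MN; left|apply: nx; left; exact: NM].
Qed.

(** Finitely many elements of the union of a chain lie in a single member, so
    that properties expressed with finitely many elements pass to the union. *)
Lemma chain_seq (T : eqType) (F : set (set T)) (s : seq T) : F !=set0 -> total_on F subset ->
  (forall x, x \in s -> (\bigcup_(X in F) X) x) -> exists2 X, F X & forall x, x \in s -> X x.
Proof.
move=> [X1 FX1] tot; elim: s => [|x s IH] h; first by exists X1.
have [|X FX Xs] := IH; first by move=> y ys; apply: h; rewrite inE ys orbT.
have [Y FY Yx] := h x (mem_head _ _).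
have [XY|YX] := tot _ _ FX FY.
  by exists Y => // y; rewrite inE => /orP[/eqP->//|/Xs/XY].
by exists X => // y; rewrite inE => /orP[/eqP->|/Xs//]; exact: YX.
Qed.

Section Ideals.
Variable A : comPzRingType.
Implicit Types (I Q S : set A).

Lemma ideal0 I : ideal I -> I 0. Proof. by case. Qed.
Lemma idealD I x y : ideal I -> I x -> I y -> I (x + y). Proof. by case=> _ + _; exact. Qed.
Lemma idealMl I a x : ideal I -> I x -> I (a * x). Proof. by case=> _ _; exact. Qed.
Lemma idealMr I a x : ideal I -> I x -> I (x * a). Proof. by rewrite mulrC; exact: idealMl. Qed.
Lemma idealN I x : ideal I -> I x -> I (- x).
Proof. by move=> iI Ix; rewrite -mulN1r; exact: idealMl. Qed.
Lemma idealB I x y : ideal I -> I x -> I y -> I (x - y).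
Proof. by move=> iI Ix Iy; apply: idealD => //; exact: idealN. Qed.
Lemma ideal_sum I (T : Type) (s : seq T) (P : pred T) (F : T -> A) : ideal I ->
  (forall i, P i -> I (F i)) -> I (\sum_(i <- s | P i) F i).
Proof. by move=> iI h; elim/big_ind: _ => //; [exact: ideal0|move=> *; exact: idealD]. Qed.
Lemma ideal_cancel I x y : ideal I -> I y -> I (x + y) -> I x.
Proof. by move=> iI Iy Ixy; rewrite -(addrK y x); exact: idealB. Qed.

Definition adjoin I x := [set z | exists i a, I i /\ z = i + a * x].

Lemma adjoin_ideal I x : ideal I -> ideal (adjoin I x).
Proof.
move=> iI; split=> [|_ _ [i [a [Ii ->]]] [j [b [Ij ->]]]|c _ [i [a [Ii ->]]]].
- by exists 0, 0; rewrite mul0r addr0; split=> //; exact: ideal0.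
- by exists (i + j), (a + b); split; [exact: idealD|ring].
- by exists (c * i), (c * a); split; [exact: idealMl|ring].
Qed.

Lemma sub_adjoin I x : I `<=` adjoin I x.
Proof. by move=> i Ii; exists i, 0; rewrite mul0r addr0. Qed.

Lemma mem_adjoin I x : ideal I -> adjoin I x x.
Proof. by move=> iI; exists 0, 1; rewrite mul1r add0r; split=> //; exact: ideal0. Qed.

Lemma prime_idealX Q x n : prime_ideal Q -> Q (x ^+ n) -> Q x.
Proof. by case=> iQ n1 pQ; elim: n => [/n1//|n IH]; rewrite exprS => /pQ[]. Qed.

(** An ideal maximal among those disjoint from a multiplicative set is prime.
    The last clause restates its maximality. *)
Lemma prime_avoiding (I S : set A) : ideal I -> S 1 ->
  (forall s t, S s -> S t -> S (s * t)) -> (forall s, I s -> ~ S s) ->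
  exists Q, [/\ prime_ideal Q, I `<=` Q, forall s, Q s -> ~ S s &
    forall x, ~ Q x -> exists a s, S s /\ Q (s - a * x)].
Proof.
move=> iI S1 SM IS.
have [||Q [[iQ QS] IQ Qmax]] :=
    @Zorn_above A (fun X => ideal X /\ forall s, X s -> ~ S s) I; first by [].
  move=> F Fn FP tot; have wit s := @chain_seq A F s Fn tot.
  split; last by move=> s [X FX Xs]; have [_] := FP _ FX; exact.
  split=> [|x y Ux Uy|a x [X FX Xx]].
  - by have [X FX] := Fn; exists X => //; have [iX _] := FP _ FX; exact: ideal0.
  - have [|X FX h] := wit [:: x; y]; first by move=> z; rewrite !inE => /orP[]/eqP->.
    exists X => //; have [iX _] := FP _ FX.
    by apply: idealD => //; apply: h; rewrite !inE eqxx ?orbT.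
  - by exists X => //; have [iX _] := FP _ FX; exact: idealMl.
have {}Qmax x : ~ Q x -> exists a s, S s /\ Q (s - a * x).
  move=> nQ; apply: contrapT => N; apply: nQ.
  apply: (Qmax (adjoin Q x)); [|exact: sub_adjoin|exact: mem_adjoin].
  split; first exact: adjoin_ideal.
  by move=> s [q [a [Qq es]]] Ss; apply: N; exists a, s; split=> //; rewrite es addrK.
exists Q; split=> //.
split=> // [/QS//|x y Qxy]; apply: contrapT => /not_orP[/Qmax[a [s [Ss Qs]]] /Qmax[b [t [St Qt]]]].
apply: (QS (s * t)); last exact: SM.
have -> : s * t = (s - a * x) * t + a * x * (t - b * y) + a * b * (x * y) by ring.
by apply: idealD => //; [apply: idealD => //; [exact: idealMr|exact: idealMl]|exact: idealMl].
Qed.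

End Ideals.

Section ResidueField.
Variables (A : comNzRingType) (M : set A).
Hypothesis iM : ideal M.
Hypothesis nM1 : ~ M 1.
Hypothesis invM : forall x, ~ M x -> exists y, M (y * x - 1).

Definition Mpred : {pred A} := fun x => `[< M x >].

Fact Mpred_idealr : idealr_closed Mpred.
Proof.
split; first by apply/asboolP; exact: ideal0.
  by apply/negP => /asboolP.
move=> a x y /asboolP Mx /asboolP My; apply/asboolP.
by apply: idealD => //; exact: idealMl.
Qed.
HB.instance Definition _ := isIdealr.Build A Mpred Mpred_idealr.

Definition residue := {ideal_quot Mpred}.
HB.instance Definition _ := GRing.ComNzRing.on residue.

Local Open Scope quotient_scope.

Lemma resmap_eq0 x : \pi_residue x = 0 <-> M x.
Proof.
rewrite -(rmorph0 \pi_residue); split=> [/eqP|Mx].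
  by rewrite -Quotient.idealrBE subr0 => /asboolP.
by apply/eqP; rewrite -Quotient.idealrBE subr0; exact/asboolP.
Qed.

Lemma residue_surj (x : residue) : exists a, \pi_residue a = x.
Proof. by exists (repr x); rewrite reprK. Qed.

Definition resinv (x : residue) : residue := if x == 0 then 0 else xget 0 [set y | y * x = 1].

Fact resmulVf x : x != 0 -> resinv x * x = 1.
Proof.
move=> x0; rewrite /resinv (negPf x0).
suff : [set y | y * x = 1] (xget 0 [set y | y * x = 1]) by [].
apply: xgetPex; have [a ax] := residue_surj x; subst x.
have [|y My] := invM (x := a); first by move=> /resmap_eq0 e; rewrite e eqxx in x0.
exists (\pi_residue y); apply/eqP; rewrite -subr_eq0 -rmorphM -(rmorph1 \pi_residue) -rmorphB.
exact/eqP/resmap_eq0.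
Qed.

Fact resinv0 : resinv 0 = 0. Proof. by rewrite /resinv eqxx. Qed.

HB.instance Definition _ := GRing.ComNzRing_isField.Build residue resmulVf resinv0.

(** The hypothesis [invM] on [M] is what the quotient needs to be a field; it is
    verified by maximal ideals, and by all primes of a ring of sequences in a
    field. *)
Lemma residue_field : exists (K : fieldType) (f : {rmorphism A -> K}),
  (forall x, exists a, f a = x) /\ forall a, f a = 0 <-> M a.
Proof.
exists residue, \pi_residue; split; [exact: residue_surj|exact: resmap_eq0].
Qed.

End ResidueField.

Lemma closed_field_of_axiom (K : fieldType) : GRing.closed_field_axiom K ->
  exists (L : closedFieldType) (f : {rmorphism K -> L}), bijective f.
Proof.
case: K => K c h; pose F : fieldType := GRing.Field.Pack c.
pose m := Field_isAlgClosed.Build F h.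
pose L : closedFieldType := HB.pack K c m.
by exists L, (@idfun L : {rmorphism F -> L}); exists (@idfun L).
Qed.

Lemma exists_nonroot (F : idomainType) (q : {poly F}) : (forall n, n.+1%:R != 0 :> F) ->
  q != 0 -> exists n : nat, q.[n%:R] != 0.
Proof.
move=> char0 q0; have inj : injective (fun n : nat => n%:R : F).
  move=> m n /= e; wlog lt : m n e / (m < n)%N.
    by move=> W; have [/W->|/W->|] := ltngtP m n.
  have := char0 (n - m).-1; rewrite prednK ?subn_gt0// natrB ?(ltnW lt)// e subrr.
  by rewrite eqxx.
apply: contrapT => N.
have := @max_poly_roots _ q [seq n%:R | n <- iota 0 (size q)] q0.
rewrite size_map size_iota ltnn map_inj_uniq ?iota_uniq// => C; suff: false by [].
apply: C => //; apply/allP => _ /mapP[n _ ->]; apply: contrapT => h.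
by apply: N; exists n; apply/negP.
Qed.

Section Sequences.
Variable (L : closedFieldType).
Definition cseq (c : L) : nat -> L := fun=> c.
Fact cseq_zmod : zmod_morphism cseq. Proof. by move=> x y; apply/funext. Qed.
Fact cseq_monoid : monoid_morphism cseq. Proof. by split=> // x y; apply/funext. Qed.
HB.instance Definition _ := GRing.isZmodMorphism.Build L (nat -> L) cseq cseq_zmod.
HB.instance Definition _ := GRing.isMonoidMorphism.Build L (nat -> L) cseq cseq_monoid.

Lemma sum_seqE n (F : 'I_n -> nat -> L) k : (\sum_(i < n) F i) k = \sum_(i < n) F i k.
Proof. by elim/big_rec2: _ => // i x y _ <-. Qed.

Lemma exp_seqE (x : nat -> L) n k : (x ^+ n) k = x k ^+ n.
Proof. by elim: n => // n IH; rewrite !exprS -IH. Qed.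

(** In the ring of sequences of elements of [L], take a prime ideal avoiding the
    sequences n -> q(n) for q nonzero, which do not vanish identically. This
    ring is von Neumann regular, so the quotient is a field; roots of
    polynomials are computed termwise, so this field is algebraically closed;
    and the sequence n -> n is transcendental over [L] by the choice of the
    ideal. *)
Lemma transcendental_extension : (forall n, n.+1%:R != 0 :> L) ->
  exists (L' : closedFieldType) (g : {rmorphism L -> L'}) (t : L'),
    forall q : {poly L}, (map_poly g q).[t] = 0 -> q = 0.
Proof.
move=> char0.
pose ev (q : {poly L}) : nat -> L := fun n => q.[n%:R].
pose S := [set x | exists2 q, q != 0 & x = ev q].
have [|||_ -> [q q0 /esym /(congr1 (fun f => f _)) h]|M [[iM nM1 pM] _ MS _]] :=
    @prime_avoiding (nat -> L) [set 0] S.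
- by split=> [|_ _ -> ->|a _ ->] /=; rewrite ?addr0 ?mulr0.
- by exists 1; rewrite ?oner_eq0//; apply/funext => n; rewrite /ev hornerC.
- move=> _ _ [q q0 ->] [r r0 ->]; exists (q * r); first exact: mulf_neq0.
  by apply/funext => n; rewrite /ev hornerM.
- by have [n /eqP] := exists_nonroot char0 q0; apply; exact: h.
have [|K [f [fs fM]]] := @residue_field (nat -> L) M iM nM1.
  move=> x nMx; exists (fun n => (x n)^-1); have [|//|//] := pM x ((fun n => (x n)^-1) * x - 1).
  rewrite (_ : _ * _ = 0); first exact: ideal0.
  apply/funext => n; rewrite /GRing.mul/= -[LHS]/(x n * ((x n)^-1 * x n - 1)).
  have [->|x0] := eqVneq (x n) 0; first by rewrite mul0r.
  by rewrite mulVf// subrr mulr0.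
have cl : GRing.closed_field_axiom K.
  move=> n P n0; have [p pP] := choice (fun i => fs (P i)).
  have [x xP] := choice (fun k => @solve_monicpoly L n (fun i => p i k) n0).
  exists (f x); rewrite -rmorphXn /= (_ : x ^+ n = \sum_(i < n) p i * x ^+ i).
    by rewrite rmorph_sum; apply: eq_bigr => i _; rewrite rmorphM pP rmorphXn.
  apply/funext => k; rewrite exp_seqE xP sum_seqE; apply: eq_bigr => i _.
  by rewrite -exp_seqE.
have [L' [h [h' hK _]]] := closed_field_of_axiom cl.
exists L', (h \o (f \o cseq)), (h (f (fun n => n%:R))) => q.
move=> e; apply: contrapT => /eqP q0; apply: (MS (ev q)); last by exists q.
apply/fM; apply: (can_inj hK); rewrite rmorph0 -e.
rewrite (map_poly_comp h (f \o cseq)) (map_poly_comp f cseq) !horner_map; congr (h (f _)).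
elim/poly_ind: q {e q0} => [|q c IH]; first by rewrite rmorph0 horner0; apply/funext => k; rewrite /ev horner0.
rewrite rmorphD rmorphM /= map_polyX map_polyC !hornerE -IH.
by apply/funext => k; rewrite /ev !hornerE.
Qed.
End Sequences.

(** * Prime ideals of polynomial rings as kernels of points *)

Section PolyIdeals.
Variable A : comNzRingType.
Implicit Types (P Q I : set {poly A}) (f q : {poly A}).

Definition contraction I : set A := [set a | I a%:P].

Lemma contraction_ideal I : ideal I -> ideal (contraction I).
Proof.
move=> iI; split=> [|x y Ix Iy|a x Ix]; rewrite /contraction /=.
- by rewrite polyC0; exact: ideal0.
- by rewrite polyCD; exact: idealD.
- by rewrite polyCM; exact: idealMl.
Qed.

Lemma contraction_prime P : prime_ideal P -> prime_ideal (contraction P).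
Proof.
case=> iP n1 pP; split; [exact: contraction_ideal|by []|].
by move=> x y; rewrite /contraction /= polyCM => /pP.
Qed.

Definition coefs_in I q := forall i, contraction I q`_i.

Lemma coefs_inW I q : ideal I -> coefs_in I q -> I q.
Proof.
move=> iI h; rewrite -[q]coefK poly_def; apply: ideal_sum => // i _.
by rewrite -mul_polyC; apply: idealMr => //; exact: h.
Qed.

(** Over the residue field of the contraction of [I], such an [f] generates the
    image of [I]; its leading coefficient is kept outside the contraction so
    that pseudo-division by [f] is a division over that field. *)
Definition minimal_in I f := [/\ I f, ~ contraction I (lead_coef f) &
  forall q, I q -> (size q < size f)%N -> coefs_in I q].

(** Take an element of smallest size among those with a coefficient outside the
    contraction: if its leading coefficient were in the contraction, the leading
    term could be removed. *)
Lemma exists_minimal_in I g : ideal I -> I g -> ~ coefs_in I g -> exists f, minimal_in I f.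
Proof.
move=> iI Ig ng.
have ex : exists n, `[< exists f, [/\ I f, ~ coefs_in I f & size f = n] >].
  by exists (size g); apply/asboolP; exists g.
have [n /asboolP[f [If nf sf]] min] := ex_minnP ex.
have small q : I q -> (size q < size f)%N -> coefs_in I q.
  move=> Iq; rewrite sf => lt; apply: contrapT => nq; move: lt; rewrite ltnNge min//.
  by apply/asboolP; exists q.
have f0 : f != 0.
  by apply/eqP => f0; apply: nf => i; rewrite f0 coef0; exact: ideal0 (contraction_ideal iI).
exists f; split=> // lcI; apply: nf.
pose m := lead_coef f *: 'X^((size f).-1).
have Im : I m by rewrite /m -mul_polyC; apply: idealMr.
have c : coefs_in I (f - m).
  apply: small; first exact: idealB.
  rewrite -[size f]prednK ?size_poly_gt0// ltnS; apply/leq_sizeP => j.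
  rewrite coefB coefZ coefXn leq_eqVlt => /orP[/eqP<-|lt].
    by rewrite eqxx mulr1 lead_coefE subrr.
  rewrite gtn_eqF// mulr0 subr0 nth_default//.
  by rewrite -[size f]prednK ?size_poly_gt0.
move=> i; have := c i; rewrite coefB coefZ coefXn; case: eqP => [->|_].
  by rewrite mulr1 lead_coefE subrr -lead_coefE.
by rewrite mulr0 subr0.
Qed.

Lemma minimal_size I f : ideal I -> minimal_in I f -> (1 < size f)%N.
Proof.
move=> iI [If nlc _]; rewrite ltnNge; apply/negP => /size1_polyC e; apply: nlc.
by rewrite e lead_coefC /contraction /= -e.
Qed.

Lemma minimal_div I f q : ideal I -> minimal_in I f -> I q ->
  exists k s r, lead_coef f ^+ k *: q = s * f + r /\ coefs_in I r.
Proof.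
move=> iI mf Iq; have [If _ small] := mf; have E := Pdiv.ComRing.rdivp_eq f q.
do 3 eexists; split; first exact: E.
apply: small.
  have -> : Pdiv.Ring.rmodp q f = lead_coef f ^+ Pdiv.Ring.rscalp q f *: q - Pdiv.Ring.rdivp q f * f.
    by rewrite E addrC addKr.
  by apply: idealB => //; [rewrite -mul_polyC; exact: idealMl|exact: idealMl].
by rewrite Pdiv.CommonRing.ltn_rmodp -size_poly_gt0 (ltnW (minimal_size iI mf)).
Qed.

Lemma prime_scale P c k q : prime_ideal P -> ~ contraction P c -> P (c ^+ k *: q) -> P q.
Proof.
move=> pP nc; have [_ _ h] := pP; rewrite -mul_polyC => /h[]//.
by rewrite polyC_exp => /(prime_idealX pP).
Qed.

Section Roots.
Variables (K : fieldType) (al : {rmorphism A -> K}) (P : set {poly A}).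
Hypothesis kerP : forall a, al a = 0 <-> contraction P a.

Lemma map_coefs_in q : map_poly al q = 0 <-> coefs_in P q.
Proof.
split=> [/polyP e i|h]; first by apply/kerP; have := e i; rewrite coef_map coef0.
by apply/polyP => i; rewrite coef_map coef0; exact/kerP.
Qed.

(** Two primes with the same contraction, the smaller of which contains a
    polynomial that is nonzero over the residue field, are equal: over the
    residue field, the generators of both are nonconstant and one divides the
    irreducible other one. *)
Lemma incomparable Q f : prime_ideal P -> prime_ideal Q ->
  (forall a, contraction Q a -> contraction P a) -> P `<=` Q -> minimal_in P f -> Q `<=` P.
Proof.
move=> pP pQ QP PQ mf; have [iP nP1 dP] := pP; have [iQ nQ1 dQ] := pQ.
have [Pf nlf small] := mf.
have [e me] : exists e, minimal_in Q e.
  by apply: (exists_minimal_in iQ (PQ _ Pf)) => /(_ (size f).-1) /QP.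
have [Qe nle _] := me; have coefQP r : coefs_in Q r -> coefs_in P r by move=> h i; exact: QP.
have nle' : ~ contraction P (lead_coef e) by move/PQ.
have Pe : P e.
  have [k [s [r [E /coefQP cr]]]] := minimal_div iQ me (PQ _ Pf).
  have Pse : P (s * e).
    rewrite (_ : s * e = lead_coef e ^+ k *: f - r); last by rewrite E addrK.
    by apply: idealB => //; [rewrite -mul_polyC; exact: idealMl|exact: coefs_inW].
  case: (dP _ _ Pse) => // Ps.
  have mf0 : map_poly al f != 0.
    by apply/eqP => /map_coefs_in/(_ (size f).-1); rewrite -lead_coefE.
  have Em : al (lead_coef e) ^+ k *: map_poly al f = map_poly al s * map_poly al e.
    have := congr1 (map_poly al) E; rewrite rmorphD rmorphM linearZ/= rmorphXn.
    by rewrite (map_coefs_in r).2// addr0.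
  have le0 : al (lead_coef e) != 0 by apply/eqP => /kerP.
  have se : size (map_poly al e) = size e by apply: size_poly_eq.
  have sef : (size (map_poly al s * map_poly al e)%R <= size f)%N.
    by rewrite -Em (leq_trans (size_scale_leq _ _))// size_poly.
  have e0 : map_poly al e != 0 by rewrite -size_poly_eq0 se -lt0n (ltnW (minimal_size iQ me)).
  have s0 : map_poly al s != 0.
    apply: contraNneq mf0 => s0; move: Em; rewrite s0 mul0r => /eqP.
    by rewrite scaler_eq0 expf_eq0 (negPf le0) andbF.
  pose s' := take_poly (size (map_poly al s)) s.
  have ms' : map_poly al s' = map_poly al s.
    apply/polyP => i; rewrite !coef_map coef_take_poly; case: ltnP => // le.
    by rewrite -coef_map nth_default// raddf0.
  have Ps' : P s'.
    rewrite -[s'](subrK s) addrC; apply: idealD => //; apply: coefs_inW => //.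
    by apply/map_coefs_in; rewrite rmorphB /= ms' subrr.
  case/negP: (s0); apply/eqP; rewrite -ms'; apply/map_coefs_in; apply: small Ps' _.
  apply: leq_trans sef; rewrite (size_mul s0 e0) se.
  apply: (leq_ltn_trans (size_take_poly _ _)).
  have := minimal_size iQ me; case: (size e) => [|[|n]]// _.
  by rewrite addnS /= addnS ltnS leq_addr.
move=> q Qq; have [k [s [r [E /coefQP cr]]]] := minimal_div iQ me Qq.
apply: (prime_scale pP nle' (k := k)); rewrite E.
by apply: idealD => //; [exact: idealMl|exact: coefs_inW].
Qed.

(** The kernel of the evaluation at [t] is a prime containing [P] with the same
    contraction, so [incomparable] applies. *)
Lemma root_kernel f t : prime_ideal P -> minimal_in P f -> (map_poly al f).[t] = 0 ->
  forall q, (map_poly al q).[t] = 0 <-> P q.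
Proof.
move=> pP mf ft; have [iP nP1 dP] := pP; have [_ nlf _] := mf.
have PQ q : P q -> (map_poly al q).[t] = 0.
  move=> /(minimal_div iP mf)[k [s [r [E cr]]]].
  have := congr1 (fun q => (map_poly al q).[t]) E.
  rewrite linearZ rmorphD rmorphM /= (map_coefs_in r).2// !hornerE ft mulr0 => /eqP.
  rewrite mulf_eq0 rmorphXn expf_eq0 => /orP[/andP[_ /eqP/kerP//]|/eqP//].
move=> q; split; last exact: PQ.
apply: (@incomparable [set q | (map_poly al q).[t] = 0] f) => //.
  split=> [|/=|x y /=]; last first.
  - by rewrite rmorphM hornerM => /eqP; rewrite mulf_eq0 => /orP[]/eqP; [left|right].
  - by rewrite rmorph1 hornerC => /eqP; rewrite oner_eq0.
  split=> [|x y /=|a x /=]; first by rewrite /= rmorph0 horner0.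
    by rewrite rmorphD hornerD => -> ->; rewrite addr0.
  by rewrite rmorphM hornerM => ->; rewrite mulr0.
by move=> a; rewrite /contraction /= map_polyC hornerC /= => /kerP.
Qed.

End Roots.

End PolyIdeals.

Lemma poly_eval_hom (A B : comNzRingType) (al : {rmorphism A -> B}) (t : B) :
  exists be : {rmorphism {poly A} -> B},
    (forall a, be a%:P = al a) /\ forall q, be q = (map_poly al q).[t].
Proof.
have cm : commr_rmorph al t by move=> x; apply: mulrC.
by exists (horner_morph cm); split=> [a|q] //; exact: horner_morphC.
Qed.

Lemma minimal_root (A : comNzRingType) (L : closedFieldType) (al : {rmorphism A -> L})
    (P : set {poly A}) f : ideal P -> (forall a, al a = 0 <-> contraction P a) ->
  minimal_in P f -> exists t, (map_poly al f).[t] = 0.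
Proof.
move=> iP kerP mf; have [_ nl _] := mf.
have : size (map_poly al f) != 1%N.
  rewrite size_poly_eq; last by apply/eqP => /kerP.
  by rewrite gtn_eqF// (minimal_size iP mf).
by move=> /closed_rootP[t /rootP]; exists t.
Qed.

(** Variables are added one at a time. If [P] is larger than the extension of
    its contraction, the new variable is sent to a root of a minimal element;
    otherwise it is sent to a transcendental element of a larger algebraically
    closed field. *)
Lemma closed_point (K : rcfType) n (P : set (ipoly K n)) : prime_ideal P ->
  exists (L : closedFieldType) (h : {rmorphism ipoly K n -> L}), forall q, h q = 0 <-> P q.
Proof.
elim: n P => [|n IH] P pP.
  exists (K[i])%C, (real_complex K) => q; split=> [/eqP|].
    by rewrite fmorph_eq0 => /eqP->; have [iP _ _] := pP; exact: ideal0.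
  move=> Pq; apply/eqP; rewrite fmorph_eq0; apply/negPn/negP => q0.
  by have [iP nP _] := pP; apply: nP; rewrite -(mulVf q0); exact: idealMl.
have [L [al kerP]] := IH _ (contraction_prime pP).
have [iP nP1 dP] := pP.
have [[g [Pg ng]]|N] := pselect (exists g, P g /\ ~ coefs_in P g).
  have [f mf] := exists_minimal_in iP Pg ng.
  have [t ft] := minimal_root iP kerP mf.
  have [be [_ beE]] := poly_eval_hom al t.
  exists L, be => q; rewrite beE. have rk := root_kernel kerP pP mf ft. exact: rk.
have char0 m : m.+1%:R != 0 :> L.
  have -> : m.+1%:R = (al \o ipolyC K n) m.+1%:R by rewrite rmorph_nat.
  by rewrite fmorph_eq0 pnatr_eq0.
have [L' [g [t tP]]] := transcendental_extension char0.
have [be [_ beE]] := poly_eval_hom (g \o al) t.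
exists L', be => q; rewrite beE map_poly_comp; split=> [/tP/map_coefs_in|Pq].
  by move/(_ _ kerP) => h; exact: coefs_inW.
rewrite (map_coefs_in kerP q).2 ?rmorph0 ?horner0//.
by apply: contrapT => nq; apply: N; exists q.
Qed.

(** The hypothesis on [q] says that the quotient by [P] is integral over [H]; it
    excludes the transcendental case at each step, so that the target field does
    not grow. *)
Lemma tower_point (H : comNzRingType) (L : closedFieldType) (al : {rmorphism H -> L}) m
    (P : set (ipoly H m)) : prime_ideal P -> (forall a, al a = 0 <-> P (ipolyC H m a)) ->
  (forall q, exists d (a : nat -> H), P (q ^+ d + \sum_(i < d) ipolyC H m (a i) * q ^+ i)) ->
  exists h : {rmorphism ipoly H m -> L},
    (forall a, h (ipolyC H m a) = al a) /\ forall q, h q = 0 <-> P q.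
Proof.
elim: m P => [|m IH] P pP kerP int; first by exists al.
have [iP nP1 dP] := pP.
have [|//|q|h [hC kerh]] := IH (contraction P); first exact: contraction_prime.
  have [d [a r]] := int q%:P; exists d, a; move: r.
  rewrite /contraction /= polyCD polyC_exp rmorph_sum /=; congr (P (_ + _)).
  by apply: eq_bigr => i _; rewrite polyCM polyC_exp.
have [d [a r]] := int 'X.
have [f mf] : exists f, minimal_in P f.
  apply: (exists_minimal_in iP r) => /(_ d); rewrite /contraction /=.
  rewrite coefD coefXn eqxx coef_sum big1 ?addr0 ?polyC1// => i _ /=.
  by rewrite mul_polyC coefZ coefXn gtn_eqF// mulr0.
have [t ft] := minimal_root iP kerh mf.
have [be [beC beE]] := poly_eval_hom h t.
exists be; split=> [b|q]; first by rewrite /= beC hC.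
by have rk := root_kernel kerh pP mf ft; rewrite beE; exact: rk.
Qed.

(** * Real closed fields *)

Lemma sqr_sum_eq0 (K : realDomainType) (s : seq K) :
  \sum_(x <- s) x ^+ 2 = 0 -> forall x, x \in s -> x = 0.
Proof.
move=> /eqP; rewrite psumr_eq0; last by move=> x _; exact: sqr_ge0.
by move=> /allP h x /h /=; rewrite sqrf_eq0 => /eqP.
Qed.

(** A nonzero polynomial has a nonzero value. *)
Lemma sqr_sum_poly_eq0 (K : realFieldType) (rs : seq {poly K}) :
  \sum_(r <- rs) r ^+ 2 = 0 -> forall r, r \in rs -> r = 0.
Proof.
move=> E r rrs; apply: contrapT => /eqP r0.
have [k /eqP] := @exists_nonroot K r (fun n => lt0r_neq0 (ltr0Sn _ n)) r0; apply.
have := congr1 (horner_eval k%:R) E; rewrite raddf_sum/= /horner_eval horner0.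
under eq_bigr do rewrite horner_exp.
rewrite -(big_map (fun q : {poly K} => q.[k%:R]) predT (fun x => x ^+ 2)).
by move=> /sqr_sum_eq0; apply; apply: (map_f (fun q : {poly K} => q.[k%:R])).
Qed.

Section IVT.
Variables (K : realFieldType) (L : closedFieldType) (v : {rmorphism K -> L}).
(* [K] is maximal among the subfields of [L] without vanishing sums of squares *)
Hypothesis maxK : forall al : L, (exists x, v x = al) \/
  exists2 qs : seq {poly K}, \sum_(q <- qs) (map_poly v q).[al] ^+ 2 = 0 &
    exists2 q, q \in qs & (map_poly v q).[al] != 0.

Let sign_change_root n := forall (p : {poly K}) a b, (size p <= n)%N -> a < b ->
  p.[a] * p.[b] < 0 -> exists2 x, a < x < b & p.[x] = 0.

(** If [h] vanishes at [c] then so does the sum of squares, hence each [q]; then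
    ['X - c] divides each [q], its square divides the sum, and this square
    divides [h] as [p] does not vanish at [c]. *)
Lemma sum_sqr_factor (p h : {poly K}) (qs : seq {poly K}) c :
  \sum_(q <- qs) q ^+ 2 = p * h -> p.[c] != 0 -> h.[c] = 0 ->
  exists rs h', [/\ qs = map (fun r => r * ('X - c%:P)) rs,
    \sum_(r <- rs) r ^+ 2 = p * h' & h = h' * ('X - c%:P) ^+ 2].
Proof.
move=> E pc hc.
have qc q : q \in qs -> q.[c] = 0.
  have := congr1 (horner_eval c) E; rewrite raddf_sum/= /horner_eval hornerM hc mulr0.
  under eq_bigr do rewrite horner_exp.
  rewrite -(big_map (fun q : {poly K} => q.[c]) predT (fun x => x ^+ 2)).
  by move=> /sqr_sum_eq0 H qqs; apply: H; apply: (map_f (fun q : {poly K} => q.[c])).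
have [rs qsE] : exists rs, qs = map (fun r => r * ('X - c%:P)) rs.
  exists (map (fun q => q %/ ('X - c%:P)) qs); rewrite -map_comp -[LHS]map_id.
  apply/eq_in_map => q /qc /eqP; rewrite -/(root _ _) root_factor_theorem => dq.
  by rewrite /= divpK.
have X0 : 'X - c%:P != 0 :> {poly K} by rewrite polyXsubC_eq0.
have [h1 h1E] := factor_theorem h c (introT eqP hc).
have E1 : (\sum_(r <- rs) r ^+ 2) * ('X - c%:P) = p * h1.
  apply: (mulIf X0); rewrite -[RHS]mulrA -h1E -E qsE big_map -mulrA -expr2 mulr_suml.
  by apply: eq_bigr => r _; rewrite exprMn.
have h1c : h1.[c] = 0.
  have := congr1 (horner_eval c) E1; rewrite /= /horner_eval !hornerM !hornerE subrr mulr0.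
  by move=> /esym/eqP; rewrite mulf_eq0 (negPf pc) => /eqP.
have [h2 h2E] := factor_theorem h1 c (introT eqP h1c).
exists rs, h2; split=> //; last by rewrite h1E h2E expr2 mulrA.
by apply: (mulIf X0); rewrite E1 h2E mulrA.
Qed.

(** Adjoin a root of [p] inside [L]. If it is in [K], then [p] is linear.
    Otherwise a sum of squares vanishes at this root, that is, a sum of squares
    of polynomials smaller than [p] equals [p * h]. Then [h] changes sign where
    [p] does and is smaller than [p], so it has a root by induction; such roots
    of [h] can be cancelled as often as needed, which ends by a descent on the
    size of [h]. *)
Lemma irreducible_ivt n (p : {poly K}) a b : sign_change_root n -> (size p <= n.+1)%N ->
  irreducible_poly p -> a < b -> p.[a] * p.[b] < 0 -> exists2 x, a < x < b & p.[x] = 0.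
Proof.
move=> IH sp [p1 irr] ab pab.
have p0 : p != 0 by rewrite -size_poly_gt0 ltnW.
have [al pal] : exists al, (map_poly v p).[al] = 0.
  have /closed_rootP[t /rootP] : size (map_poly v p) != 1%N by rewrite size_map_poly gtn_eqF.
  by exists t.
have dvd (s : {poly K}) : (map_poly v s).[al] = 0 -> p %| s.
  move=> sal; apply: contraT => nd.
  have cop : coprimep p s.
    rewrite /coprimep; case: (eqVneq (size (gcdp p s)) 1%N) => // sg.
    have := irr _ sg (dvdp_gcdl p s); move=> /eqp_dvdl e.
    by move: (dvdp_gcdr p s); rewrite e (negPf nd).
  have := coprimep_root (x := al) (p := map_poly v p) (q := map_poly v s).
  by rewrite coprimep_map => /(_ cop); rewrite rootE pal eqxx sal eqxx => /(_ isT).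
case: (maxK al) => [[x xal]|[qs qs0 [q qqs qal]]].
  have px : p.[x] = 0 by apply: (fmorph_inj v); rewrite rmorph0 -horner_map xal.
  have /eqpP[[c d] /andP[/= c0 d0] e] : 'X - x%:P %= p.
    by apply: irr; [rewrite size_XsubC|rewrite -root_factor_theorem rootE px].
  exists x => //; move: (congr1 (horner_eval a) e) (congr1 (horner_eval b) e).
  rewrite /horner_eval !hornerZ !hornerE => ea eb.
  have : (a - x) * (b - x) < 0.
    rewrite -(pmulr_rlt0 _ (_ : 0 < c ^+ 2)) ?exprn_even_gt0//.
    rewrite (_ : _ * _ = (c * (a - x)) * (c * (b - x))); last by ring.
    rewrite ea eb (_ : _ * _ = d ^+ 2 * (p.[a] * p.[b])); last by ring.
    by rewrite pmulr_rlt0// exprn_even_gt0.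
  have [ax|ax] := ltP a x; have [xb|xb] := ltP x b => //.
  - by rewrite nmulr_rlt0 ?subr_lt0// subr_gt0 ltNge xb.
  - by rewrite ltNge mulr_ge0// subr_ge0// ltW.
  - by have := lt_le_trans ab (le_trans xb ax); rewrite ltxx.
pose good m := forall (h : {poly K}) (rs : seq {poly K}), (size h <= m)%N ->
  \sum_(r <- rs) r ^+ 2 = p * h -> (forall r, r \in rs -> (size r < size p)%N) ->
  (exists2 r, r \in rs & r != 0) -> exists2 x, a < x < b & p.[x] = 0.
have goodP m : good m.
  elim: m => [|m IHm] h rs sh E srs [r rrs r0].
    have h0 : h = 0 by apply/eqP; rewrite -size_poly_eq0 -leqn0.
    move: E; rewrite h0 mulr0 => /sqr_sum_poly_eq0/(_ _ rrs) re.
    by rewrite re eqxx in r0.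
  have h0 : h != 0.
    apply: contraNneq r0 => h0; move: E; rewrite h0 mulr0.
    by move=> /sqr_sum_poly_eq0/(_ _ rrs)->.
  have descend c : p.[c] != 0 -> h.[c] = 0 -> exists2 x, a < x < b & p.[x] = 0.
    move=> pc hc; have [rs' [h' [rsE E' hE]]] := sum_sqr_factor E pc hc.
    have X0 : 'X - c%:P != 0 :> {poly K} by rewrite polyXsubC_eq0.
    have h'0 : h' != 0 by apply: contraNneq h0 => h'0; rewrite hE h'0 mul0r.
    apply: (IHm h' rs' _ E').
    - move: sh; rewrite hE size_mul ?expf_neq0// size_exp_XsubC addnS /=.
      by rewrite addnS addn1 /= => /ltnW; rewrite ltnS.
    - move=> r' r'rs; apply: leq_ltn_trans (srs (r' * ('X - c%:P)) _); last first.
        by rewrite rsE; apply: (map_f (fun r => r * ('X - c%:P))).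
      have [->|r'0] := eqVneq r' 0; first by rewrite mul0r.
      by rewrite size_mul// size_XsubC addn2 /=.
    - move: rrs; rewrite rsE => /mapP[r' r'rs re]; exists r' => //.
      by apply: contraNneq r0 => r'0; rewrite re r'0 mul0r.
  have shn : (size h <= n)%N.
    have : (size (p * h)%R <= ((size p).-2 * 2).+1)%N.
      rewrite -E; apply: leq_trans (size_sum _ _ _) _; apply/bigmax_leqP_seq => q' q'rs _.
      apply: leq_trans (size_poly_exp_leq _ _) _; rewrite ltnS leq_mul2r /=.
      by move: (srs _ q'rs); case: (size p) p1 => [|[|k]]//= _; case: (size q').
    rewrite size_mul//; case: (size p) p1 sp => [|[|k]]//= _ kn.
    rewrite addSn ltnS muln2 -addnn leq_add2l => hk; apply: leq_trans hk _.
    by rewrite ltnS in kn; exact: ltnW.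
  have pa : p.[a] != 0 by apply: contraTneq pab => ->; rewrite mul0r ltxx.
  have pb : p.[b] != 0 by apply: contraTneq pab => ->; rewrite mulr0 ltxx.
  have [ha|ha] := eqVneq h.[a] 0; first exact: descend ha.
  have [hb|hb] := eqVneq h.[b] 0; first exact: descend hb.
  have pos c : 0 <= p.[c] * h.[c].
    rewrite -hornerM -E horner_sum; apply: sumr_ge0 => ? _.
    by rewrite horner_exp sqr_ge0.
  have hab : h.[a] * h.[b] < 0.
    rewrite lt_neqAle mulf_neq0//= -(nmulr_rge0 _ pab).
    by rewrite mulrACA mulr_ge0.
  have [c acb hc] := IH h a b shn ab hab.
  have [pc|pc] := eqVneq p.[c] 0; first by exists c.
  exact: descend pc hc.
have [h E] : exists h, \sum_(r <- map (fun q => q %% p) qs) r ^+ 2 = p * h.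
  have /dvdpP[h hE] : p %| \sum_(r <- map (fun q => q %% p) qs) r ^+ 2.
    apply: dvd; rewrite -[RHS]qs0 big_map raddf_sum /= horner_sum; apply: eq_bigr => s _.
    rewrite rmorphXn horner_exp /=; congr (_ ^+ 2).
    by rewrite [in RHS](divp_eq s p) rmorphD rmorphM !hornerE pal mulr0 add0r.
  by exists h; rewrite hE mulrC.
apply: (goodP _ h _ (leqnn _) E).
  by move=> _ /mapP[q' _ ->]; rewrite ltn_modp.
exists (q %% p); first exact: (map_f (fun q => q %% p)).
apply: contra_neq qal => qp; have := divp_eq q p; rewrite qp addr0 => ->.
by rewrite rmorphM hornerM pal mulr0.
Qed.

(** A polynomial which changes sign has a factor of smaller degree which does,
    unless it is irreducible. *)
Lemma ivt_of_maximal : Num.real_closed_axiom K.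
Proof.
have ivt : forall n, sign_change_root n.
  elim=> [|n IH] p a b sp ab pab.
    by move: sp pab; rewrite leqn0 size_poly_eq0 => /eqP->; rewrite !horner0 mulr0 ltxx.
  have [irr|red] := pselect (irreducible_poly p); first exact: irreducible_ivt IH sp irr ab pab.
  have p0 : p != 0 by apply: contraTneq pab => ->; rewrite !horner0 mul0r ltxx.
  have p1 : (1 < size p)%N.
    rewrite ltnNge; apply: contraL pab => /size1_polyC->.
    by rewrite !hornerC -leNgt -expr2 sqr_ge0.
  have [d [sd dp nd]] : exists d : {poly K}, [/\ size d != 1%N, d %| p & ~~ (d %= p)].
    apply: contrapT => N; apply: red; split=> // d sd dp; apply: contrapT => /negP nd.
    by apply: N; exists d.
  have d0 : d != 0 by apply: contraNneq p0 => d0; rewrite d0 dvd0p in dp.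
  have [e pE] : exists e, p = e * d by exists (p %/ d); rewrite divpK.
  have e0 : e != 0 by apply: contraNneq p0 => e0; rewrite pE e0 mul0r.
  have sdp : (size d < size p)%N by rewrite ltn_neqAle dvdp_size_eqp// nd dvdp_leq.
  have sep : (size e < size p)%N.
    rewrite pE size_mul//; have : (0 < size d)%N by rewrite size_poly_gt0.
    by case: (size d) sd => [|[|m]]// _ _; rewrite addnS /= addnS ltnS leq_addr.
  have : (d.[a] * d.[b]) * (e.[a] * e.[b]) < 0.
    by rewrite (_ : _ * _ = p.[a] * p.[b])// pE !hornerM; ring.
  have root_of f : f %| p -> (exists2 x, a < x < b & f.[x] = 0) -> exists2 x, a < x < b & p.[x] = 0.
    move=> /dvdpP[g ->] [x axb fx]; exists x => //; by rewrite hornerM fx mulr0.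
  have [dab _|dab] := ltP (d.[a] * d.[b]) 0.
    by apply: (root_of d) => //; apply: IH => //; rewrite -ltnS (leq_trans sdp).
  have [eab _|eab] := ltP (e.[a] * e.[b]) 0; last by rewrite ltNge mulr_ge0.
  apply: (root_of e); first by rewrite pE dvdp_mulr.
  by apply: IH => //; rewrite -ltnS (leq_trans sep).
move=> p a b ab /andP[pa pb].
move: pa; rewrite le_eqVlt => /orP[/eqP pa|pa].
  by exists a; rewrite ?lexx// rootE pa.
move: pb; rewrite le_eqVlt => /orP[/eqP pb|pb].
  by exists b; rewrite ?lexx ?andbT// rootE -pb.
have lt : a < b.
  by rewrite lt_neqAle ab andbT; apply/eqP => e; move: pb; rewrite -e ltNge ltW.
have [x /andP[ax xb] px] : exists2 x, a < x < b & p.[x] = 0.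
  by apply: (ivt (size p)) => //; rewrite nmulr_rlt0.
by exists x; rewrite ?ltW// rootE px.
Qed.
End IVT.

Section RealSubrings.
Variable L : closedFieldType.
Implicit Types F G : set L.

Definition is_subring F := [/\ F 1, forall x y, F x -> F y -> F (x - y) &
  forall x y, F x -> F y -> F (x * y)].

(** The usual definition of a real ring, for a subset of [L]. *)
Definition is_real F := forall s : seq L, (forall x, x \in s -> F x) ->
  \sum_(x <- s) x ^+ 2 = 0 -> forall x, x \in s -> x = 0.

Lemma subring0 F : is_subring F -> F 0.
Proof. by case=> F1 FB _; rewrite -(subrr 1); exact: FB. Qed.
Lemma subringN F x : is_subring F -> F x -> F (- x).
Proof. by move=> sF Fx; have [_ FB _] := sF; rewrite -sub0r; apply: (FB) => //; exact: subring0. Qed.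
Lemma subringD F x y : is_subring F -> F x -> F y -> F (x + y).
Proof. by move=> sF Fx Fy; have [_ FB _] := sF; rewrite -(opprK y); apply: (FB) => //; exact: subringN. Qed.
Lemma subringX F x n : is_subring F -> F x -> F (x ^+ n).
Proof. by move=> [F1 _ FM] Fx; elim: n => // n IH; rewrite exprS; exact: FM. Qed.
Lemma subring_sum F (T : eqType) (s : seq T) (f : T -> L) : is_subring F ->
  (forall i, i \in s -> F (f i)) -> F (\sum_(i <- s) f i).
Proof.
move=> sF h; rewrite big_seq; elim/big_ind: _ => //; [exact: subring0|by move=> *; exact: subringD].
Qed.

Lemma maximal_real_subring F0 : is_subring F0 -> is_real F0 ->
  exists F, [/\ is_subring F, is_real F, F0 `<=` F &
    forall G, is_subring G -> is_real G -> F `<=` G -> G `<=` F].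
Proof.
move=> s0 r0; have [|C Cn CP tot|F [[sF rF] F0F max]] :=
  @Zorn_above L (fun F => is_subring F /\ is_real F) F0; first by [].
  have wit s := @chain_seq L C s Cn tot; split.
    split; first by have [X CX] := Cn; exists X => //; have [[]] := CP _ CX.
      move=> x y Ux Uy; have [|X CX h] := wit [:: x; y].
        by move=> z; rewrite !inE => /orP[]/eqP->.
      by exists X => //; have [[_ XB _] _] := CP _ CX; apply: XB; apply: h; rewrite !inE eqxx ?orbT.
    move=> x y Ux Uy; have [|X CX h] := wit [:: x; y].
      by move=> z; rewrite !inE => /orP[]/eqP->.
    by exists X => //; have [[_ _ XM] _] := CP _ CX; apply: XM; apply: h; rewrite !inE eqxx ?orbT.
  move=> s /wit[X CX Xs]; have [_ rX] := CP _ CX; exact: rX.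
by exists F; split=> // G sG rG; apply: max.
Qed.

Section Maximal.
Variable F : set L.
Hypothesis sF : is_subring F.
Hypothesis rF : is_real F.
Hypothesis maxF : forall G, is_subring G -> is_real G -> F `<=` G -> G `<=` F.

Definition coefs_inF (q : {poly L}) := forall i : nat, F q`_i.

Lemma coefs_inF_C c : F c -> coefs_inF c%:P.
Proof. by move=> Fc i; rewrite coefC; case: ifP => // _; exact: subring0. Qed.

(** Adjoining to a maximal real subring an element outside it produces a
    vanishing sum of squares. *)
Lemma maximal_isotropic al : ~ F al -> exists2 qs : seq {poly L},
  (forall q, q \in qs -> coefs_inF q) /\ \sum_(q <- qs) q.[al] ^+ 2 = 0 &
  exists2 q, q \in qs & q.[al] != 0.
Proof.
move=> nF; pose G := [set x | exists2 q : {poly L}, coefs_inF q & x = q.[al]].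
have sG : is_subring G.
  have [F1 FB FM] := sF; split.
  - by exists 1; rewrite ?hornerC//; exact: coefs_inF_C.
  - move=> _ _ [p cp ->] [q cq ->]; exists (p - q); rewrite ?hornerE// => i.
    by rewrite coefB; exact: FB.
  - move=> _ _ [p cp ->] [q cq ->]; exists (p * q); rewrite ?hornerE// => i.
    by rewrite coefM; apply: subring_sum => // j _; exact: FM.
have FG : F `<=` G by move=> x Fx; exists x%:P; rewrite ?hornerC//; exact: coefs_inF_C.
have nrG : ~ is_real G.
  move=> rG; apply: nF; apply: (maxF sG rG FG); exists 'X; rewrite ?hornerX// => i.
  by rewrite coefX; case: eqP => _; [have [] := sF|exact: subring0].
apply: contrapT => N; apply: nrG => s sGs.
have [qs qsc ->] : exists2 qs : seq {poly L}, (forall q, q \in qs -> coefs_inF q) &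
    s = map (fun q => q.[al]) qs.
  elim: s sGs => [|x s IH] sGs; first by exists [::].
  have [|qs qsc ->] := IH; first by move=> y ys; apply: sGs; rewrite inE ys orbT.
  have [q cq ->] := sGs x (mem_head _ _); exists (q :: qs) => // r.
  by rewrite inE => /orP[/eqP->//|/qsc].
rewrite big_map => e _ /mapP[q qqs ->]; apply: contrapT => /eqP q0.
by apply: N; exists qs => //; exists q.
Qed.

(** Multiplying a sum of squares of polynomials in [x^-1] by a high even power
    of [x] gives a sum of squares in [F]. *)
Lemma maximal_inv x : F x -> F x^-1.
Proof.
move=> Fx; have [->|x0] := eqVneq x 0; first by rewrite invr0; exact: subring0.
apply: contrapT => /maximal_isotropic[qs [cqs e] [q qqs qx]].
pose N := \max_(q <- qs) size q.
have Nq r : r \in qs -> (size r <= N)%N by move=> rqs; rewrite /N (big_rem r rqs) /= leq_maxl.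
suff : x ^+ N * q.[x^-1] = 0 by move/eqP; rewrite mulf_eq0 expf_eq0 (negPf x0) (negPf qx) andbF.
apply: (rF (s := map (fun q => x ^+ N * q.[x^-1]) qs)); last exact: (map_f (fun q => x ^+ N * q.[x^-1])).
  move=> _ /mapP[r rqs ->]; rewrite (horner_coef_wide _ (Nq _ rqs)) mulr_sumr.
  apply: subring_sum => // i _; rewrite mulrCA exprVn -expfB ?ltn_ord//.
  have [_ _ FM] := sF; apply: (FM); [exact: cqs|exact: subringX].
rewrite big_map; under eq_bigr do rewrite exprMn.
by rewrite -mulr_sumr e mulr0.
Qed.

Definition sos x := exists2 s, (forall y, y \in s -> F y) & x = \sum_(y <- s) y ^+ 2.

Lemma sosM x y : sos x -> sos y -> sos (x * y).
Proof.
have [_ _ FM] := sF; move=> [s Fs ->] [t Ft ->]; exists [seq a * b | a <- s, b <- t].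
  by move=> _ /allpairsP[[a b] /= [sa tb ->]]; apply: (FM); [exact: Fs|exact: Ft].
rewrite big_allpairs_dep /= mulr_suml; apply: eq_bigr => a _.
by rewrite mulr_sumr; apply: eq_bigr => b _; rewrite exprMn.
Qed.

Lemma sos_sqr x : F x -> sos (x ^+ 2).
Proof. by move=> Fx; exists [:: x]; [move=> y; rewrite inE => /eqP->|rewrite big_seq1]. Qed.

(** Elements of [F[al]] reduce to degree one, as the square of [al] is in [F]. *)
Lemma horner_sqrt a al q : F a -> al ^+ 2 = a -> coefs_inF q ->
  exists u v, [/\ F u, F v & q.[al] = u + v * al].
Proof.
have [F1 FB FM] := sF; move=> Fa ala; elim/poly_ind: q => [|q c IH] cq.
  by exists 0, 0; rewrite horner0 mul0r addr0; split=> //; exact: subring0.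
have [|u [v [Fu Fv e]]] := IH.
  by move=> i; have := cq i.+1; rewrite coefD coefMX coefC /= addr0.
exists (v * a + c), u; split=> //.
  apply: subringD => //; first exact: FM.
  by have := cq 0%N; rewrite coefD coefMX coefC /= add0r.
by rewrite !hornerE e -ala; ring.
Qed.

(** Write a vanishing sum of squares in [F] extended by a square root of [a] as
    a sum of (u + v al)^2. Its part along [al] vanishes since [al] is not in
    [F], so the sums U of the u^2 and V of the v^2 satisfy U + a V = 0, and - a
    = U V / V^2 is a sum of squares. *)
Lemma sqrt_or_sos a : F a -> (exists2 b, F b & b ^+ 2 = a) \/ sos (- a).
Proof.
move=> Fa; have [F1 FB FM] := sF.
have /closed_rootP[al] : size ('X^2 - a%:P) != 1%N by rewrite size_XnsubC.
rewrite rootE hornerD hornerN hornerXn hornerC subr_eq0 => /eqP ala.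
have [Fal|nFal] := pselect (F al); first by left; exists al.
have [qs [cqs e] [q qqs qal]] := maximal_isotropic nFal.
have [ts Fts tsE] : exists2 ts : seq (L * L), (forall t, t \in ts -> F t.1 /\ F t.2) &
    map (fun q => q.[al]) qs = map (fun t => t.1 + t.2 * al) ts.
  elim: qs cqs {e qqs} => [|r qs IH] cqs; first by exists [::].
  have [|ts Fts tsE] := IH; first by move=> y ys; apply: cqs; rewrite inE ys orbT.
  have [u [v [Fu Fv ruv]]] := horner_sqrt Fa ala (cqs r (mem_head _ _)).
  exists ((u, v) :: ts); last by rewrite /= ruv tsE.
  by move=> t; rewrite inE => /orP[/eqP->//|/Fts].
rewrite -(big_map (fun q : {poly L} => q.[al]) predT (fun x => x ^+ 2)) tsE big_map in e.
pose U := \sum_(t <- ts) t.1 ^+ 2; pose V := \sum_(t <- ts) t.2 ^+ 2.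
pose W := \sum_(t <- ts) t.1 * t.2.
have UVW : U + a * V + al * (2%:R * W) = 0.
  rewrite -[RHS]e /U /V /W !mulr_sumr -!big_split /=; apply: eq_bigr => t _.
  by rewrite -ala; ring.
have FW : F W by apply: subring_sum => // t /Fts[]; exact: FM.
have FU : F U by apply: subring_sum => // t /Fts[? _]; exact: subringX.
have FV : F V by apply: subring_sum => // t /Fts[_ ?]; exact: subringX.
have F2 : F 2%:R by exact: subringD.
have n2 : 2%:R != 0 :> L.
  apply/eqP => e2; have /eqP := oner_neq0 L; apply.
  apply: (rF (s := [:: 1; 1])); rewrite ?mem_head//; first by move=> y; rewrite !inE orbb => /eqP->.
  by rewrite big_cons big_seq1 expr1n.
have W0 : W = 0.
  apply: contrapT => /eqP W0; apply: nFal.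
  have -> : al = - (U + a * V) * (2%:R * W)^-1.
    have nW : 2%:R * W != 0 by rewrite mulf_neq0.
    by apply: (mulIf nW); rewrite mulfVK//; apply/eqP; rewrite -addr_eq0 addrC UVW.
  apply: (FM); first by apply: subringN => //; apply: subringD => //; exact: FM.
  by apply: maximal_inv; exact: FM.
move: UVW; rewrite W0 !mulr0 addr0 => /eqP; rewrite addr_eq0 => /eqP UV.
have [V0|V0] := eqVneq V 0.
  have U0 : U = 0 by rewrite UV V0 mulr0 oppr0.
  have : q.[al] \in map (fun q => q.[al]) qs by exact: (map_f (fun q => q.[al])).
  rewrite tsE => /mapP[t tts qt]; case/eqP: qal; rewrite qt.
  have -> : t.1 = 0.
    apply: (rF (s := map fst ts)); rewrite ?map_f ?big_map//.
    by move=> _ /mapP[t' /Fts[+ _] ->].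
  have -> : t.2 = 0.
    apply: (rF (s := map snd ts)); rewrite ?map_f ?big_map//.
    by move=> _ /mapP[t' /Fts[_ +] ->].
  by rewrite mul0r addr0.
right; have -> : - a = U * V * V^-1 ^+ 2.
  by rewrite UV expr2 mulrA mulfK// mulNr mulfK.
apply: sosM; last by apply: sos_sqr; exact: maximal_inv.
apply: sosM.
  exists (map fst ts); last by rewrite big_map.
  by move=> _ /mapP[t' /Fts[+ _] ->].
exists (map snd ts); last by rewrite big_map.
by move=> _ /mapP[t' /Fts[_ +] ->].
Qed.

(** If neither [a] nor [- a] is a square, both are sums of squares, with sum 0. *)
Lemma sqr_or_sqrN a : F a -> exists2 b, F b & b ^+ 2 = a \/ b ^+ 2 = - a.
Proof.
move=> Fa; have [[b Fb ba]|[s Fs sa]] := sqrt_or_sos Fa; first by exists b => //; left.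
have [[b Fb ba]|[t Ft ta]] := sqrt_or_sos (subringN sF Fa); first by exists b => //; right.
rewrite opprK in ta; exists 0; first exact: subring0.
left; apply/esym; rewrite expr0n /= ta big_seq big1// => x xt.
suff -> : x = 0 by rewrite expr0n.
apply: (rF (s := s ++ t)); last by rewrite mem_cat xt orbT.
  by move=> y; rewrite mem_cat => /orP[/Fs|/Ft].
by rewrite big_cat /= -sa -ta addNr.
Qed.

Definition Fpred : {pred L} := fun x => `[< F x >].

Fact Fpred_divring : divring_closed Fpred.
Proof.
have [F1 FB FM] := sF; split; first exact/asboolP.
  by move=> x y /asboolP Fx /asboolP Fy; apply/asboolP; exact: FB.
by move=> x y /asboolP Fx /asboolP Fy; apply/asboolP; apply: (FM) => //; exact: maximal_inv.
Qed.
HB.instance Definition _ := GRing.isDivringClosed.Build L Fpred Fpred_divring.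

Definition Fsub := {x : L | x \in Fpred}.
HB.instance Definition _ := [isSub of Fsub for @sval L (fun x => x \in Fpred)].
HB.instance Definition _ := [Choice of Fsub by <:].
HB.instance Definition _ := [SubChoice_isSubIntegralDomain of Fsub by <:].
HB.instance Definition _ := [SubIntegralDomain_isSubField of Fsub by <:].

Implicit Types x y z : Fsub.

Lemma Fsub_F x : F (\val x). Proof. by case: x => x /= /asboolP. Qed.

Lemma Fsub_lift a : F a -> exists x, \val x = a.
Proof. by move=> Fa; exists (Sub a (asboolT Fa : a \in Fpred)); rewrite SubK. Qed.

Lemma Fsub_real (s : seq Fsub) : \sum_(x <- s) x ^+ 2 = 0 -> forall x, x \in s -> x = 0.
Proof.
move=> e x xs; apply: val_inj; rewrite rmorph0.
apply: (rF (s := map val s)); last exact: map_f.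
  by move=> _ /mapP[y _ ->]; exact: Fsub_F.
transitivity (val (\sum_(x <- s) x ^+ 2)); last by rewrite e rmorph0.
by rewrite big_map rmorph_sum; apply: eq_bigr => y _; rewrite rmorphXn.
Qed.

(** Since [a] or [- a] is a square, the squares are the nonnegative elements of
    a total order. *)
Definition nneg x := `[< exists z, z ^+ 2 = x >].
Definition Fle x y := nneg (y - x).
Definition Flt x y := (y != x) && Fle x y.
Definition Fnorm x := if nneg x then x else - x.

Lemma nneg_total x : nneg x \/ nneg (- x).
Proof.
have [b /Fsub_lift[z <-]] := sqr_or_sqrN (Fsub_F x).
by rewrite -rmorphXn -rmorphN => -[] /val_inj e; [left|right]; apply/asboolP; exists z.
Qed.

Lemma nneg_anti x : nneg x -> nneg (- x) -> x = 0.
Proof.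
move=> /asboolP[z zx] /asboolP[w wx].
have := @Fsub_real [:: z; w]; rewrite big_cons big_seq1 zx wx subrr => /(_ erefl z).
by rewrite mem_head => /(_ isT) z0; rewrite -zx z0 expr0n.
Qed.

Lemma nnegD x y : nneg x -> nneg y -> nneg (x + y).
Proof.
move=> /asboolP[z zx] /asboolP[w wy]; have [//|/asboolP[t tE]] := nneg_total (x + y).
have := @Fsub_real [:: z; w; t]; rewrite !big_cons big_nil zx wy tE addr0 addrA subrr.
move=> /(_ erefl) h; apply/asboolP; exists 0.
have z0 : z = 0 by apply: h; exact: mem_head.
have w0 : w = 0 by apply: h; rewrite inE mem_head orbT.
by rewrite -zx -wy z0 w0 expr0n addr0.
Qed.

Lemma nnegM x y : nneg x -> nneg y -> nneg (x * y).
Proof.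
by move=> /asboolP[z <-] /asboolP[w <-]; apply/asboolP; exists (z * w); rewrite exprMn.
Qed.

Fact Fle0_add x y : Fle 0 x -> Fle 0 y -> Fle 0 (x + y).
Proof. by rewrite /Fle !subr0; exact: nnegD. Qed.
Fact Fle0_mul x y : Fle 0 x -> Fle 0 y -> Fle 0 (x * y).
Proof. by rewrite /Fle !subr0; exact: nnegM. Qed.
Fact Fle0_anti x : Fle 0 x -> Fle x 0 -> x = 0.
Proof. by rewrite /Fle subr0 sub0r; exact: nneg_anti. Qed.
Fact Fsub_ge0 x y : Fle 0 (y - x) = Fle x y.
Proof. by rewrite /Fle subr0. Qed.
Fact Fle0_total x : Fle 0 x || Fle x 0.
Proof. by rewrite /Fle subr0 sub0r; apply/orP; exact: nneg_total. Qed.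
Fact FnormN x : Fnorm (- x) = Fnorm x.
Proof.
rewrite /Fnorm opprK; case: ifPn => p; case: ifPn => q //.
  by rewrite (nneg_anti q p) oppr0.
by have [r|r] := nneg_total x; [rewrite r in q|rewrite r in p].
Qed.
Fact Fge0_norm x : Fle 0 x -> Fnorm x = x.
Proof. by rewrite /Fle subr0 /Fnorm => ->. Qed.

HB.instance Definition _ := Num.IntegralDomain_isLeReal.Build Fsub
  Fle0_add Fle0_mul Fle0_anti Fsub_ge0 Fle0_total FnormN Fge0_norm (fun _ _ => erefl).

Lemma Fsub_max (al : L) : (exists x, val x = al) \/
  exists2 qs : seq {poly Fsub},
    \sum_(q <- qs) (map_poly (val : {rmorphism Fsub -> L}) q).[al] ^+ 2 = 0 &
    exists2 q, q \in qs & (map_poly (val : {rmorphism Fsub -> L}) q).[al] != 0.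
Proof.
have [/Fsub_lift|/maximal_isotropic[qs [cqs e] [q qqs qal]]] := pselect (F al); first by left.
right; have [qs' qsE] : exists qs', qs = map (map_poly (val : {rmorphism Fsub -> L})) qs'.
  elim: qs cqs {e qqs} => [|r qs IH] cqs; first by exists [::].
  have [|qs' ->] := IH; first by move=> y ys; apply: cqs; rewrite inE ys orbT.
  have cr := cqs r (mem_head _ _).
  pose lift i : Fsub := Sub r`_i (asboolT (cr i) : r`_i \in Fpred).
  exists (\poly_(i < size r) lift i :: qs'); rewrite map_cons; congr (_ :: _).
  apply/polyP => i; rewrite coef_map coef_poly; case: ltnP => ir //=.
  by rewrite nth_default.
exists qs'; first by rewrite -[RHS]e qsE big_map.
by move: qqs; rewrite qsE => /mapP[q' q'qs qE]; exists q'; rewrite // -qE.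
Qed.

HB.instance Definition _ := Num.RealField_isClosed.Build Fsub (ivt_of_maximal Fsub_max).

Section Corestrict.
Variables (D : comNzRingType) (h : {rmorphism D -> L}).
Hypothesis hF : forall d, F (h d).
Definition corestrict (d : D) : Fsub := Sub (h d) (asboolT (hF d) : h d \in Fpred).
Fact corestrict_zmod : zmod_morphism corestrict.
Proof. by move=> a b; apply: val_inj; rewrite rmorphB !SubK rmorphB. Qed.
Fact corestrict_monoid : monoid_morphism corestrict.
Proof.
by split=> [|a b]; apply: val_inj; rewrite ?rmorphM ?rmorph1 !SubK ?rmorphM ?rmorph1.
Qed.
HB.instance Definition _ := GRing.isZmodMorphism.Build D Fsub corestrict corestrict_zmod.
HB.instance Definition _ := GRing.isMonoidMorphism.Build D Fsub corestrict corestrict_monoid.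

Lemma rcf_corestrict : exists (W : rcfType) (h' : {rmorphism D -> W}),
  forall d, h' d = 0 <-> h d = 0.
Proof.
exists Fsub, corestrict => d; split=> [/(congr1 val)|e]; first by rewrite SubK rmorph0.
by apply: val_inj; rewrite SubK rmorph0.
Qed.
End Corestrict.

End Maximal.

(** The hypothesis says that the kernel of [h] is a real ideal, that is, that
    the image of [h] is a real subring of [L]. *)
Lemma real_closed_point (D : comNzRingType) (h : {rmorphism D -> L}) :
  (forall s : seq D, h (\sum_(d <- s) d ^+ 2) = 0 -> forall d, d \in s -> h d = 0) ->
  exists (W : rcfType) (h' : {rmorphism D -> W}), forall d, h' d = 0 <-> h d = 0.
Proof.
move=> hr; have [||F [sF rF F0F maxF]] := @maximal_real_subring (range h).
- split=> [|_ _ [x _ <-] [y _ <-]|_ _ [x _ <-] [y _ <-]].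
  + by exists 1; rewrite ?rmorph1.
  + by exists (x - y); rewrite ?rmorphB.
  + by exists (x * y); rewrite ?rmorphM.
- move=> s sh; have [ds ->] : exists ds, s = map h ds.
    elim: s sh => [|x s IH] sh; first by exists [::].
    have [|ds ->] := IH; first by move=> y ys; apply: sh; rewrite inE ys orbT.
    by have [d _ <-] := sh x (mem_head _ _); exists (d :: ds).
  rewrite big_map => e _ /mapP[d dds ->]; apply: (hr ds) => //.
  by rewrite -[RHS]e rmorph_sum; apply: eq_bigr => y _; rewrite rmorphXn.
by apply: (rcf_corestrict sF rF maxF) => d; apply: F0F; exists d.
Qed.
End RealSubrings.

(** * Hilbert's basis theorem *)

(** Generation is expressed by the ideals containing the generators, which
    avoids linear combinations. *)
Definition finitely_generated (A : comPzRingType) (I : set A) :=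
  exists2 s : seq A, (forall x, x \in s -> I x) &
    forall J, ideal J -> (forall x, x \in s -> J x) -> I `<=` J.

Definition noetherian (A : comPzRingType) := forall I : set A, ideal I -> finitely_generated I.

Lemma noetherian_field (K : fieldType) : noetherian K.
Proof.
move=> I iI; have [[x [Ix x0]]|N] := pselect (exists x, I x /\ x != 0).
  exists [:: x] => [y|J iJ Jx y _]; first by rewrite inE => /eqP->.
  by rewrite -(mulfVK x0 y); apply: idealMl => //; apply: Jx; rewrite mem_head.
exists [::] => // J iJ _ y Iy; have [->|y0] := eqVneq y 0; first exact: ideal0.
by case: N; exists y.
Qed.

Section HilbertBasis.
Variable A : comNzRingType.
Hypothesis nA : noetherian A.
Variable I : set {poly A}.
Hypothesis iI : ideal I.

Let lead d : set A := [set a | exists f : {poly A}, [/\ I f, (size f <= d.+1)%N & f`_d = a]].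

Let lead_ideal (J : set {poly A}) d : ideal J ->
  ideal [set a | exists f : {poly A}, [/\ I f, J f, (size f <= d.+1)%N & f`_d = a]].
Proof.
move=> iJ; split=> [|_ _ [f [If Jf sf <-]] [g [Ig Jg sg <-]]|a _ [f [If Jf sf <-]]].
- by exists 0; rewrite size_poly0 coef0; split=> //; exact: ideal0.
- exists (f + g); rewrite coefD; split=> //; [exact: idealD|exact: idealD|].
  by rewrite (leq_trans (size_polyD _ _))// geq_max sf.
- exists (a%:P * f); rewrite coefCM; split=> //; [exact: idealMl|exact: idealMl|].
  by rewrite mul_polyC (leq_trans (size_scale_leq _ _)).
Qed.

Let lead_idealT d : ideal (lead d).
Proof.
have -> : lead d = [set a | exists f : {poly A}, [/\ I f, I f, (size f <= d.+1)%N & f`_d = a]].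
  by apply/seteqP; split=> a [f]; [case|case] => *; exists f.
exact: lead_ideal.
Qed.

Let lead_mono d e a : (d <= e)%N -> lead d a -> lead e a.
Proof.
move=> de [f [If sf <-]]; exists (f * 'X^(e - d)); rewrite coefMXn; split.
- exact: idealMr.
- rewrite (leq_trans (size_polyMleq _ _))// size_polyXn addnS /=.
  by rewrite (leq_trans (leq_add sf (leqnn _)))// addSn subnKC.
- by rewrite ltnNge leq_subr /= subKn.
Qed.

(* every leading coefficient of [I] in degree [d] is that of an element of [I] in
   the ideal generated by [G] *)
Let covers (G : seq {poly A}) d := forall J, ideal J -> (forall x : {poly A}, x \in G -> J x) ->
  forall a, lead d a -> exists f, [/\ I f, J f, (size f <= d.+1)%N & f`_d = a].

Let lifts d (s : seq A) : (forall a, a \in s -> lead d a) -> exists G : seq {poly A},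
  (forall f, f \in G -> I f) /\
  forall a, a \in s -> exists f, [/\ f \in G, (size f <= d.+1)%N & f`_d = a].
Proof.
elim: s => [|a s IH] h; first by exists [::].
have [|G [GI Gs]] := IH; first by move=> b bs; apply: h; rewrite inE bs orbT.
have [f [If sf fa]] := h a (mem_head _ _); exists (f :: G); split.
  by move=> g; rewrite inE => /orP[/eqP->|/GI].
move=> b; rewrite inE => /orP[/eqP->|/Gs[g [gG sg gb]]]; first by exists f; rewrite mem_head.
by exists g; rewrite inE gG orbT.
Qed.

Let cover1 d : exists2 G, (forall f, f \in G -> I f) & covers G d.
Proof.
have [s sl sgen] := nA (lead_idealT d); have [G [GI Gs]] := lifts sl.
exists G => // J iJ GJ a; apply: (sgen _ (lead_ideal d iJ)) => b /Gs[f [fG sf fb]].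
by exists f; split=> //; [exact: GI|exact: GJ].
Qed.

Let cover_below N : exists2 G, (forall f, f \in G -> I f) & forall d, (d < N)%N -> covers G d.
Proof.
elim: N => [|N [G GI Gc]]; first by exists [::].
have [G' GI' Gc'] := cover1 N; exists (G ++ G').
  by move=> f; rewrite mem_cat => /orP[/GI|/GI'].
move=> d; rewrite ltnS leq_eqVlt => /orP[/eqP->|dN] J iJ GJ.
  by apply: Gc' => // f fG; apply: GJ; rewrite mem_cat fG orbT.
by apply: Gc => // f fG; apply: GJ; rewrite mem_cat fG.
Qed.

Let cover_above : exists N, exists2 G, (forall f, f \in G -> I f) & forall d, (N <= d)%N -> covers G d.
Proof.
pose Loo : set A := [set a | exists d, lead d a].
have iL : ideal Loo.
  split=> [|x y [d dx] [e ey]|a x [d dx]].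
  - by exists 0%N; exact: ideal0 (lead_idealT _).
  - exists (maxn d e); apply: idealD (lead_idealT _) _ _.
      by apply: lead_mono dx; exact: leq_maxl.
    by apply: lead_mono ey; exact: leq_maxr.
  - by exists d; exact: idealMl (lead_idealT _) _.
have [s sl sgen] := nA iL.
have [N Nl] : exists N, forall a, a \in s -> lead N a.
  elim: s sl {sgen} => [|a s IH] sl; first by exists 0%N.
  have [|N Nl] := IH; first by move=> b bs; apply: sl; rewrite inE bs orbT.
  have [d da] := sl a (mem_head _ _); exists (maxn d N) => b.
  rewrite inE => /orP[/eqP->|/Nl]; first by apply: lead_mono da; exact: leq_maxl.
  by apply: lead_mono; exact: leq_maxr.
have [G [GI Gs]] := lifts Nl; exists N, G => // d Nd J iJ GJ a ad.
have : Loo a by exists d.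
apply: (sgen _ (lead_ideal d iJ)) => b /Gs[f [fG sf <-]].
exists (f * 'X^(d - N)); rewrite coefMXn ltnNge leq_subr /= subKn//; split=> //.
- by apply: idealMr => //; exact: GI.
- by apply: idealMr => //; exact: GJ.
rewrite (leq_trans (size_polyMleq _ _))// size_polyXn addnS /=.
by rewrite (leq_trans (leq_add sf (leqnn _)))// addSn subnKC.
Qed.

(** Cancelling leading coefficients by elements of the ideal generated by the
    finite list reduces any element of [I] to 0. The ideals of leading
    coefficients in degree [d] increase with [d] to a finitely generated ideal,
    so that finitely many degrees suffice. *)
Lemma hilbert_basis : finitely_generated I.
Proof.
have [N [G GI Gc]] := cover_above; have [G' GI' Gc'] := cover_below N.
exists (G ++ G') => [f|J iJ GJ]; first by rewrite mem_cat => /orP[/GI|/GI'].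
have cov d : covers (G ++ G') d.
  move=> J' iJ' GJ'; have [dN|Nd] := ltnP d N.
    by apply: Gc' => // f fG; apply: GJ'; rewrite mem_cat fG orbT.
  by apply: Gc => // f fG; apply: GJ'; rewrite mem_cat fG.
move=> f; move: {2}(size f) (leqnn (size f)) => n.
elim: n f => [|n IH] f sf If.
  by move: sf; rewrite leqn0 size_poly_eq0 => /eqP->; exact: ideal0.
have [g [Ig Jg sg gf]] := cov n J iJ GJ f`_n (ex_intro _ f (And3 If sf erefl)).
rewrite -(subrK g f); apply: idealD => //; apply: IH; last exact: idealB.
apply/leq_sizeP => j; rewrite leq_eqVlt => /orP[/eqP<-|nj]; first by rewrite coefB gf subrr.
by rewrite coefB !nth_default ?subrr// (leq_trans _ nj).
Qed.
End HilbertBasis.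

Lemma noetherian_ipoly (K : fieldType) m n : noetherian (ipoly (ipoly K n) m).
Proof.
elim: m => [|m IH]; last by move=> I iI; exact: hilbert_basis IH _ iI.
elim: n => [|n IH]; first exact: noetherian_field.
by move=> I iI; exact: hilbert_basis IH _ iI.
Qed.

(** * Symbolic complex points *)

Section ComplexMap.
Variables (A B : comPzRingType) (f : {rmorphism A -> B}).
Definition cxmap (z : complexification A) : complexification B := (f z.1, f z.2).
Fact cxmap_zmod : zmod_morphism cxmap.
Proof. by move=> z w; rewrite /cxmap !rmorphB. Qed.
Fact cxmap_monoid : monoid_morphism cxmap.
Proof.
split; first by rewrite /cxmap rmorph1 rmorph0.
by move=> z w; rewrite /cxmap !rmorphD rmorphN !rmorphM.
Qed.
HB.instance Definition _ := GRing.isZmodMorphism.Build _ _ cxmap cxmap_zmod.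
HB.instance Definition _ := GRing.isMonoidMorphism.Build _ _ cxmap cxmap_monoid.
End ComplexMap.

Section ComplexEval.
Variables (A : comPzRingType) (F : rcfType) (f : {rmorphism A -> F}).
Definition cxeval (z : complexification A) : F[i]%C := (f z.1 +i* f z.2)%C.
Fact cxeval_zmod : zmod_morphism cxeval.
Proof. by move=> z w; rewrite /cxeval !rmorphB. Qed.
Fact cxeval_monoid : monoid_morphism cxeval.
Proof.
split; first by rewrite /cxeval rmorph1 rmorph0.
by move=> z w; rewrite /cxeval !rmorphD rmorphN !rmorphM.
Qed.
HB.instance Definition _ := GRing.isZmodMorphism.Build _ _ cxeval cxeval_zmod.
HB.instance Definition _ := GRing.isMonoidMorphism.Build _ _ cxeval cxeval_monoid.
End ComplexEval.

Lemma nontrivial_ring (B : comPzRingType) : (1 : B) != 0 ->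
  {B' : comNzRingType | (B' : comPzRingType) = B}.
Proof.
case: B => B c n10; pose B0 : comPzRingType := GRing.ComPzRing.Pack c.
pose m := GRing.PzSemiRing_isNonZero.Build B0 n10.
pose B' : comNzRingType := HB.pack B c m.
by exists B'.
Qed.

Lemma poly_hom (A : comNzRingType) (B : comPzRingType) (al : {rmorphism A -> B}) (t : B) :
  exists be : {rmorphism {poly A} -> B}, (forall a, be a%:P = al a) /\ be 'X = t.
Proof.
have [e|/nontrivial_ring[B' eB]] := eqVneq (1 : B) 0.
  have triv (x y : B) : x = y by rewrite -[x]mul1r -[y]mul1r e !mul0r.
  by exists (al \o horner_eval 0); split=> [a|]; exact: triv.
move: al t; rewrite -eB {B eB} => al t.
have cm : commr_rmorph al t by move=> x; apply: mulrC.
by exists (horner_morph cm); split=> [a|]; [exact: horner_morphC|exact: horner_morphX].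
Qed.

Lemma poly_rmorph_ext (A : comNzRingType) (B : pzRingType) (f g : {rmorphism {poly A} -> B}) :
  (forall a, f a%:P = g a%:P) -> f 'X = g 'X -> f =1 g.
Proof.
move=> fg fgX; elim/poly_ind => [|q c IH]; first by rewrite !rmorph0.
by rewrite !rmorphD !rmorphM /= IH fg fgX.
Qed.

Section SymbolicPoint.
Variables (R W : rcfType).

(** A point of the R-algebra [G] with coordinates in W[i] is the specialisation,
    by a morphism [al'] to [W], of a point whose coordinates are symbols u + i v,
    with u and v in a polynomial ring [A'] to which transfer applies. The
    construction extends a given specialisation [al], so that two points can be
    made symbolic over the same ring. *)
Definition has_symbolic_points (G : comNzRingType) (iG : R -> G) :=
  forall (A : comNzRingType) (i : {rmorphism R -> A}) (al : {rmorphism A -> W}) (h : {rmorphism G -> W[i]%C}),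
    transferable W i -> (forall c, h (iG c) = (al (i c))%:C%C) ->
  exists (A' : comNzRingType) (i' : {rmorphism R -> A'}) (e : {rmorphism A -> A'})
    (al' : {rmorphism A' -> W}) (Phi : {rmorphism G -> complexification A'}),
    [/\ transferable W i', (forall c, e (i c) = i' c), (forall a, al' (e a) = al a),
        (forall c, Phi (iG c) = (i' c, 0)) & forall u, h u = cxeval al' (Phi u)].

Lemma symbolic_points_base : has_symbolic_points (@idfun R).
Proof.
move=> A i al h tA hi.
have cst_z : zmod_morphism (fun c => (i c, 0) : complexification A).
  by move=> c d; rewrite rmorphB; congr (_, _); rewrite subr0.
have cst_m : monoid_morphism (fun c => (i c, 0) : complexification A).
  split=> [|c d]; first by rewrite rmorph1.
  by rewrite rmorphM; congr (_, _); rewrite /= !(mul0r, mulr0, subr0, addr0).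
pose m1 := GRing.isZmodMorphism.Build R (complexification A) _ cst_z.
pose m2 := GRing.isMonoidMorphism.Build R (complexification A) _ cst_m.
pose Phi : {rmorphism R -> complexification A} :=
  HB.pack (fun c => (i c, 0) : complexification A) m1 m2.
exists A, i, idfun, al, Phi; split=> // u.
by rewrite hi /cxeval /= rmorph0.
Qed.

(** The new coordinate requires two variables, for its real and imaginary parts. *)
Lemma symbolic_points_poly (G : comNzRingType) (iG : R -> G) :
  has_symbolic_points iG -> has_symbolic_points (fun c => (iG c)%:P).
Proof.
move=> sG A i al h tA hi.
have [|A' [i' [e [al' [Phi [tA' ei ale PhiC hE]]]]]] := sG A i al (h \o @polyC G) tA.
  by move=> c; exact: hi.
have [al1 [al1C al1X]] := poly_hom al' (complex.Re (h 'X)).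
have [al2 [al2C al2X]] := poly_hom al1 (complex.Im (h 'X)).
pose up : {rmorphism A' -> {poly {poly A'}}} := @polyC {poly A'} \o @polyC A'.
have [Phi' [Phi'C Phi'X]] := poly_hom (cxmap up \o Phi) ('X%:P, 'X).
exists {poly {poly A'}}, (up \o i'), (up \o e), al2, Phi'; split.
- exact: (transferable_poly (transferable_poly tA')).
- by move=> c; rewrite /= ei.
- by move=> a; rewrite /= al2C al1C ale.
- by move=> c; rewrite Phi'C /= PhiC /cxmap /= !rmorph0.
- apply: (poly_rmorph_ext (g := cxeval al2 \o Phi')) => [a|] /=.
    by rewrite Phi'C [LHS]hE /= /cxeval /cxmap /= !al2C !al1C.
  by rewrite Phi'X /cxeval /= al2C al1X al2X; case: (h 'X).
Qed.

Lemma symbolic_points_ipoly (G : comNzRingType) (iG : R -> G) m :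
  has_symbolic_points iG -> has_symbolic_points (ipolyC G m \o iG).
Proof. by move=> sG; elim: m => // m IH; exact: symbolic_points_poly IH. Qed.

End SymbolicPoint.

(** The list consists of the variables; the statement is the induction principle
    that they provide. *)
Lemma ipoly_gens (A : comNzRingType) n : exists us : seq (ipoly A n),
  forall Q : set (ipoly A n), (forall c, Q (ipolyC A n c)) -> (forall u, u \in us -> Q u) ->
    (forall u v, Q u -> Q v -> Q (u + v)) -> (forall u v, Q u -> Q v -> Q (u * v)) ->
    forall u, Q u.
Proof.
elim: n => [|n [us usP]]; first by exists [::].
exists ('X :: map (@polyC (ipoly A n)) us) => Q QC Qus QD QM.
have Qc u : Q u%:P.
  apply: (usP (fun u => Q u%:P)) => [c|v vus|v w|v w]; first exact: QC.
  - by apply: Qus; rewrite inE map_f ?orbT.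
  - by rewrite polyCD; exact: QD.
  - by rewrite polyCM; exact: QM.
elim/poly_ind => [|q c IH]; first exact: Qc 0.
by apply: (QD); [apply: QM => //; apply: Qus; exact: mem_head|exact: Qc].
Qed.


(** * Fibres over real points *)

Section RealPoints.
Variables (R : realType) (X : affScheme R).

Lemma scalar_in_ideal (J : set X) c : ideal J -> ~ J 1 -> J (scalar X c) -> c = 0.
Proof.
move=> iJ nJ1 Jc; apply: contrapT => /eqP c0; apply: nJ1.
by rewrite -(rmorph1 (scalar X)) -(mulVf c0) rmorphM; exact: idealMl.
Qed.

(** A proper ideal with residue ring R is maximal, since R is a field. *)
Lemma real_pointI (m : set X) : ideal m -> ~ m 1 ->
  (forall a, exists c, m (a - scalar X c)) -> real_points m.
Proof.
move=> im nm1 res; split; last first.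
  move=> a; have [c mc] := res a; exists c; split=> // d md.
  apply/eqP; rewrite -subr_eq0; apply/eqP/(scalar_in_ideal im nm1).
  have -> : scalar X (c - d) = (a - scalar X d) - (a - scalar X c).
    by rewrite rmorphB; ring.
  exact: idealB.
split=> // J iJ nJ1 mJ; apply/seteqP; split=> // a Ja; have [c mc] := res a.
have c0 : c = 0.
  apply: (scalar_in_ideal iJ nJ1).
  rewrite -[scalar X c](subKr a); apply: idealB => //; exact: mJ.
by move: mc; rewrite c0 rmorph0 subr0.
Qed.

Lemma real_point_residue (m : set X) : real_points m -> 
  [/\ ideal m, ~ m 1 & forall a, exists c, m (a - scalar X c)].
Proof. by case=> -[im nm1 _] h; split=> // a; have [c []] := h a; exists c. Qed.

End RealPoints.

Section ComplexFold.
Variables (R : realType) (G : comPzRingType) (g : {rmorphism G -> complexification R}).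

Let im : complexification R := (0, 1).
Let im2 : im * im = -1.
Proof. by congr (_, _) => /=; ring. Qed.

(** The extension of [g] to G tensored with C, sending u + i v to g(u) + i g(v). *)
Definition cxfold (w : complexification G) : complexification R := g w.1 + im * g w.2.
Fact cxfold_zmod : zmod_morphism cxfold.
Proof. by move=> z w; rewrite /cxfold !rmorphB /=; ring. Qed.
Fact cxfold_monoid : monoid_morphism cxfold.
Proof.
split; first by rewrite /cxfold rmorph1 rmorph0 mulr0 addr0.
move=> z w; rewrite /cxfold !rmorphD rmorphN !rmorphM /=.
transitivity (g z.1 * g w.1 + im * im * (g z.2 * g w.2) + im * (g z.1 * g w.2 + g z.2 * g w.1)).
  by rewrite im2; ring.
by ring.
Qed.
HB.instance Definition _ := GRing.isZmodMorphism.Build _ _ cxfold cxfold_zmod.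
HB.instance Definition _ := GRing.isMonoidMorphism.Build _ _ cxfold cxfold_monoid.

Lemma cxfold_real w r s : g w.1 = (r, 0) -> g w.2 = (s, 0) -> cxfold w = (r, s).
Proof. by move=> e1 e2; rewrite /cxfold e1 e2; congr (_, _) => /=; ring. Qed.
End ComplexFold.

(** The rings [H] and [G] are polynomial rings presenting the coordinate rings of
    X and Z, by the surjections [phiA] and [phi]. Points of X and Z are handled as
    morphisms from [H] and [G] vanishing on the kernels of these surjections. *)
Section RealFibre.
Variables (R : realType) (X Z : affScheme R) (piZ : morphism Z X).
Hypothesis bij : bijective_over_real piZ.
Variables (H G : comNzRingType) (phiA : {rmorphism H -> X}) (iR : {rmorphism R -> H}).
Variables (iG : {rmorphism H -> G}) (phi : {rmorphism G -> Z}).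
Hypothesis phiA_scalar : forall c, phiA (iR c) = scalar X c.
Hypothesis phiA_surj : forall a, exists u, phiA u = a.
Hypothesis phi_surj : forall b, exists u, phi u = b.
Hypothesis phi_iG : forall u, phi (iG u) = piZ (phiA u).

Section OnePoint.
Variable g : {rmorphism G -> complexification R}.
Hypothesis g_ker : forall u, phi u = 0 -> g u = 0.
Hypothesis g_scalar : forall c, g (iG (iR c)) = (c, 0).
Hypothesis g_real : forall u, (g (iG u)).2 = 0.

(** The point of Z(C) given by [g], as a maximal ideal of the complexified
    coordinate ring. *)
Definition kernel_point : set (complexification Z) :=
  [set z | exists2 w, z = cxmap phi w & cxfold g w = 0].

Lemma kernel_pointE w : kernel_point (cxmap phi w) <-> cxfold g w = 0.
Proof.
split=> [[v e v0]|w0]; last by exists w.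
have d0 : cxmap phi (w - v) = 0 by rewrite rmorphB /= e subrr.
have : cxfold g (w - v) = 0.
  move: d0; rewrite /cxmap => -[] /g_ker e1 /g_ker e2.
  by rewrite /cxfold e1 e2 mulr0 addr0.
by rewrite rmorphB /= v0 subr0.
Qed.

Lemma cxmap_surj z : exists w, cxmap phi w = z.
Proof.
by case: z => a b; have [u <-] := phi_surj a; have [v <-] := phi_surj b; exists (u, v).
Qed.

Lemma cxfold_scalar r s : cxfold g (iG (iR r), iG (iR s)) = (r, s).
Proof. by apply: cxfold_real; rewrite g_scalar. Qed.

(** An element with nonzero value r + i s has an inverse modulo [kernel_point],
    namely the scalar (r - i s) / (r^2 + s^2). *)
Lemma kernel_point_maximal : maximal_ideal kernel_point.
Proof.
have iP : ideal kernel_point.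
  split=> [|z w|z w]; first by rewrite -(rmorph0 (cxmap phi)); apply/kernel_pointE; rewrite rmorph0.
    have [z' <-] := cxmap_surj z; have [w' <-] := cxmap_surj w.
    move=> /kernel_pointE z0 /kernel_pointE w0; rewrite -rmorphD; apply/kernel_pointE.
    by rewrite rmorphD /= z0 w0 addr0.
  have [z' <-] := cxmap_surj z; have [w' <-] := cxmap_surj w.
  move=> /kernel_pointE w0; rewrite -rmorphM; apply/kernel_pointE.
  by rewrite rmorphM /= w0 mulr0.
split=> // [|J iJ nJ1 PJ].
  rewrite -(rmorph1 (cxmap phi)) => /kernel_pointE; rewrite rmorph1 => -[] /eqP.
  by rewrite oner_eq0.
apply/seteqP; split=> // z; have [w <-] := cxmap_surj z => Jw; apply/kernel_pointE.
case E : (cxfold g w) => [r s]; apply: contrapT => rs0; apply: nJ1.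
have d0 : r ^+ 2 + s ^+ 2 != 0.
  apply/eqP => /eqP; rewrite paddr_eq0 ?sqr_ge0// !sqrf_eq0 => /andP[/eqP r0 /eqP s0].
  by apply: rs0; rewrite r0 s0.
pose wc : complexification G := (iG (iR (r / (r ^+ 2 + s ^+ 2))), iG (iR (- s / (r ^+ 2 + s ^+ 2)))).
have e1 : cxfold g (1 - w * wc) = 0.
  rewrite rmorphB rmorph1 rmorphM /= E cxfold_scalar; congr (_, _) => /=; field => //.
have /PJ : kernel_point (cxmap phi (1 - w * wc)) by apply/kernel_pointE.
rewrite rmorphB rmorph1 rmorphM /= => J1.
rewrite -(subrK (cxmap phi w * cxmap phi wc) 1); apply: idealD => //.
exact: idealMr.
Qed.

(** The image in X of the point given by [g], which is real by [g_real]. *)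
Definition base_point : set X := [set a | exists2 u, a = phiA u & (g (iG u)).1 = 0].

Lemma base_pointE u : base_point (phiA u) <-> (g (iG u)).1 = 0.
Proof.
split=> [[v e v0]|u0]; last by exists u.
have : g (iG (u - v)) = 0 by apply: g_ker; rewrite phi_iG rmorphB /= e subrr rmorph0.
by rewrite !rmorphB /= => /(congr1 fst) /=; rewrite v0 subr0.
Qed.

Lemma base_point_real : real_points base_point.
Proof.
apply: real_pointI.
- split=> [|a b|a b].
  + by rewrite -(rmorph0 phiA); apply/base_pointE; rewrite !rmorph0.
  + have [u <-] := phiA_surj a; have [v <-] := phiA_surj b.
    by move=> /base_pointE u0 /base_pointE v0; rewrite -rmorphD; apply/base_pointE;
      rewrite !rmorphD /= u0 v0 addr0.
  + have [u <-] := phiA_surj a; have [v <-] := phiA_surj b.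
    move=> /base_pointE v0; rewrite -rmorphM; apply/base_pointE.
    by rewrite !rmorphM /= v0 !g_real !mulr0 subr0.
- rewrite -(rmorph1 phiA) => /base_pointE; rewrite !rmorph1 /= => /eqP.
  by rewrite oner_eq0.
- move=> a; have [u <-] := phiA_surj a; exists (g (iG u)).1.
  by rewrite -phiA_scalar -rmorphB; apply/base_pointE; rewrite !rmorphB /= g_scalar /= subrr.
Qed.

Lemma complex_map_kernel_point : complex_map piZ kernel_point = real_to_complex base_point.
Proof.
have E u v : cxfold g (iG u, iG v) = ((g (iG u)).1, (g (iG v)).1).
  by apply: cxfold_real => /=; rewrite [LHS]surjective_pairing g_real.
apply/seteqP; split=> -[a b]; have [u <-] := phiA_surj a; have [v <-] := phiA_surj b.
  rewrite /complex_map /= -!phi_iG => /(kernel_pointE (iG u, iG v)).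
  by rewrite E => -[u0 v0]; split; apply/base_pointE.
move=> [/base_pointE u0 /base_pointE v0]; rewrite /complex_map /= -!phi_iG.
by apply/(kernel_pointE (iG u, iG v)); rewrite E u0 v0.
Qed.

End OnePoint.

(** The points of Z(C) given by [g1] and [g2] have the same real image in X, so
    bijectivity makes them equal. A morphism is recovered from its kernel, as it
    takes the value r + i s at [u] when the kernel contains u - (r + i s). *)
Lemma real_fibre_unique (g1 g2 : {rmorphism G -> complexification R}) :
  (forall u, phi u = 0 -> g1 u = 0) -> (forall u, phi u = 0 -> g2 u = 0) ->
  (forall c, g1 (iG (iR c)) = (c, 0)) -> (forall c, g2 (iG (iR c)) = (c, 0)) ->
  (forall u, (g1 (iG u)).2 = 0) -> (forall u, (g2 (iG u)).2 = 0) ->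
  (forall u, (g1 (iG u)).1 = (g2 (iG u)).1) -> g1 =1 g2.
Proof.
move=> k1 k2 s1 s2 r1 r2 e12.
have eb : base_point g1 = base_point g2.
  by apply/seteqP; split=> a [u -> u0]; exists u; rewrite // -?u0 ?e12.
have ep : kernel_point g1 = kernel_point g2.
  have [_ inj _] := bij.
  have in_dom (g : {rmorphism G -> complexification R}) :
    (forall u, phi u = 0 -> g u = 0) -> (forall c, g (iG (iR c)) = (c, 0)) ->
    (forall u, (g (iG u)).2 = 0) ->
    kernel_point g \in @complex_points R Z `&` complex_map piZ @^-1` @real_points_in_complex R X.
    move=> kg sg rg; apply/mem_set; split; first exact: kernel_point_maximal.
    by exists (base_point g); rewrite ?complex_map_kernel_point//; exact: base_point_real.
  by apply: inj; rewrite ?in_dom// !complex_map_kernel_point// eb.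
move=> u; case E : (g1 u) => [r s].
pose w : complexification G := (u - iG (iR r), - iG (iR s)).
have F (g : {rmorphism G -> complexification R}) : (forall c, g (iG (iR c)) = (c, 0)) ->
    cxfold g w = g u - (r, s).
  by move=> sg; rewrite /cxfold /w /= rmorphB rmorphN /= !sg; congr (_, _) => /=; ring.
have : kernel_point g1 (cxmap phi w) by apply/(kernel_pointE k1); rewrite F// E subrr.
by rewrite ep => /(kernel_pointE k2); rewrite F// => /eqP; rewrite subr_eq0 => /eqP.
Qed.

Variable W : rcfType.
Hypothesis noethG : noetherian G.
Hypothesis symG : has_symbolic_points W (iG \o iR).
Variable us : seq H.
Hypothesis usP : forall Q : set H, (forall c, Q (iR c)) -> (forall u, u \in us -> Q u) ->
    (forall u v, Q u -> Q v -> Q (u + v)) -> (forall u v, Q u -> Q v -> Q (u * v)) ->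
    forall u, Q u.

(** Transfer of [real_fibre_unique] to a real closed extension [W] of R. Two
    distinct points of Z over W[i] above the same point of X(W) are made
    symbolic; being points of Z, being equal and real on X, and being distinct
    amount to finitely many conditions on the symbols, which then hold for some
    values of the symbols in R. *)
Lemma rcf_fibre_unique (x : {rmorphism H -> W}) (h1 h2 : {rmorphism G -> W[i]%C}) :
  (forall u, phi u = 0 -> h1 u = 0) -> (forall u, phi u = 0 -> h2 u = 0) ->
  (forall u, h1 (iG u) = (x u)%:C%C) -> (forall u, h2 (iG u) = (x u)%:C%C) ->
  h1 =1 h2.
Proof.
move=> k1 k2 x1 x2 u0; apply: contrapT => /eqP ne.
have [|A1 [i1 [e1 [al1 [Phi1 [t1 ei1 ale1 PhiC1 hE1]]]]]] :=
  @symG R idfun (x \o iR) h1 (@transferable_base R W).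
  by move=> c; exact: x1.
have [|A2 [i2 [e2 [al2 [P2 [t2 ei2 ale2 PC2 hE2]]]]]] := @symG A1 i1 al1 h2 t1.
  by move=> c; rewrite -ei1 ale1; exact: x2.
pose P1 : {rmorphism G -> complexification A2} := cxmap e2 \o Phi1.
have {}hE1 u : h1 u = cxeval al2 (P1 u) by rewrite hE1 /cxeval /P1 /= !ale2.
have PC1 c : P1 (iG (iR c)) = (i2 c, 0).
  by rewrite /P1 /= (PhiC1 c) /cxmap /= ei2 rmorph0.
clearbody P1.
have [js jsk jsP] := @noethG [set u | phi u = 0] (ltac:(split=> [|u v /= u0' v0|u v /= v0];
  [exact: rmorph0|by rewrite rmorphD u0' v0 addr0|by rewrite rmorphM v0 mulr0])).
(* the conditions to be transferred: the equations of Z for both points,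
   reality and equality of their images in X, and their difference *)
pose Fj g := [:: (P1 g).1; (P1 g).2; (P2 g).1; (P2 g).2].
pose Fu u := [:: (P1 (iG u)).2; (P2 (iG u)).2; (P1 (iG u)).1 - (P2 (iG u)).1].
pose D := [:: (P1 u0).1 - (P2 u0).1; (P1 u0).2 - (P2 u0).2].
pose cs := flatten (map Fj js) ++ flatten (map Fu us) ++ D.
have [be beC ss] := t2 al2 cs.
have transf c : c \in cs -> al2 c = 0 -> be c = 0.
  by move=> cc c0; apply/eqP; rewrite (same_signs_eq0 ss cc) c0.
have transj g c : g \in js -> c \in Fj g -> al2 c = 0 -> be c = 0.
  move=> gj cg; apply: transf; rewrite mem_cat; apply/orP; left.
  by apply/flattenP; exists (Fj g) => //; exact: map_f.
have transu u c : u \in us -> c \in Fu u -> al2 c = 0 -> be c = 0.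
  move=> uu cu; apply: transf; rewrite !mem_cat; apply/orP; right; apply/orP; left.
  by apply/flattenP; exists (Fu u) => //; exact: map_f.
have cx0 (h : {rmorphism G -> W[i]%C}) (P : {rmorphism G -> complexification A2}) u w :
    (forall u, h u = cxeval al2 (P u)) -> h u = (w%:C)%C -> al2 (P u).1 = w /\ al2 (P u).2 = 0.
  by move=> hE; rewrite hE /cxeval => -[].
pose g1 : {rmorphism G -> complexification R} := cxmap be \o P1.
pose g2 : {rmorphism G -> complexification R} := cxmap be \o P2.
have kill (h : {rmorphism G -> W[i]%C}) (P : {rmorphism G -> complexification A2}) :
    (forall u, h u = cxeval al2 (P u)) -> (forall u, phi u = 0 -> h u = 0) ->
    (forall g, g \in js -> (P g).1 \in Fj g /\ (P g).2 \in Fj g) ->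
    forall u, phi u = 0 -> cxmap be (P u) = 0.
  move=> hE kh PF u pu; apply: (jsP [set u | cxmap be (P u) = 0]) pu.
    split=> [|v w /= v0 w0|v w /= w0]; first by rewrite /= rmorph0 rmorph0.
      by rewrite !rmorphD /= v0 w0 addr0.
    by rewrite !rmorphM /= w0 mulr0.
  move=> g gj /=; have [f1 f2] := PF _ gj.
  have [a1 a2] := cx0 h P g 0 hE (kh _ (jsk _ gj)).
  by rewrite /cxmap (transj g) ?(transj g (P g).2).
have base : forall u, [/\ (g1 (iG u)).2 = 0, (g2 (iG u)).2 = 0 & (g1 (iG u)).1 = (g2 (iG u)).1].
  apply: usP => [c|u uu|u v [a b c] [a' b' c']|u v [a b c] [a' b' c']].
  - by rewrite /= PC1 PC2 /= rmorph0.
  - have [a1 a2] := cx0 h1 P1 _ _ hE1 (x1 u); have [b1 b2] := cx0 h2 P2 _ _ hE2 (x2 u).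
    rewrite /= (transu u (P1 _).2)// ?(transu u (P2 _).2)// ?inE ?eqxx ?orbT//.
    split=> //; apply/eqP; rewrite -subr_eq0 -rmorphB; apply/eqP.
    by apply: (transu u) => //; rewrite ?inE ?eqxx ?orbT// rmorphB /= a1 b1 subrr.
  - move: a b c a' b' c' => /= a b c a' b' c'.
    by rewrite !rmorphD /= a a' b b' c c' !addr0.
  - move: a b c a' b' c' => /= a b c a' b' c'.
    rewrite !rmorphM /= !rmorphB !rmorphD !rmorphM /= a b a' b' c c' !mulr0 !mul0r.
    by split; rewrite ?addr0.
have g12 : g1 =1 g2.
  apply: real_fibre_unique => //.
  - by apply: kill hE1 k1 _ => g gj; rewrite !inE !eqxx ?orbT.
  - by apply: kill hE2 k2 _ => g gj; rewrite !inE !eqxx ?orbT.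
  - by move=> c; rewrite /= PC1 /cxmap /= beC rmorph0.
  - by move=> c; rewrite /= PC2 /cxmap /= beC rmorph0.
  - by move=> u; have [] := base u.
  - by move=> u; have [] := base u.
  - by move=> u; have [] := base u.
case/eqP: ne; rewrite hE1 hE2 /cxeval.
have back c : c \in D -> be c = 0 -> al2 c = 0.
  move=> cD c0; apply/eqP; rewrite -(same_signs_eq0 ss) ?c0//.
  by rewrite !mem_cat cD !orbT.
have := g12 u0; rewrite /= /cxmap => -[e1' e2'].
congr (_ +i* _)%C; apply/eqP; rewrite -subr_eq0 -rmorphB; apply/eqP; apply: back.
- by rewrite mem_head.
- by rewrite rmorphB /= e1' subrr.
- by rewrite !inE eqxx orbT.
- by rewrite rmorphB /= e2' subrr.
Qed.
End RealFibre.

(** * Finite extensions *)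

Lemma ipoly_presentation (A : comNzRingType) (B : comPzRingType) (f : {rmorphism A -> B}) (s : seq B) :
  exists phi : {rmorphism ipoly A (size s) -> B},
    (forall a, phi (ipolyC A (size s) a) = f a) /\ forall b, b \in s -> exists u, phi u = b.
Proof.
elim: s => [|b s [phi [phiC phis]]] /=; first by exists f.
have [psi [psiC psiX]] := poly_hom phi b; exists psi; split=> [a|c] /=.
  by rewrite psiC phiC.
rewrite inE => /orP[/eqP->|/phis[u <-]]; first by exists 'X.
by exists u%:P; rewrite psiC.
Qed.

Lemma affine_presentation (R : realType) (X : affScheme R) : real_affine_variety X ->
  exists n (phi : {rmorphism ipoly R n -> X}),
    (forall c, phi (ipolyC R n c) = scalar X c) /\ forall a, exists u, phi u = a.
Proof.
move=> [n [psi [psiC psiS _]]].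
pose s := [seq psi (mpoly.mpolyX R (mpoly.mnm1 i)) | i <- enum 'I_n].
have [phi [phiC phis]] := ipoly_presentation (scalar X) s.
exists (size s), phi; split=> // a; have [P <-] := psiS a.
have gen i : exists u, phi u = psi (mpoly.mpolyX R (mpoly.mnm1 i)).
  by apply: phis; apply: (map_f (fun i => psi (mpoly.mpolyX R (mpoly.mnm1 i)))); rewrite mem_enum.
rewrite (mpoly.mpolyE P) raddf_sum.
elim/big_ind: _ => [|x y [u <-] [v <-]|m _].
- by exists 0; rewrite rmorph0.
- by exists (u + v); rewrite rmorphD.
rewrite -mpoly.mul_mpolyC /= (rmorphM psi) psiC -phiC mpoly.mpolyXE_id (rmorph_prod psi) /=.
have [u <-] : exists u, phi u = \prod_(i < n) psi (mpoly.mpolyX R (mpoly.mnm1 i) ^+ (mpoly.fun_of_multinom m i)).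
  elim/big_ind: _ => [|x y [u <-] [v <-]|i _].
  - by exists 1; rewrite rmorph1.
  - by exists (u * v); rewrite rmorphM.
  - by have [u e] := gen i; exists (u ^+ mpoly.fun_of_multinom m i); rewrite !rmorphXn /= e.
by exists (ipolyC R (size s) (mpoly.mcoeff m P) * u); rewrite rmorphM.
Qed.

Definition integral (A B : comPzRingType) (f : A -> B) (b : B) :=
  exists d (a : nat -> A), b ^+ d + \sum_(i < d) f (a i) * b ^+ i = 0.

Definition module_finite (A B : comPzRingType) (f : A -> B) :=
  exists s : seq B, forall b, exists a : 'I_(size s) -> A, b = \sum_(i < size s) f (a i) * s`_i.

(** The determinant trick: multiplication by [b] on the generators is given by a
    matrix over [A], and the characteristic polynomial of that matrix vanishes
    at [b] because its value kills the generators, hence 1. *)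
Lemma module_finite_integral_nz (A B : comNzRingType) (f : {rmorphism A -> B}) :
  module_finite f -> forall b, integral f b.
Proof.
move=> [s sP] b; pose n := size s.
have [m mP] := choice (fun i : 'I_n => sP (b * s`_i)).
pose M : 'M[A]_n := \matrix_(i, j) m i j.
pose v : 'cV[B]_n := \col_i s`_i.
have cm : commr_rmorph f b by move=> x; apply: mulrC.
pose N : 'M[B]_n := map_mx (horner_morph cm) (char_poly_mx M).
have NE : N = b%:M - map_mx f M.
  apply/matrixP => i j; rewrite !mxE rmorphB /= horner_morphC rmorphMn /= horner_morphX.
  by [].
have Nv : N *m v = 0.
  rewrite NE mulmxBl mul_scalar_mx; apply/eqP; rewrite subr_eq0; apply/eqP/matrixP => i j.
  by rewrite !mxE mP; apply: eq_bigr => k _; rewrite !mxE.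
have dv i : \det N * s`_(i : 'I_n) = 0.
  have : \adj N *m (N *m v) = 0 by rewrite Nv mulmx0.
  rewrite mulmxA mul_adj_mx mul_scalar_mx => /matrixP/(_ i ord0).
  by rewrite !mxE.
have d0 : \det N = 0.
  have [u uP] := sP 1; rewrite -[LHS]mulr1 uP mulr_sumr big1// => i _.
  by rewrite mulrCA dv mulr0.
have : (map_poly f (char_poly M)).[b] = 0 by rewrite -[RHS]d0 det_map_mx.
rewrite (@horner_coef_wide _ n.+1); last by rewrite (leq_trans (size_poly _ _))// size_char_poly.
rewrite big_ord_recr /= coef_map /= -(_ : lead_coef (char_poly M) = (char_poly M)`_n).
  rewrite (eqP (char_poly_monic M)) rmorph1 mul1r addrC => e.
  exists n, (fun i => (char_poly M)`_i); rewrite -[RHS]e; congr (_ + _).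
  by apply: eq_bigr => i _; rewrite coef_map.
by rewrite lead_coefE size_char_poly.
Qed.

Lemma module_finite_integral (A B : comPzRingType) (f : {rmorphism A -> B}) :
  module_finite f -> forall b, integral f b.
Proof.
move=> fin b; have [e|/nontrivial_ring[B' eB]] := eqVneq (1 : B) 0.
  by exists 0%N, (fun=> 0); rewrite big_ord0 addr0 expr0.
move: f fin b; rewrite -{}eB => f fin b.
have /nontrivial_ring[A' eA] : (1 : A) != 0.
  by apply/eqP => e; have := rmorph1 f; rewrite e rmorph0 => /esym/eqP; rewrite oner_eq0.
by move: f fin; rewrite -{}eA => f fin; exact: (@module_finite_integral_nz A' B' f fin).
Qed.

(** * Rationality of the fibres over real primes *)

Lemma preimage_ideal (A B : comPzRingType) (f : {rmorphism A -> B}) (Q : set B) :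
  ideal Q -> ideal (f @^-1` Q).
Proof.
move=> iQ; split=> [|x y /= Qx Qy|a x /= Qx]; rewrite /preimage /= ?rmorph0 ?rmorphD ?rmorphM.
- exact: ideal0.
- exact: idealD.
- exact: idealMl.
Qed.

Lemma preimage_prime (A B : comPzRingType) (f : {rmorphism A -> B}) (Q : set B) :
  prime_ideal Q -> prime_ideal (f @^-1` Q).
Proof.
move=> [iQ n1 pQ]; split; first exact: preimage_ideal.
  by rewrite /preimage /= rmorph1.
by move=> x y; rewrite /preimage /= rmorphM => /pQ.
Qed.

(** Embed the quotient by [P] in an algebraically closed field, then take a
    maximal real subring containing its image. *)
Lemma real_prime_point (K : rcfType) n (P : set (ipoly K n)) : prime_ideal P ->
  (forall s : seq (ipoly K n), P (\sum_(a <- s) a ^+ 2) -> forall a, a \in s -> P a) ->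
  exists (W : rcfType) (x : {rmorphism ipoly K n -> W}), forall u, x u = 0 <-> P u.
Proof.
move=> pP rP; have [L [h hP]] := closed_point pP.
have [s e a as_|W [x xP]] := @real_closed_point L _ h; last first.
  by exists W, x => u; split=> [/xP/hP|/hP/xP].
by apply/hP; apply: rP as_; apply/hP.
Qed.

(** A polynomial of degree at least 2 with a single root has a multiple root. *)
Lemma simple_root_deriv (L : closedFieldType) (g : {poly L}) t : (2 < size g)%N ->
  (forall r, g.[r] = 0 -> r = t) -> g^`().[t] = 0.
Proof.
move=> sg rt; have [rs gE] := closed_field_poly_normal g.
have g0 : lead_coef g != 0 by rewrite lead_coef_eq0 -size_poly_gt0 (ltn_trans _ sg).
have rst r : r \in rs -> r = t.
  move=> rrs; apply: rt; apply/eqP; rewrite -/(root g r) gE rootZ//.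
  by rewrite root_prod_XsubC.
move: sg; rewrite gE size_scale// size_prod_XsubC; case: rs rst {gE} => [|r0 [|r1 rs]]// rst _.
rewrite !big_cons (rst r0) ?mem_head// (rst r1) ?inE ?eqxx ?orbT//.
by rewrite derivZ !derivM !derivXsubC !hornerE !subrr !(mul0r, mulr0, add0r, addr0).
Qed.

Definition lies_over (A B : comPzRingType) (f : A -> B) (p : set A) (Q : set B) :=
  forall a, Q (f a) <-> p a.

(** The fraction a/s of the residue field of [p] is the value of [b] at all the
    points of the fibre. *)
Definition fibrewise_rational (A B : comPzRingType) (f : A -> B) (p : set A) (b : B) :=
  exists a s, ~ p s /\
    forall Q, prime_ideal Q -> lies_over f p Q -> Q (f s * b - f a).

Section Fibre.
Variables (R : realType) (X Z : affScheme R) (piZ : morphism Z X).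
Hypothesis bij : bijective_over_real piZ.
Hypothesis hX : real_affine_variety X.
Hypothesis fin : finite_morphism piZ.

(** All the primes over [p] are kernels of morphisms to W[i] extending a point
    [x] of X(W) with kernel [p], and there is only one such morphism by
    [rcf_fibre_unique]. In particular a minimal polynomial [f] of [c] over the
    residue field has a single root in W[i], since each root extends to a
    morphism. As [f] is separable in characteristic 0, it has degree 1, and its
    two coefficients give the fraction. *)
Lemma rational_fibre (p : realSpec X) (c : Z) : fibrewise_rational piZ p c.
Proof.
have int := module_finite_integral fin.
have [n [phiA [phiAC phiAS]]] := affine_presentation hX.
have [W [x xP]] : exists (W : rcfType) (x : {rmorphism ipoly R n -> W}), forall u, x u = 0 <-> real_prime p (phiA u).
  apply: (@real_prime_point R n (phiA @^-1` real_prime p)).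
    by apply: preimage_prime; exact: real_primeP.
  move=> s ps a as_; have [_ rp] := real_primeR p; apply: (rp (map phiA s)); last exact: map_f.
  rewrite big_map; move: ps; rewrite /preimage /= rmorph_sum.
  by congr (real_prime p _); apply: eq_bigr => i _; rewrite rmorphXn.
pose xC : {rmorphism ipoly R n -> W[i]%C} := real_complex W \o x.
have xCP u : xC u = 0 <-> real_prime p (phiA u).
  by split=> [/eqP|/xP /= ->]; [rewrite fmorph_eq0 => /eqP/xP|rewrite rmorph0].
pose H1 : comNzRingType := {poly ipoly R n}.
have [phi1 [phi1C phi1X]] := @poly_hom (ipoly R n) Z (piZ \o phiA) c.
have [s sgen] := fin.
have [phi [phiC phis]] := @ipoly_presentation H1 Z phi1 s.
pose G := ipoly H1 (size s).
pose iG : {rmorphism ipoly R n -> G} := ipolyC H1 (size s) \o @polyC (ipoly R n).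
have phi_iG u : phi (iG u) = piZ (phiA u) by rewrite /iG /= phiC phi1C.
have phiS b : exists u, phi u = b.
  have [a ->] := sgen b; elim/big_ind: _ => [|y z [u <-] [v <-]|i _].
  - by exists 0; rewrite rmorph0.
  - by exists (u + v); rewrite rmorphD.
  - have [u <-] := phis _ (mem_nth 0 (ltn_ord i)); have [v <-] := phiAS (a i).
    by exists (iG v * u); rewrite rmorphM phi_iG.
have [us usP] := ipoly_gens R n.
have unique := @rcf_fibre_unique R X Z piZ bij (ipoly R n) G phiA (ipolyC R n) iG phi
  phiAC phiAS phiS phi_iG W (@noetherian_ipoly R (size s) n.+1)
  (@symbolic_points_ipoly R W H1 _ (size s) (@symbolic_points_ipoly R W R idfun n.+1 (@symbolic_points_base R W)))
  us usP x.
have intG b : exists d (a : nat -> ipoly R n), b ^+ d + \sum_(i < d) piZ (phiA (a i)) * b ^+ i = 0.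
  have [d [a e]] := int b; have [u uP] := choice (fun i => phiAS (a i)).
  by exists d, u; rewrite -[RHS]e; congr (_ + _); apply: eq_bigr => i _; rewrite uP.
pose above q := prime_ideal q /\ lies_over piZ p q.
pose P1 (q : set Z) : set {poly ipoly R n} := phi1 @^-1` q.
have contractionP1 q : above q -> forall a, xC a = 0 <-> contraction (P1 q) a.
  by move=> [_ qp] a; rewrite /contraction /P1 /preimage /= phi1C /= qp; exact: xCP.
have minP1 q : above q -> exists f, minimal_in (P1 q) f.
  move=> aq; have [pq qp] := aq; have [iq n1 _] := pq; have [d [a e]] := intG c.
  pose g : {poly ipoly R n} := 'X^d + \sum_(i < d) (a i)%:P * 'X^i.
  apply: (@exists_minimal_in _ (P1 q) g); first exact: preimage_ideal.
    rewrite /P1 /preimage /= rmorphD rmorphXn rmorph_sum /= phi1X.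
    rewrite (_ : _ + _ = 0); first exact: ideal0.
    by rewrite -[RHS]e; congr (_ + _); apply: eq_bigr => i _; rewrite rmorphM rmorphXn /= phi1C phi1X.
  move=> /(_ d); rewrite /g coefD coefXn eqxx coef_sum big1 ?addr0.
    by rewrite /contraction /P1 /preimage /= rmorph1.
  by move=> i _ /=; rewrite coefCM coefXn gtn_eqF// mulr0.
have homs q f t : above q -> minimal_in (P1 q) f -> (map_poly xC f).[t] = 0 ->
    exists h : {rmorphism G -> W[i]%C}, [/\ forall u, h (iG u) = (x u)%:C%C,
      h (ipolyC H1 (size s) 'X) = t & forall u, h u = 0 <-> q (phi u)].
  move=> aq mf ft; have [pq qp] := aq.
  have [be [beC beE]] := poly_eval_hom xC t.
  have rk := @root_kernel _ _ xC (P1 q) (contractionP1 _ aq) f t (preimage_prime phi1 pq) mf ft.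
  have [|a|u|h [hC hk]] := @tower_point H1 W[i]%C be (size s) (phi @^-1` q).
  - exact: preimage_prime.
  - by rewrite beE /preimage /= phiC; exact: rk.
  - have [d [a e]] := intG (phi u); exists d, (fun i => (a i)%:P).
    rewrite /preimage /= rmorphD rmorphXn rmorph_sum /=.
    rewrite (_ : _ + _ = 0); first by have [iq _ _] := pq; exact: ideal0.
    rewrite -[RHS]e; congr (_ + _); apply: eq_bigr => i _.
    by rewrite rmorphM rmorphXn /= -phi_iG.
  exists h; split=> [u||//]; first by rewrite /iG /= hC beC.
  by rewrite hC beE map_polyX hornerX.
have homs_eq q q' f f' t t' : above q -> above q' -> minimal_in (P1 q) f -> minimal_in (P1 q') f' ->
    (map_poly xC f).[t] = 0 -> (map_poly xC f').[t'] = 0 -> t = t' /\ forall b, q b <-> q' b.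
  move=> aq aq' mf mf' ft ft'.
  have [h [hx ht hk]] := homs q f t aq mf ft; have [h' [hx' ht' hk']] := homs q' f' t' aq' mf' ft'.
  have hh : h =1 h'.
    apply: unique => // u u0.
      by apply/hk; rewrite u0; have [[iq _ _] _] := aq; exact: ideal0.
    by apply/hk'; rewrite u0; have [[iq _ _] _] := aq'; exact: ideal0.
  split; first by rewrite -ht -ht' hh.
  by move=> b; have [u <-] := phiS b; rewrite -hk -hk' hh.
have [[q0 aq0]|N] := pselect (exists q, above q); last first.
  exists 0, 1; split; first by have [] := real_primeP p.
  by move=> q pq qp; case: N; exists q.
have [f mf] := minP1 _ aq0.
have iP1 : ideal (P1 q0) by apply: preimage_ideal; have [[]] := aq0.
have [t ft] := minimal_root iP1 (contractionP1 _ aq0) mf.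
have [P1f nlf small] := mf.
have lf0 : xC (lead_coef f) != 0 by apply/eqP => /(contractionP1 _ aq0).
have sf : (size f <= 2)%N.
  rewrite leqNgt; apply/negP => sf2.
  have sfx : size (map_poly xC f) = size f by apply: size_poly_eq.
  (* a single root would be multiple, hence a root of the derivative,
     contradicting the minimality of [f] *)
  have d0 : (map_poly xC f^`()).[t] = 0.
    rewrite -deriv_map; apply: simple_root_deriv; first by rewrite sfx.
    by move=> r fr; have [] := homs_eq q0 q0 f f r t aq0 aq0 mf mf fr ft.
  have P1d : P1 q0 f^`().
    exact/(root_kernel (contractionP1 _ aq0) (preimage_prime phi1 aq0.1) mf ft).
  have f0 : f != 0 by rewrite -size_poly_gt0 (ltn_trans _ sf2).
  have /(_ (size f).-2) := small _ P1d (lt_size_deriv f0).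
  move=> /(contractionP1 _ aq0); rewrite coef_deriv.
  have -> : (size f).-2.+1 = (size f).-1 by case: (size f) sf2 => [|[|k]].
  rewrite rmorphMn => /eqP; rewrite mulrn_eq0 -lead_coefE (negPf lf0) orbF.
  by case: (size f) sf2 => [|[|k]].
have sf' : size f = 2%N by apply/eqP; rewrite eqn_leq sf (minimal_size iP1 mf).
(* [f] is [f`_1 * 'X + f`_0] *)
exists (phiA (- f`_0)), (phiA f`_1); split.
  by move=> /xCP/eqP; have -> : 1%N = (size f).-1; [rewrite sf'|rewrite -lead_coefE (negPf lf0)].
move=> q pq qp; have aq : above q by [].
have [f' mf'] := minP1 _ aq.
have iP1' : ideal (P1 q) by apply: preimage_ideal; have [] := pq.
have [t' ft'] := minimal_root iP1' (contractionP1 _ aq) mf'.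
have [_ ->] := homs_eq q q0 f' f t' t aq aq0 mf' mf ft' ft.
move: P1f; rewrite /P1 /preimage /= -{1}(coefK f) poly_def sf' !big_ord_recl big_ord0 addr0 /=.
rewrite expr0 expr1 -!mul_polyC mulr1 rmorphD rmorphM /= !phi1C phi1X /= addrC.
by rewrite rmorphN /= rmorphN opprK.
Qed.

End Fibre.

(** * Primes of an integral extension and of its localizations *)

Lemma maximal_unit (A : comPzRingType) (M : set A) x : maximal_ideal M -> ~ M x ->
  exists y, M (1 - y * x).
Proof.
move=> [iM nM1 max] nx; have [J1|nJ1] := pselect (adjoin M x 1).
  by have [m [y [Mm e]]] := J1; exists y; rewrite e addrK.
case: nx; rewrite -(max _ (adjoin_ideal x iM) nJ1 (@sub_adjoin _ _ _)).
exact: mem_adjoin.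
Qed.

Lemma maximal_prime (A : comPzRingType) (M : set A) : maximal_ideal M -> prime_ideal M.
Proof.
move=> mM; have [iM nM1 _] := mM; split=> // x y Mxy.
apply: contrapT => /not_orP[/(maximal_unit mM)[z Mz] ny]; apply: ny.
have -> : y = y * (1 - z * x) + z * (x * y) by ring.
by apply: idealD => //; exact: idealMl.
Qed.

Lemma ideal_subX (A : comPzRingType) (I : set A) x y n : ideal I -> I (x - y) -> I (x ^+ n - y ^+ n).
Proof. by move=> iI Ixy; rewrite subrXX; exact: idealMr. Qed.

Section Integral.
Variables (A B : comPzRingType) (f : {rmorphism A -> B}).
Hypothesis int : forall b, integral f b.
Variable p : set A.
Hypothesis pp : prime_ideal p.

Local Notation over := (lies_over f p).

(** Multiply an integral equation of [b] of degree d by f(a)^d, and replace b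
    f(a) by f(t): modulo [Q] this gives an element of [A] congruent to t^d
    modulo [p], hence outside [p], whose image lies in [Q]. *)
Lemma integral_comaximal (Q : set B) a t b : ideal Q -> (forall s, ~ p s -> ~ Q (f s)) ->
  p a -> ~ p t -> ~ Q (f t - b * f a).
Proof.
move=> iQ disj pa nt Qb; have [ip n1 _] := pp; have [d [c e]] := int b.
pose z := t ^+ d + \sum_(i < d) c i * (t ^+ i * a ^+ (d - i)).
apply: (disj z).
  move=> pz; apply: nt; apply: (prime_idealX (n := d) pp); apply: ideal_cancel pz => //.
  apply: ideal_sum => // i _; apply: idealMl => //; apply: idealMl => //.
  by rewrite -(prednK (n := d - i)) ?subn_gt0// exprS; exact: idealMr.
have E : (b * f a) ^+ d + \sum_(i < d) f (c i) * ((b * f a) ^+ i * f a ^+ (d - i)) = 0.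
  transitivity (f a ^+ d * (b ^+ d + \sum_(i < d) f (c i) * b ^+ i)); last by rewrite e mulr0.
  rewrite mulrDr mulr_sumr; congr (_ + _); first by rewrite exprMn mulrC.
  apply: eq_bigr => i _; rewrite exprMn.
  have -> : f a ^+ d = f a ^+ (d - i) * f a ^+ i by rewrite -exprD subnK// ltnW.
  by ring.
rewrite rmorphD rmorph_sum rmorphXn /= -[X in Q X]subr0 -[X in Q (_ - X)]E.
rewrite opprD addrACA -sumrB; apply: idealD => //; first exact: ideal_subX.
apply: ideal_sum => // i _; rewrite !rmorphM !rmorphXn -mulrBr -mulrBl.
by apply: idealMl => //; apply: idealMr => //; exact: ideal_subX.
Qed.

(** An ideal of [B] maximal among those disjoint from the image of the
    complement of [p] lies over [p], by [integral_comaximal]. *)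
Lemma lying_over : (forall a, f a = 0 -> p a) -> exists2 Q, prime_ideal Q & over Q.
Proof.
move=> ker; have [ip n1 pM] := pp.
have [|||s -> [a na fa]|Q [pQ _ disj max]] := @prime_avoiding B [set 0] (f @` ~` p).
- by split=> [|_ _ -> ->|a _ ->] /=; rewrite ?addr0 ?mulr0.
- by exists 1; rewrite ?rmorph1.
- by move=> _ _ [a na <-] [b nb <-]; exists (a * b); rewrite ?rmorphM// => /pM[].
- exact/na/ker.
have [iQ _ _] := pQ; exists Q => // a; split=> [Qa|pa].
  by apply: contrapT => na; apply: (disj _ Qa); exists a.
apply: contrapT => /max[b [_ [[t nt <-] Qt]]].
by apply: (integral_comaximal iQ _ pa nt Qt) => s ns Qs; apply: (disj _ Qs); exists s.
Qed.

(** In an integral equation of [b], leading coefficient 1 included, the lowest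
    coefficient outside [p] is a multiple of [b] modulo [Q], once a power of [b]
    has been cancelled. *)
Lemma integral_prime_unit Q b : prime_ideal Q -> over Q -> ~ Q b ->
  exists e b', ~ p e /\ Q (f e - b' * b).
Proof.
move=> [iQ n1 pQ] ov nb; have [d [c e]] := int b.
suff : forall e0, ~ p e0 -> Q (f e0 * b ^+ d + \sum_(i < d) f (c i) * b ^+ i) ->
    exists e b', ~ p e /\ Q (f e - b' * b).
  move=> H; apply: (H 1); first by have [_ n1' _] := pp.
  by rewrite rmorph1 mul1r e; exact: ideal0.
elim: d c {e} => [|d IH] c e0 ne0; first by rewrite big_ord0 addr0 expr0 mulr1 => /ov.
rewrite big_ord_recl expr0 mulr1 exprSr mulrA addrCA.
under eq_bigr do rewrite exprSr mulrA.
rewrite -mulr_suml -mulrDl => Qe; have [pc|nc] := pselect (p (c 0%N)).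
  have : Q ((f e0 * b ^+ d + \sum_(i < d) f (c (lift ord0 i)) * b ^+ i) * b).
    by move: Qe; rewrite addrC; apply: ideal_cancel => //; exact/ov.
  by case/pQ => // /(IH (fun i => c i.+1) _ ne0).
exists (c 0%N), (- (f e0 * b ^+ d + \sum_(i < d) f (c (lift ord0 i)) * b ^+ i)).
by split=> //; rewrite mulNr opprK.
Qed.

End Integral.

Section RplusPrimes.
Variables (A B : comPzRingType) (f : {rmorphism A -> B}).
Hypothesis int : forall b, integral f b.
Variable p : realSpec A.
Let pp : prime_ideal p := real_primeP p.

Let denP (t : prime_compl f p) : exists2 s, ~ real_prime p s & den t = f s.
Proof. by case: t => t /= /set_mem[s ns <-]; exists s. Qed.

Let compl s : ~ real_prime p s -> exists t : prime_compl f p, den t = f s.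
Proof.
move=> ns; have St : mulset (prime_compl f p) (f s) by exists s.
by exists (mulset_elt St).
Qed.

Section MaxOfPrime.
Variable Q : set B.
Hypothesis pQ : prime_ideal Q.
Hypothesis ovQ : lies_over f p Q.

Definition extended_prime : set (loc_prime f p) := [set z | exists b t, z = frac b t /\ Q b].

Let compl_notin u : mulset (prime_compl f p) u -> ~ Q u.
Proof. by case=> s ns <- /ovQ. Qed.

Lemma extended_primeE b t : extended_prime (frac b t) <-> Q b.
Proof.
split=> [[b' [t' [/fracP[u Su e] Qb']]]|Qb]; last by exists b, t.
have [iQ _ pQM] := pQ; have [s ns ts] := denP t'.
have : Q (u * (b * den t')).
  have -> : u * (b * den t') = u * (b * den t' - b' * den t) + u * (b' * den t) by ring.
  by rewrite e add0r; apply: idealMl => //; exact: idealMr.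
by case/pQM => [/(compl_notin Su)//|/pQM[//|]]; rewrite ts => /ovQ.
Qed.

(** By [integral_prime_unit], an element outside the extension of [Q] is
    invertible modulo it. *)
Lemma extended_prime_maximal : maximal_ideal extended_prime.
Proof.
have [iQ n1 pQM] := pQ.
have iE : ideal extended_prime.
  split=> [|_ _ [b [t [-> Qb]]] [c [u [-> Qc]]]|y _ [b [t [-> Qb]]]].
  - by exists 0, (sone _); split=> //; exact: ideal0.
  - by rewrite fracD; apply/extended_primeE; apply: idealD => //; exact: idealMr.
  - by elim/loc_ind: y => c u; rewrite fracM; apply/extended_primeE; exact: idealMl.
split=> // [/extended_primeE//|J iJ nJ1 EJ]; apply/seteqP; split=> // x.
elim/loc_ind: x => b t Jb; apply/extended_primeE; apply: contrapT => nb; apply: nJ1.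
have [e [b' [ne Qe]]] := integral_prime_unit int pp pQ ovQ nb.
have [u ue] := compl ne.
have -> : 1 = frac (f e - b' * b) u + frac (b' * den t) u * frac b t :> loc_prime f p.
  rewrite fracM fracD; apply/fracP; exists 1; first exact: mulset1.
  by rewrite !den_smul den_sone ue; ring.
apply: idealD => //; last exact: idealMl.
by apply: EJ; apply/extended_primeE.
Qed.
End MaxOfPrime.

(** The primes of [B] over [p] extend to maximal ideals of the localization,
    which contain its Jacobson radical. *)
Lemma Rplus_rational b : Rplus f b -> fibrewise_rational f p b.
Proof.
move=> /(_ p)[_ [a [t ->]] [r rJ e]]; have [s ns ts] := denP t.
exists a, s; split=> // Q pQ ovQ.
have := rJ _ (extended_prime_maximal pQ ovQ).
have -> : r = frac (b * den t - f a) t.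
  have -> : r = loc_in (prime_compl f p) b - frac (f a) t by rewrite e addrC addKr.
  rewrite fracN fracD; apply/fracP; exists 1; first exact: mulset1.
  by rewrite !den_smul !den_sone; ring.
by move=> /(extended_primeE pQ ovQ); rewrite ts mulrC.
Qed.

(** The image of the complement of [p] is invertible in the localization, and
    the image of [p] lies in every maximal ideal by [integral_comaximal]. *)
Lemma contracted_maximal_over (M : set (loc_prime f p)) : maximal_ideal M ->
  prime_ideal (loc_in (prime_compl f p) @^-1` M) /\ lies_over f p (loc_in (prime_compl f p) @^-1` M).
Proof.
move=> mM; have pM := maximal_prime mM; have [iM nM1 _] := pM.
have pQ := preimage_prime (loc_in (prime_compl f p)) pM; split=> //.
have [iQ nQ1 _] := pQ.
have nQ s : ~ real_prime p s -> ~ M (loc_in (prime_compl f p) (f s)).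
  move=> ns Ms; apply: nM1; have [t te] := compl ns.
  have -> : 1 = frac 1 t * loc_in (prime_compl f p) (f s).
    by rewrite fracM; apply/fracP; exists 1; [exact: mulset1|rewrite den_smul den_sone te; ring].
  exact: idealMl.
move=> a; split=> [Ma|pa]; first by apply: contrapT => /nQ.
apply: contrapT => /(maximal_unit mM)[y].
elim/loc_ind: y => b t; have [s ns ts] := denP t => My.
apply: (integral_comaximal int pp (Q := loc_in (prime_compl f p) @^-1` M) (t := s) (b := b) iQ nQ pa ns).
have : M (loc_in (prime_compl f p) (f s) * (1 - frac b t * loc_in (prime_compl f p) (f a))).
  exact: idealMl.
congr (M _); rewrite fracM -[1]/(frac 1 (sone _)) fracN fracD fracM; apply/fracP.
by exists 1; [exact: mulset1|rewrite !den_smul !den_sone -ts; ring].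
Qed.

(** Conversely, the maximal ideals of the localization contract to primes over
    [p]. *)
Lemma rational_Rplus_at b : fibrewise_rational f p b ->
  exists2 x : loc_prime f p, loc_base x &
    exists2 r : loc_prime f p, jacobson_radical r & loc_in (prime_compl f p) b = x + r.
Proof.
move=> [a [s [ns h]]]; have [t te] := compl ns.
exists (frac (f a) t); first by exists a, t.
exists (loc_in (prime_compl f p) b - frac (f a) t); last by rewrite addrC subrK.
move=> M mM; have [pQ ovQ] := contracted_maximal_over mM; have [iM _ _] := maximal_prime mM.
have -> : loc_in (prime_compl f p) b - frac (f a) t =
    frac 1 t * loc_in (prime_compl f p) (f s * b - f a).
  rewrite fracN fracD fracM; apply/fracP; exists 1; first exact: mulset1.
  by rewrite !den_smul !den_sone te; ring.
by apply: (idealMl _ iM); exact: (h _ pQ ovQ).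
Qed.

End RplusPrimes.

(** * Real primes of a real ring *)

Section RealPrimeAvoiding.
Variable B : comPzRingType.
Hypothesis rB : forall s : seq B, \sum_(b <- s) b ^+ 2 = 0 -> forall b, b \in s -> b = 0.

Lemma real_reduced (x : B) n : x ^+ n = 0 -> x = 0.
Proof.
elim: n => [|n IH]; first by rewrite expr0 -[x]mulr1 => ->; rewrite mulr0.
case: n IH => [|n] IH; first by rewrite expr1.
move=> xn; apply: IH; apply: (rB (s := [:: x ^+ n.+1])); last exact: mem_head.
rewrite big_seq1 -exprM (_ : (n.+1 * 2)%N = (n.+2 + n)%N); last by lia.
by rewrite exprD xn mul0r.
Qed.

(** The complement of a maximal multiplicative set containing [w] but not 0 is a
    minimal prime. Its elements are killed by elements of the multiplicative
    set, because [B] is reduced, which makes it a real ideal: if [s] kills the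
    sum of the x^2, the sum of the (s x)^2 vanishes, hence [s] kills each x. *)
Lemma real_prime_avoiding (w : B) : w <> 0 ->
  exists q : set B, [/\ prime_ideal q, real_ideal q & ~ q w].
Proof.
move=> w0; pose P (S : set B) := [/\ S 1, forall x y, S x -> S y -> S (x * y) & ~ S 0].
have [||S [[S1 SM S0] wS max]] := @Zorn_above B P [set w ^+ n | n in [set: nat]].
- split; first by exists 0%N.
    by move=> _ _ [m _ <-] [n _ <-]; exists (m + n)%N; rewrite // exprD.
  by move=> [n _ /real_reduced].
- move=> F [X FX] FP tot; split; first by exists X => //; have [] := FP _ FX.
    move=> x y Ux Uy; have [||Y FY h] := @chain_seq _ F [:: x; y] _ tot; first by exists X.
      by move=> z; rewrite !inE => /orP[]/eqP->.
    exists Y => //; have [_ YM _] := FP _ FY.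
    by apply: YM; apply: h; rewrite !inE eqxx ?orbT.
  by move=> [Y FY]; have [] := FP _ FY.
have kill x : ~ S x -> exists2 s, S s & s * x = 0.
  move=> nx; pose S' := [set z | exists s n, S s /\ z = s * x ^+ n].
  have SS' : S `<=` S' by move=> s Ss; exists s, 0%N; rewrite expr0 mulr1.
  have [S'0|nS'0] := pselect (S' 0).
    have [s [n [Ss e]]] := S'0; exists s => //; apply: (@real_reduced _ n).
    case: n e => [|n] e; first by case: S0; rewrite e expr0 mulr1.
    by rewrite exprMn exprSr -mulrA -e mulr0.
  case: nx; apply: (max S') => //; last by exists 1, 1%N; rewrite expr1 mul1r.
  split; [exact: SS'| |by []].
  move=> _ _ [s [n [Ss ->]]] [t [m [St ->]]]; exists (s * t), (n + m)%N.
  by split; [exact: SM|rewrite exprD; ring].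
have notS x s : S s -> s * x = 0 -> ~ S x.
  by move=> Ss sx Sx; apply: S0; rewrite -sx; exact: SM.
have iS : ideal (~` S).
  split=> [|x y /kill[s Ss sx] /kill[t St ty]|a x /kill[s Ss sx]]; first exact: S0.
    apply: (notS _ (s * t)); first exact: SM.
    have -> : s * t * (x + y) = t * (s * x) + s * (t * y) by ring.
    by rewrite sx ty !mulr0 addr0.
  by apply: (notS _ s) => //; rewrite mulrCA sx mulr0.
exists (~` S); split.
- split=> // x y nxy.
  by apply: contrapT => /not_orP[/contrapT Sx /contrapT Sy]; apply: nxy; exact: SM.
- split=> // xs /kill[s Ss e] x xxs; apply: (notS _ s) => //.
  apply: (rB (s := map (fun y => s * y) xs)); last exact: (map_f (fun y => s * y)).
  transitivity (s ^+ 2 * \sum_(a <- xs) a ^+ 2); last by rewrite expr2 -mulrA e mulr0.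
  by rewrite big_map mulr_sumr; apply: eq_bigr => y _; rewrite exprMn.
- by move=> nw; apply: nw; apply: wS; exists 1%N.
Qed.
End RealPrimeAvoiding.

(** * Factorizations through the R-seminormalization *)

Section Bijective.
Variables (R : realType) (Y X : affScheme R) (pi : morphism Y X).

(** Modulo [m], a sum of squares is a sum of squares of real numbers. *)
Lemma real_point_real (m : set X) : real_points m -> real_ideal m.
Proof.
move=> /real_point_residue[im nm1 res]; split=> // s ms a as_.
have [c cP] := choice res.
have : scalar X (\sum_(a <- s) c a ^+ 2) = 
   \sum_(a <- s) a ^+ 2 - \sum_(a <- s) (a ^+ 2 - scalar X (c a) ^+ 2).
  rewrite rmorph_sum -sumrB; apply: eq_bigr => x _; rewrite rmorphXn /= opprB addrC subrK.
  by [].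
move=> e; have m0 : m (scalar X (\sum_(a <- s) c a ^+ 2)).
  rewrite e; apply: idealB => //; apply: ideal_sum => // x _.
  by rewrite subr_sqr; apply: idealMr.
have /eqP := scalar_in_ideal im nm1 m0.
rewrite psumr_eq0; last by move=> x _; exact: sqr_ge0.
move=> /allP/(_ a as_) /=; rewrite sqrf_eq0 => /eqP c0.
by have := cP a; rewrite c0 rmorph0 subr0.
Qed.

(** Rational values determine the membership of [b] in a prime over [p], so that
    there is only one such prime, and it exists by lying over. Over a real point
    these values are real numbers, so this prime is a real point; its
    complexification is maximal, and is contained in every complex point of the
    fibre. *)
Lemma bijective_of_rational : (forall b, integral pi b) ->
  (forall (p : realSpec X) b, fibrewise_rational pi p b) -> bijective_over_real pi.
Proof.
move=> int rat.
have fibre (m : set X) : real_points m -> exists n : set Y, [/\ prime_ideal n,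
    forall a, n (pi a) <-> m a, forall b, exists c, n (b - scalar Y c) &
    forall n', prime_ideal n' -> (forall a, n' (pi a) <-> m a) -> n' = n].
  move=> mR; have [im nm1 res] := real_point_residue mR.
  have pm := maximal_prime mR.1; pose p := RealSpec pm (real_point_real mR).
  have [|n pn ov] := @lying_over _ _ pi int m pm.
    by move=> a a0; rewrite (_ : a = 0); [exact: ideal0|apply: (comorphism_inj (m := pi)); rewrite a0 rmorph0].
  exists n; split=> // [b|n' pn' ov'].
    have [a [s [ns h]]] := rat p b; have [ca na] := res a; have [cs nsc] := res s.
    have cs0 : cs != 0.
      by apply/eqP => cs0; apply: ns; move: nsc; rewrite cs0 rmorph0 subr0.
    exists (ca / cs); have [inn _ _] := pn.
    (* [a] and [s] are congruent to the real numbers [ca] and [cs] *)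
    have -> : b - scalar Y (ca / cs) = scalar Y cs^-1 *
        ((pi s * b - pi a) - pi (s - scalar X cs) * b + pi (a - scalar X ca)).
      rewrite !rmorphB /= !comorphism_scalar rmorphM /=.
      transitivity (scalar Y (cs^-1 * cs) * b - scalar Y cs^-1 * scalar Y ca).
        by rewrite mulVf// rmorph1; ring.
      by rewrite rmorphM /=; ring.
    apply: idealMl => //; apply: idealD => //; last exact/ov.
    by apply: idealB => //; [exact: h|apply: idealMr => //; exact/ov].
  have incl (q q' : set Y) : prime_ideal q -> (forall a, q (pi a) <-> m a) ->
      prime_ideal q' -> (forall a, q' (pi a) <-> m a) -> q `<=` q'.
    move=> pq oq pq' oq' b qb; have [a [s [ns h]]] := rat p b.
    have [iq _ _] := pq; have [iq' _ pM] := pq'.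
    have ma : m a.
      apply/oq; rewrite -[pi a](subKr (pi s * b)); apply: idealB => //; last exact: h.
      exact: idealMl.
    have : q' (pi s * b).
      by rewrite -(subrK (pi a) (pi s * b)); apply: idealD => //; [exact: h|exact/oq'].
    by case/pM => // /oq'.
  by apply/seteqP; split; exact: incl.
have maxC (m : set X) (n : set Y) : prime_ideal n -> (forall b, exists c, n (b - scalar Y c)) ->
    maximal_ideal (real_to_complex n).
  move=> [inn nn1 _] res; split=> [|[]//|J iJ nJ1 nJ].
    split=> [|[a b] [c d] [na nb] [nc nd]|[a b] [c d] [nc nd]].
    - by split; exact: ideal0.
    - by split; exact: idealD.
    - by split; [apply: idealB => //|apply: idealD => //]; exact: idealMl.
  apply/seteqP; split=> // -[b1 b2] Jb; have [c1 n1] := res b1; have [c2 n2] := res b2.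
  pose sc c1 c2 : complexification Y := (scalar Y c1, scalar Y c2).
  have Jc : J (sc c1 c2).
    have -> : sc c1 c2 = ((b1, b2) : complexification Y) -
        ((b1 - scalar Y c1, b2 - scalar Y c2) : complexification Y).
      by congr (_, _) => /=; ring.
    by apply: idealB => //; apply: nJ; split.
  have [d0|d0] := eqVneq (c1 ^+ 2 + c2 ^+ 2) 0.
    move/eqP: d0; rewrite paddr_eq0 ?sqr_ge0// !sqrf_eq0 => /andP[/eqP c10 /eqP c20].
    by move: n1 n2; rewrite c10 c20 !rmorph0 !subr0.
  case: nJ1; have -> : 1 = sc (c1 / (c1 ^+ 2 + c2 ^+ 2)) (- c2 / (c1 ^+ 2 + c2 ^+ 2)) * sc c1 c2.
    rewrite /sc; congr (_, _) => /=; rewrite -!rmorphM -?rmorphB -?rmorphD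
      -?(rmorph1 (scalar Y)) -?(rmorph0 (scalar Y)); congr (scalar Y _); field => //.
  exact: idealMl.
have contr_real (n : set Y) (m : set X) : (forall a, n (pi a) <-> m a) ->
    complex_map pi (real_to_complex n) = real_to_complex m.
  by move=> ov; apply/seteqP; split=> -[a b] [/= na nb]; split; exact/ov.
have point (N : set (complexification Y)) (m : set X) n : complex_points N -> 
    complex_map pi N = real_to_complex m -> prime_ideal n -> (forall b, exists c, n (b - scalar Y c)) ->
    (forall n', prime_ideal n' -> (forall a, n' (pi a) <-> m a) -> n' = n) -> N = real_to_complex n.
  move=> mN Nm pn res un.
  have pN := maximal_prime mN; have [iN nN1 pM] := pN.
  pose emb b : complexification Y := (b, 0).
  have embM b c : emb (b * c) = emb b * emb c by congr (_, _) => /=; ring.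
  have pn' : prime_ideal [set b | N (emb b)].
    split=> [||b c /=].
    - split=> [|b c /= Nb Nc|b c /= Nc]; first exact: ideal0 iN.
        have -> : emb (b + c) = emb b + emb c by congr (_, _) => /=; ring.
        exact: idealD.
      by rewrite embM; exact: idealMl.
    - exact: nN1.
    - by rewrite embM => /pM.
  have m0 : m 0 by have := ideal0 (preimage_ideal (cxmap pi) iN); rewrite -[_ @^-1` _]/(complex_map pi N) Nm => -[].
  have en := un _ pn' _.
  have {}en : [set b | N (emb b)] = n.
    apply: en => a; have -> : [set b | N (emb b)] (pi a) = complex_map pi N (a, 0).
      by rewrite /complex_map /emb /= rmorph0.
    by rewrite Nm; split=> [[]|ma].
  have [_ _ maxn] := maxC m n pn res; apply: maxn => //.
  move=> [b1 b2]; rewrite -en => -[/= N1 N2].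
  have -> : (b1, b2) = emb b1 + ((0, 1) : complexification Y) * emb b2.
    by congr (_, _) => /=; ring.
  by apply: idealD => //; exact: idealMl.
split.
- by move=> N [].
- move=> N1 N2 /set_mem[m1 [m mR e1]] /set_mem[m2 _] e12.
  have [n [pn ov res un]] := fibre m mR.
  by rewrite (point N1 m n) // (point N2 m n) // -e12 -e1.
- move=> _ [m mR <-]; have [n [pn ov res un]] := fibre m mR.
  exists (real_to_complex n); last exact: contr_real.
  split; first exact: (maxC m).
  by exists m; rewrite // (contr_real n m).
Qed.
End Bijective.

Lemma affine_real (R : realType) (Y : affScheme R) : real_affine_variety Y ->
  forall s : seq Y, \sum_(b <- s) b ^+ 2 = 0 -> forall b, b \in s -> b = 0.
Proof.
move=> [n [phi [_ phiS [_ rphi]]]] s e.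
have [ps sE] : exists ps, s = map phi ps.
  elim: s {e} => [|b s [ps ->]]; first by exists [::].
  by have [P <-] := phiS b; exists (P :: ps).
move=> b; rewrite sE => /mapP[P Pps ->]; apply: (rphi ps) => //.
rewrite /= rmorph_sum -[RHS]e sE big_map; apply: eq_bigr => i _.
by rewrite rmorphXn.
Qed.

Lemma preimage_real (A B : comPzRingType) (f : {rmorphism A -> B}) (q : set B) :
  real_ideal q -> real_ideal (f @^-1` q).
Proof.
move=> [iq rq]; split; first exact: preimage_ideal.
move=> s qs a as_; apply: (rq (map f s)); last exact: map_f.
rewrite big_map; move: qs; rewrite /preimage /= rmorph_sum.
by congr (q _); apply: eq_bigr => i _; rewrite rmorphXn.
Qed.

Section Span.
Variables (A B : comPzRingType) (f : {rmorphism A -> B}) (s : seq B).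
Let span b := exists a : 'I_(size s) -> A, b = \sum_(i < size s) f (a i) * s`_i.

Lemma span_lin (T : Type) (r : seq T) (F : T -> B) (a : T -> A) :
  (forall i, span (F i)) -> span (\sum_(i <- r) f (a i) * F i).
Proof.
move=> h; elim: r => [|x r [c e]].
  by rewrite big_nil; exists (fun=> 0); rewrite big1// => i _; rewrite rmorph0 mul0r.
have [d e'] := h x; rewrite big_cons e e'; exists (fun i => a x * d i + c i).
by rewrite mulr_sumr -big_split /=; apply: eq_bigr => i _; rewrite rmorphD rmorphM /=; ring.
Qed.

Lemma span_mem b : b \in s -> span b.
Proof.
move=> bs; have k : (index b s < size s)%N by rewrite index_mem.
exists (fun i => (i == Ordinal k)%:R).
rewrite (bigD1 (Ordinal k))//= eqxx rmorph1 mul1r nth_index// big1 ?addr0// => i /negPf->.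
by rewrite rmorph0 mul0r.
Qed.
End Span.

Lemma module_finite_comp (A C B : comPzRingType) (f : {rmorphism A -> C}) (g : {rmorphism C -> B}) :
  module_finite f -> module_finite g -> module_finite (g \o f).
Proof.
move=> [s sP] [t tP]; pose st := [seq g x * y | x <- s, y <- t]; exists st => b.
have [c ->] := tP b; have [a aP] := choice (fun i => sP (c i)).
have -> : \sum_(i < size t) g (c i) * t`_i =
    \sum_(ij <- [seq (i, j) | i <- enum 'I_(size t), j <- enum 'I_(size s)])
      (g \o f) (a ij.1 ij.2) * (g s`_ij.2 * t`_ij.1).
  rewrite big_allpairs_dep /= big_enum /=; apply: eq_bigr => i _.
  rewrite {1}aP rmorph_sum mulr_suml big_enum /=; apply: eq_bigr => j _.
  by rewrite rmorphM mulrA.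
apply: (@span_lin _ _ (g \o f) st) => -[i j].
have := @span_mem _ _ (g \o f) st; apply.
by apply: (allpairs_f (fun x y => g x * y)); exact: mem_nth.
Qed.

Section Factorization.
Variables (R : realType) (X Y Z : affScheme R).
Hypothesis hX : real_affine_variety X.
Hypothesis hY : real_affine_variety Y.
Variables (rho : morphism Y Z) (piZ : morphism Z X).
Hypothesis hrho : finite_morphism rho.
Hypothesis hpiZ : finite_morphism piZ.
Let pi := morphism_comp piZ rho.
Let Xplus := Rseminormalization pi.

Lemma int_pi b : integral pi b.
Proof. exact: module_finite_integral (module_finite_comp hpiZ hrho) b. Qed.

Lemma int_plus (b : Xplus) : integral (Rseminormalization_map pi) b.
Proof.
have [d [a e]] := int_pi (val b); exists d, a; apply: val_inj.
rewrite rmorph0 -[RHS]e rmorphD rmorphXn rmorph_sum; congr (_ + _).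
by apply: eq_bigr => i _; rewrite rmorphM rmorphXn.
Qed.

Lemma int_val (b : Y) : integral (val : Xplus -> Y) b.
Proof. by have [d [a e]] := int_pi b; exists d, (Rplus_incl pi \o a). Qed.

(** A prime of A+ is the contraction of a prime of [Y]. *)
Lemma plus_rational (p : realSpec X) b : fibrewise_rational (Rseminormalization_map pi) p b.
Proof.
have bR : Rplus pi (val b) by apply: set_mem; exact: valP b.
have [a [s [ns h]]] := Rplus_rational int_pi p bR; exists a, s; split=> // P pP ov.
have [|Q pQ ovQ] := @lying_over Xplus Y (val : {rmorphism RplusRing pi -> Y}) int_val P pP.
  have [iP _ _] := pP.
  by move=> c c0; rewrite (_ : c = 0); [exact: ideal0|apply: val_inj; rewrite c0 rmorph0].
apply/ovQ; rewrite rmorphB rmorphM /=; apply: h => // x.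
by rewrite -ov -ovQ.
Qed.

(** A prime of [Z] is the contraction of a prime of A+. *)
Lemma factor_rational (f : {rmorphism Z -> Xplus}) :
  (forall a, f (piZ a) = Rplus_incl pi a) -> injective f ->
  forall (p : realSpec X) c, fibrewise_rational piZ p c.
Proof.
move=> fE finj p c; have [a [s [ns h]]] := plus_rational p (f c).
exists a, s; split=> // q pq ov.
have int_f b : integral f b.
  have [d [e eE]] := int_plus b; exists d, (piZ \o e); rewrite -[RHS]eE; congr (_ + _).
  by apply: eq_bigr => i _; rewrite /= fE.
have [|P pP ovP] := @lying_over Z Xplus f int_f q pq.
  move=> z z0; have [iq _ _] := pq.
  by rewrite (_ : z = 0); [exact: ideal0|apply: finj; rewrite z0 rmorph0].
apply/ovP; rewrite rmorphB rmorphM /= !fE; apply: h => // x.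
by rewrite -ov -ovP fE.
Qed.

Lemma int_piZ c : integral piZ c.
Proof. exact: module_finite_integral hpiZ c. Qed.

Lemma rational_Rplus : (forall (p : realSpec X) c, fibrewise_rational piZ p c) -> forall c, Rplus pi (rho c).
Proof.
move=> rat c p; apply: (rational_Rplus_at int_pi).
have [a [s [ns h]]] := rat p c; exists a, s; split=> // Q pQ ov.
have := h _ (preimage_prime rho pQ).
by rewrite /preimage /= rmorphB rmorphM; apply => x; exact: ov.
Qed.

Section Factor.
Hypothesis rhoP : forall c, Rplus pi (rho c).
Definition factor_fun (c : Z) : RplusRing pi := exist _ (rho c) (mem_set (rhoP c)).
Fact factor_zmod : zmod_morphism factor_fun.
Proof. by move=> a b; apply: val_inj; rewrite /= !rmorphB. Qed.
Fact factor_monoid : monoid_morphism factor_fun.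
Proof. by split=> [|a b]; apply: val_inj; rewrite /= ?rmorph1 ?rmorphM. Qed.
HB.instance Definition _ := GRing.isZmodMorphism.Build Z (RplusRing pi) factor_fun factor_zmod.
HB.instance Definition _ := GRing.isMonoidMorphism.Build Z (RplusRing pi) factor_fun factor_monoid.

Fact factor_scalar c : factor_fun (scalar Z c) = scalar Xplus c.
Proof. by apply: val_inj; rewrite /= !comorphism_scalar. Qed.
Fact factor_inj : injective factor_fun.
Proof. by move=> a b /(congr1 val)/= /comorphism_inj. Qed.

Definition factor_morphism : morphism Xplus Z :=
  @Morphism R Xplus Z (factor_fun : {rmorphism _ -> _}) factor_scalar factor_inj.

Lemma factor_morphismP : morphism_comp piZ factor_morphism =1 Rseminormalization_map pi.
Proof. by move=> a; apply: val_inj. Qed.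
End Factor.

(** Suppose that two factorizations differ at [c], and let a real prime of [Y]
    avoid the difference. It contracts to a prime of [Z] along both
    factorizations, and both contractions lie over the same real prime of [X],
    so that both images of [c] have the value a/s there. *)
Lemma factor_unique (f g : morphism Xplus Z) :
  morphism_comp piZ f =1 Rseminormalization_map pi ->
  morphism_comp piZ g =1 Rseminormalization_map pi -> g =1 f.
Proof.
move=> fE gE c; apply: contrapT => ne.
have rat := factor_rational fE (@comorphism_inj _ _ _ f).
have w0 : val (f c - g c) <> 0 by move=> e; apply: ne; apply/esym/eqP; rewrite -subr_eq0; apply/eqP/val_inj.
have [Q [pQ rQ nQ]] := real_prime_avoiding (affine_real hY) w0.
pose P := (val : {rmorphism RplusRing pi -> Y}) @^-1` Q.
have pP : prime_ideal P := preimage_prime _ pQ.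
pose p := RealSpec (preimage_prime pi pQ) (preimage_real pi rQ).
have [a [s [ns h]]] := rat p c; have [iP _ pM] := pP.
have hP (k : morphism Xplus Z) : morphism_comp piZ k =1 Rseminormalization_map pi ->
    P (Rplus_incl pi s * k c - Rplus_incl pi a).
  move=> kE; have := h _ (preimage_prime k pP); rewrite /preimage /= rmorphB rmorphM.
  rewrite -[k (piZ s)]/(morphism_comp piZ k s) -[k (piZ a)]/(morphism_comp piZ k a) !kE.
  apply=> x; rewrite /= -[k (piZ x)]/(morphism_comp piZ k x) kE.
  by [].
have : P (Rplus_incl pi s * (f c - g c)).
  have -> : Rplus_incl pi s * (f c - g c) = (Rplus_incl pi s * f c - Rplus_incl pi a) -
     (Rplus_incl pi s * g c - Rplus_incl pi a) by ring.
  by apply: idealB => //; exact: hP.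
by case/pM => // Ps; apply: ns.
Qed.

(** A prime of A+ over a real prime [p] of [Z] also lies over the contraction of
    [p] to [X]. *)
Lemma factor_bijective (f : morphism Xplus Z) :
  morphism_comp piZ f =1 Rseminormalization_map pi -> bijective_over_real f.
Proof.
move=> fE; apply: bijective_of_rational => [b|p b].
  have [d [e eE]] := int_plus b; exists d, (piZ \o e); rewrite -[RHS]eE; congr (_ + _).
  by apply: eq_bigr => i _; rewrite -fE.
pose p0 := RealSpec (preimage_prime piZ (real_primeP p)) (preimage_real piZ (real_primeR p)).
have [a [s [ns h]]] := plus_rational p0 b; exists (piZ a), (piZ s); split=> // q pq ov.
rewrite -[f (piZ s)]/(morphism_comp piZ f s) -[f (piZ a)]/(morphism_comp piZ f a) !fE.
apply: h => // x; rewrite -fE; exact: ov.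
Qed.
End Factorization.

Theorem theorem2p5 (R : realType) (X Y Z : affScheme R)
    (hX : real_affine_variety X) (hY : real_affine_variety Y)
    (hZ : real_affine_variety Z)
    (rho : morphism Y Z) (piZ : morphism Z X)
    (hrho : finite_morphism rho) (hpiZ : finite_morphism piZ) :
  let pi := morphism_comp piZ rho in
  let Xplus := Rseminormalization pi in
  let factors (piZplus : morphism Xplus Z) :=
    morphism_comp piZ piZplus =1 Rseminormalization_map pi in
  (bijective_over_real piZ <-> exists piZplus : morphism Xplus Z, factors piZplus)
  /\ (forall piZplus : morphism Xplus Z, factors piZplus ->
        (forall piZplus' : morphism Xplus Z,
           factors piZplus' -> piZplus' =1 piZplus)
        /\ bijective_over_real piZplus).
Proof.
move=> pi Xplus factors; split; last first.
  move=> f fE; split; last exact: factor_bijective fE.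
  by move=> g gE; exact: factor_unique fE gE.
split=> [bij|[f fE]].
  have rat (p : realSpec X) c : fibrewise_rational piZ p c by exact: rational_fibre.
  have rhoP := rational_Rplus hrho hpiZ rat.
  by exists (factor_morphism rhoP); exact: factor_morphismP.
apply: bijective_of_rational; first exact: int_piZ.
exact: (factor_rational hrho hpiZ fE (@comorphism_inj _ _ _ f)).
Qed.
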